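(* Let $(I,\mathbf\Lambda)$ be a Bruhat–Tits index and let $k$ be an algebraically closed field containing $\kappa$. Under the identification of $\mathcal N^{\mathbf h}_{E/F}(k)$ with a set of lattice chains, the set of $k$-rational points of the closed subscheme $\mathcal N^{\mathbf h}_{I,\mathbf\Lambda}$ coincides with the set of points $(A_m\subset\dots\subset A_1\subset B_1\subset\dots\subset B_m)\in\mathcal N^{\mathbf h}_{E/F}(k)$ such that $\pi(\Lambda_0^i)^\vee_k\subset\pi B_i^\vee$ and $B_i\subset(\Lambda_0^i)_k$ for all $i\in I\setminus\{0\}$, and $\pi^2(\Lambda_1^j)_k^\vee\subset\pi^2A_{j+1}^\vee$ and $A_{j+1}\subset(\Lambda_1^j)_k$ for all $j\in I\setminus\{m\}$.
   Context: Fields. $p$ is an odd prime, $F/\mathbb Q_p$ a finite extension with ring of integers $\mathcal O_F$, uniformizer $\pi$, residue field $\mathbb F_q$; $E/F$ is the unramified quadratic extension with nontrivial automorphism $x\mapsto x^*$; $\breve E$ is the completion of the maximal unramified extension of $E$, with residue field $\kappa=\overline{\mathbb F}_{q}$. For a perfect field $R\supset\mathbb F_q$, $W_{\mathcal O_F}(R)$ is the ring of relative Witt vectors, $F_R$ its fraction field, $\sigma$ the lift of $x\mapsto x^q$. Fix $n,m\ge 1$ and integers $\mathbf h=(h_1<\dots<h_m)$, $0\le h_i\le n$, all of the same parity. Framing objects. A strict formal $\mathcal O_F$-module is a formal $p$-divisible group with $\mathcal O_F$-action inducing the natural action on its Lie algebra. For $h\in\{h_1,\dots,h_m\}$ fix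 $\mathbb X^{[h]}=(\mathbb X,i_{\mathbb X},\lambda^{[h]})$: $\mathbb X$ a supersingular strict formal $\mathcal O_F$-module over $\mathbb F_{q^2}$ of relative $F$-height $2n$; $i_{\mathbb X}$ an $\mathcal O_E$-action extending the $\mathcal O_F$-action with $\mathrm{charpol}(i_{\mathbb X}(x)\mid\mathrm{Lie})=(T-x)(T-x^* )^{n-1}$; $\lambda^{[h]}$ an $\mathcal O_E$-linear polarization (the dual having the action $i_{\mathbb X}(x^* )^\vee$) with kernel contained in $\mathbb X[\pi]$ of order $q^{2h}$. For $h<h'$ among the $h_i$ fix isogenies $\alpha_{h',h}:\mathbb X^{[h']}\to\mathbb X^{[h]}$, compatible with composition, $\mathcal O_E$-actions and polarizations (inducing isometries of Dieudonné isocrystals), with kernel in the $\pi$-torsion of order $q^{h'-h}$; $\alpha_{h,h}=\mathrm{id}$. Moduli space. For an $\mathcal O_E$-scheme $S$ on which $\pi$ is locally nilpotent, with $\bar S=S\times_{\mathcal O_F}\mathbb F_q$, $\mathcal N^h(S)$ is the set of isomorphism classes of $(X,i_X,\lambda_X,\rho_X)$: $X$ a strict formal $\mathcal O_F$-module over $S$ of relative height $2n$, $i_X$ an $\mathcal O_E$-action extending the $\mathcal O_F$-action with $\mathrm{charpol}(i_X(x)\mid\mathrm{Lie}X)=(T-x)(T-x^* )^{n-1}$, $\lambda_X$ an $\mathcal O_E$-linear polarization, $\rho_X:X_{\bar S}\to\mathbb X^{[h]}_{\bar S}$ an $\mathcal O_E$-linear quasi-isogeny of height $0$ with $\rho_X^\vee\lambda^{[h]}\rho_X=\lambda_X$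 up to a scalar in $\mathcal O_F^\times$. $\mathcal N^{\mathbf h}(S)$ is the set of tuples $(X^{[i]},i_{X^{[i]}},\lambda_{X^{[i]}},\rho_{X^{[i]}})_{1\le i\le m}$ (up to isomorphism) of elements of $\mathcal N^{h_i}(S)$ such that $\rho_{X^{[i]}}^{-1}\circ\alpha_{h_{i+1},h_i}\circ\rho_{X^{[i+1]}}$ lifts to an isogeny $X^{[i+1]}\to X^{[i]}$ for $1\le i<m$. After base change to $\mathcal O_{\breve E}$ it is represented by a formal scheme $\mathcal N^{\mathbf h}_{E/F}$; $\mathcal N^{\mathbf h}_{E/F,\mathrm{red}}$ is the reduced special fiber, over $\kappa$. Hermitian space. Let $\mathbb N$ be the rational relative Dieudonné module of $\mathbb X^{[h_1]}$, with $\mathcal F,\mathcal V$ ($\mathcal F\mathcal V=\pi$) and pairing $\langle\cdot,\cdot\rangle$ induced by $\lambda^{[h_1]}$, with $\langle\mathcal Fv,w\rangle=\langle v,\mathcal Vw\rangle^\sigma$ and $\langle i(x)v,w\rangle=\langle v,i(x^* )w\rangle$. For $k\supset\kappa$ algebraically closed, $\mathbb N_k=\mathbb N\otimes F_k=\mathbb N_{k,0}\oplus\mathbb N_{k,1}$, where $E$ acts on $\mathbb N_{k,0}$ via a fixed $F$-isomorphism $\varphi_0:E\simeq F_{\mathbb F_{q^2}}$ and on $\mathbb N_{k,1}$ via its conjugate. Put $\tau=\pi\mathcal V^{-2}$ and $C=\mathbb N_{k,0}^\tau$, an $n$-dimensional $F_{\mathbb F_{q^2}}$-space independent of $k$, with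 $C_k:=C\otimes F_k=\mathbb N_{k,0}$, $\tau=\mathrm{id}\otimes\sigma^2$. The form $\{v,w\}=\delta\langle v,\mathcal Fw\rangle$ (fixed $\delta\in W_{\mathcal O_F}(\mathbb F_{q^2})^\times$, $\delta^\sigma=-\delta$) is left linear, right $\sigma$-linear, nondegenerate on $C_k$, hermitian on $C$. For a lattice $A$, $A^\vee$ is the set of $v$ with $\{v,A\}$ integral. $A\overset{x}{\subset}B$ means $A\subset B$ with $B/A$ of length $x$. $\Lambda_k=\Lambda\otimes W_{\mathcal O_F}(k)$ for a lattice $\Lambda\subset C$. Points. By relative Dieudonné theory $\mathcal N^{\mathbf h}_{E/F}(k)$ is identified with the set of chains of $W_{\mathcal O_F}(k)$-lattices $A_m\subset\dots\subset A_1\subset B_1\subset\dots\subset B_m$ in $C_k$ such that for all $i$: $\pi A_i^\vee\overset{1}{\subset}B_i\subset A_i^\vee$, $\pi B_i^\vee\overset{1}{\subset}A_i\subset B_i^\vee$, $\pi B_i\subset A_i\overset{h_i}{\subset}B_i$. Explicitly, if $M_i\subset\mathbb N_k$ is the image of the Dieudonné module of $X^{[i]}$ under $\alpha_{h_i,h_1}\circ\rho_{X^{[i]}}$, then $A_i=(M_i)_0$ and $B_i=\{x\in\mathbb N_{k,0}:\langle x,(M_i)_1\rangle\subset W_{\mathcal O_F}(k)\}$. Vertex lattices. $\mathcal L_i$ is the set of $W_{\mathcal O_F}(\mathbb F_{q^2})$-lattices $\Lambda\subset C$ with $\pi^{i+1}\Lambda^\vee\subset\Lambda\subset\pi^i\Lambda^\vee$;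 the type of $\Lambda\in\mathcal L_i$ is $t(\Lambda)=[\Lambda:\pi^{i+1}\Lambda^\vee]$; $\mathcal L_i^{\ge x}=\{\Lambda\in\mathcal L_i: t(\Lambda)\ge x\}$. Bruhat–Tits index. A pair $(I,\mathbf\Lambda)$: $I$ a non-empty subset of $\{0,\dots,m\}$ with $0\notin I$ if $h_1=0$ and $m\notin I$ if $h_m=n$; $\mathbf\Lambda$ a collection of $\Lambda_0^i\in\mathcal L_0^{\ge h_i+1}$ for $i\in I\setminus\{0\}$ and $\Lambda_1^j\in\mathcal L_1^{\ge n-h_{j+1}+1}$ for $j\in I\setminus\{m\}$ such that, writing $I=\{i_1<\dots<i_s\}$, $\Lambda_0^{i_1}\subset\pi\Lambda_1^{i_1\vee}\subset\Lambda_0^{i_2}\subset\pi\Lambda_1^{i_2\vee}\subset\dots\subset\Lambda_0^{i_s}\subset\pi\Lambda_1^{i_s\vee}$, where the first term is omitted if $i_1=0$ and the last term is omitted if $i_s=m$. Closed subscheme. For $i\in I\setminus\{0\}$ and $j\in I\setminus\{m\}$ put $\Lambda_0^{i-}=\alpha_{h_i,h_1}^{-1}(\pi\Lambda_0^{i\vee}\oplus\mathcal V(\Lambda_0^{i\vee}))$ and $\Lambda_1^{j+}=\alpha_{h_{j+1},h_1}^{-1}(\Lambda_1^j\oplus\mathcal V^{-1}(\Lambda_1^j))$. These are relative Dieudonné modules of strict formal $\mathcal O_F$-modules $X_{\Lambda_0^{i-}},X_{\Lambda_1^{j+}}$, coming with quasi-isogenies $\rho_{\Lambda_0^{i-}}:X_{\Lambda_0^{i-}}\to\mathbb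 X^{[h_i]}$ and $\rho_{\Lambda_1^{j+}}:X_{\Lambda_1^{j+}}\to\mathbb X^{[h_{j+1}]}$ over $\kappa$. $\mathcal N^{\mathbf h}_{I,\mathbf\Lambda}$ is the subfunctor of $\mathcal N^{\mathbf h}_{E/F}\otimes\kappa$ whose $S$-points ($S$ a $\kappa$-scheme) are those for which $\rho_{X^{[i]}}^{-1}\circ(\rho_{\Lambda_0^{i-}})_S$ and $(\rho_{\Lambda_1^{j+}})_S^{-1}\circ\rho_{X^{[j+1]}}$ are isogenies for all $i\in I\setminus\{0\}$, $j\in I\setminus\{m\}$; it is represented by a projective closed subscheme of $\mathcal N^{\mathbf h}_{E/F,\mathrm{red}}$. *)

(* Defs.v *)
From mathcomp Require Import all_boot all_order all_algebra all_field.
From mathcomp.multinomials Require Import mpoly.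

Set Implicit Arguments.
Unset Strict Implicit.
Unset Printing Implicit Defensive.

Import GRing.Theory.
Local Open Scope ring_scope.

(* Subsets of a type are predicates [T -> Prop]. *)
Definition incl (T : Type) (A B : T -> Prop) := forall v, A v -> B v.

(** * Local fields and relative Witt vectors *)

(* [O] is a discrete valuation ring with fraction field [K], uniformizer [u]
   and residue map [res : O -> R] (extended by junk outside [O]). *)
Record is_dvr (K R : fieldType) (O : K -> Prop) (u : K) (res : K -> R) : Prop :=
  IsDvr {
    dvr_one : O 1;
    dvr_sub : forall x y, O x -> O y -> O (x - y);
    dvr_mul : forall x y, O x -> O y -> O (x * y);
    dvr_unif : O u /\ ~ O u^-1;
    dvr_val : forall x, x != 0 ->
      exists (z : int) (e : K), [/\ O e, O e^-1 & x = e * u ^ z];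
    dvr_res1 : res 1 = 1;
    dvr_resB : forall x y, O x -> O y -> res (x - y) = res x - res y;
    dvr_resM : forall x y, O x -> O y -> res (x * y) = res x * res y;
    dvr_res_surj : forall r, exists2 x, O x & res x = r;
    dvr_res_ker : forall x, O x -> (res x = 0 <-> O (x / u))
  }.

Definition adic_complete (K : fieldType) (O : K -> Prop) (u : K) : Prop :=
  forall s : nat -> K, (forall i, O (s i)) ->
    (forall i, O ((s i.+1 - s i) / u ^+ i)) ->
    exists l, forall i, O ((l - s i) / u ^+ i).

Definition integral_closure (K : fieldType) (L : fieldExtType K)
    (O : K -> Prop) (x : L) : Prop :=
  exists P : {poly K},
    [/\ P \is monic, (forall i, O P`_i) & root (map_poly (in_alg L) P) x].

(* An odd prime p, a finite extension F/Q_p with uniformizer [unif] and residue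
   field [Fq], and the unramified quadratic extension E/F with its nontrivial
   automorphism [conjE]. Q_p is the fraction field of the complete discrete
   valuation ring with uniformizer p and residue field F_p. *)
Record local_fields := LocalFields {
  lp : nat;
  lp_prime : prime lp;
  lp_odd : odd lp;
  Qp : fieldType;
  Zp : Qp -> Prop;
  resQp : Qp -> 'F_lp;
  Qp_dvr : is_dvr Zp lp%:R resQp;
  Qp_complete : adic_complete Zp lp%:R;
  fldF : fieldExtType Qp;
  unif : fldF;
  Fq : finFieldType;
  resF : fldF -> Fq;
  F_dvr : is_dvr (integral_closure (L := fldF) Zp) unif resF;
  fldE : fieldExtType fldF;
  E_quadratic : \dim {:fldE} = 2%N;
  conjE : {rmorphism fldE -> fldE};
  conjE_F : forall a : fldF, conjE a%:A = a%:A;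
  conjE_nontrivial : exists x, conjE x != x;
  FqE : finFieldType;
  resE : fldE -> FqE;
  E_unramified :
    is_dvr (integral_closure (L := fldE) (integral_closure (L := fldF) Zp))
           unif%:A resE;
  FqE_card : #|FqE| = (#|Fq| ^ 2)%N
}.

Definition OF (L : local_fields) : fldF L -> Prop :=
  integral_closure (L := fldF L) (@Zp L).
Definition OE (L : local_fields) : fldE L -> Prop :=
  integral_closure (L := fldE L) (@OF L).
Definition q (L : local_fields) : nat := #|Fq L|.

(* For a perfect field R over F_q, the ring W_{O_F}(R) is characterized, up to a
   unique isomorphism, as the complete discrete valuation ring over O_F with
   uniformizer pi and residue F_q-algebra R; [wK] is its fraction field F_R and
   [frob] the lift of the q-Frobenius. *)
Record witt (L : local_fields) (R : fieldType) := Witt {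
  Fq_emb : {rmorphism Fq L -> R};
  witt_perfect : forall x : R, exists y, y ^+ lp L = x;
  wK : fieldType;
  wW : wK -> Prop;
  wres : wK -> R;
  wF : {rmorphism fldF L -> wK};
  wW_dvr : is_dvr wW (wF (unif L)) wres;
  wW_complete : adic_complete wW (wF (unif L));
  wF_int : forall a, OF a -> wW (wF a);
  wF_res : forall a, OF a -> wres (wF a) = Fq_emb (resF a);
  frob : {rmorphism wK -> wK};
  frob_bij : bijective frob;
  frob_F : forall a, frob (wF a) = wF a;
  frob_int : forall x, wW x -> wW (frob x);
  frob_res : forall x, wW x -> wres (frob x) = wres x ^+ q L
}.

Definition wpi L R (W : witt L R) : wK W := wF W (unif L).

Record witt_morph L R R' (W : witt L R) (W' : witt L R') := WittMorph {
  mR : {rmorphism R -> R'};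
  mK : {rmorphism wK W -> wK W'};
  mK_F : forall a, mK (wF W a) = wF W' a;
  mK_int : forall x, wW x -> wW (mK x);
  mK_res : forall x, wW x -> wres (mK x) = mR (wres x);
  mK_frob : forall x, mK (frob W x) = frob W' (mK x)
}.

(* phi0 : E ~ F_{F_{q^2}} over F. It is normalized by the residue maps, so that
   it induces the structure morphism O_E -> F_{q^2} used for the moduli problem. *)
Record is_phi0 L (W0 : witt L (FqE L)) (phi0 : {rmorphism fldE L -> wK W0}) :
    Prop := IsPhi0 {
  phi0_bij : bijective phi0;
  phi0_F : forall a : fldF L, phi0 a%:A = wF W0 a;
  phi0_res : forall x, OE x -> wres (phi0 x) = resE x
}.

Definition alg_closed (R : fieldType) : Prop :=
  forall P : {poly R}, size P != 1%N -> exists x, root P x.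

Definition is_alg_closure (R0 R : fieldType) (f : {rmorphism R0 -> R}) : Prop :=
  alg_closed R /\
  forall x, exists2 P : {poly R0}, P != 0 & root (map_poly f P) x.

(** * Lattices *)

Section Lattices.
Variables (K : fieldType) (V : vectType K) (O : K -> Prop).
Implicit Types A B S : V -> Prop.

Definition is_submod A : Prop :=
  [/\ A 0, (forall v w, A v -> A w -> A (v - w))
    & (forall a v, O a -> A v -> A (a *: v))].

Definition span_over S (v : V) : Prop :=
  exists (N : nat) (a : 'I_N -> K) (s : 'I_N -> V),
    [/\ forall i, O (a i), forall i, S (s i) & v = \sum_i a i *: s i].

Definition is_lattice A : Prop :=
  exists e : (\dim {:V}).-tuple V,
    basis_of {:V} e /\ forall v, A v <-> forall i, O (coord e i v).

Definition scale_set (c : K) A (v : V) : Prop := exists2 w, A w & v = c *: w.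

(* [colength A B x]: A is contained in B and B/A has length x over O. *)
Definition colength A B (x : nat) : Prop :=
  exists M : nat -> V -> Prop,
    [/\ forall i, (i <= x)%N -> is_submod (M i),
        forall v, M 0%N v <-> A v,
        forall v, M x v <-> B v
      & forall i, (i < x)%N ->
          [/\ incl (M i) (M i.+1), ~ incl (M i.+1) (M i)
            & forall S, is_submod S -> incl (M i) S -> incl S (M i.+1) ->
                incl S (M i) \/ incl (M i.+1) S]].

End Lattices.

(** * Formal power series and formal groups *)

Definition fps (R : fieldType) (n : nat) := 'X_{1..n} -> R.
(* m-tuples of power series in n variables *)
Definition fpsmap (R : fieldType) (n m : nat) := 'I_m -> fps R n.

Section PowerSeries.
Variable R : fieldType.

Definition trunc n (N : nat) (f : fps R n) : {mpoly R[n]} :=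
  \sum_(m : 'X_{1..n < N}) f m *: 'X_[m].

Definition fps_mul n (f g : fps R n) : fps R n :=
  fun m => (trunc (mdeg m).+1 f * trunc (mdeg m).+1 g)@_m.

(* Composition f o g; only meaningful if g has zero constant terms. *)
Definition fcomp n m l (f : fpsmap R n m) (g : fpsmap R l n) : fpsmap R l m :=
  fun i a => (trunc (mdeg a).+1 (f i) \mPo
              [tuple trunc (mdeg a).+1 (g j) | j < n])@_a.

Definition no_const n m (f : fpsmap R n m) : Prop := forall i, f i 0%MM = 0.

Definition var n (i : 'I_n) : fps R n := fun m => (m == U_(i)%MM)%:R.
Definition fid n : fpsmap R n n := @var n.
Definition fzero n m : fpsmap R n m := fun _ _ => 0.

Definition jac n m (f : fpsmap R n m) : 'M[R]_(m, n) :=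
  \matrix_(i, j) f i U_(j)%MM.

(* Phi(f, g) for a series Phi in two blocks of d variables *)
Definition app2 d l (Phi : fpsmap R (d + d) d) (f g : fpsmap R l d) : fpsmap R l d :=
  fcomp Phi (fun j => match split j with inl a => f a | inr b => g b end).

(* ideal generated by f_1, ..., f_m *)
Definition in_ideal n m (f : fpsmap R n m) (g : fps R n) : Prop :=
  exists a : 'I_m -> fps R n, forall e, g e = \sum_i fps_mul (a i) (f i) e.

(* The closed subgroup Ker f = Spf R[[x]]/(f) is finite of order N. *)
Definition ker_order n m (f : fpsmap R n m) (N : nat) : Prop :=
  exists b : 'I_N -> fps R n, forall g : fps R n,
    exists! c : 'rV[R]_N, in_ideal f (fun e => g e - \sum_j c 0 j * b j e).

(* Ker f is contained in Ker g. *)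
Definition ker_sub n m m' (f : fpsmap R n m) (g : fpsmap R n m') : Prop :=
  forall i, in_ideal f (g i).

Definition isogeny n m (f : fpsmap R n m) : Prop :=
  n = m /\ exists N, ker_order f N.

End PowerSeries.

(* A formal group law of dimension d with multiplication maps [oact a], which
   are relevant for a in O_F only; the axioms are in [is_sfm]. *)
Record fmod (L : local_fields) (R : fieldType) := Fmod {
  fdim : nat;
  fgl : fpsmap R (fdim + fdim) fdim;
  oact : fldF L -> fpsmap R fdim fdim
}.

Arguments fgl {L R} _.
Arguments oact {L R} _ _.

Definition xblock R d : fpsmap R (d + d) d := fun i => @var R (d + d) (lshift d i).
Definition yblock R d : fpsmap R (d + d) d := fun i => @var R (d + d) (rshift d i).

Record is_fgl (R : fieldType) d (Phi : fpsmap R (d + d) d) : Prop := IsFgl {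
  fgl_const : no_const Phi;
  fgl_unit : app2 Phi (@fid R d) (@fzero R d d) = @fid R d;
  fgl_comm : app2 Phi (@yblock R d) (@xblock R d) = Phi;
  fgl_assoc :
    let x : fpsmap R (d + d + d) d :=
      fun i => @var R (d + d + d) (lshift d (lshift d i)) in
    let y : fpsmap R (d + d + d) d :=
      fun i => @var R (d + d + d) (lshift d (rshift d i)) in
    let z : fpsmap R (d + d + d) d :=
      fun i => @var R (d + d + d) (rshift (d + d) i) in
    app2 Phi (app2 Phi x y) z = app2 Phi x (app2 Phi y z)
}.

Record is_hom L R (X Y : fmod L R) (f : fpsmap R (fdim X) (fdim Y)) : Prop :=
  IsHom {
    hom_const : no_const f;
    hom_add : fcomp f (fgl X) =
      app2 (fgl Y) (fcomp f (@xblock R (fdim X))) (fcomp f (@yblock R (fdim X)));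
    hom_act : forall a, OF a -> fcomp f (oact X a) = fcomp (oact Y a) f
  }.

(* Strict formal O_F-modules over R. *)
Record is_sfm L R (W : witt L R) (X : fmod L R) : Prop := IsSfm {
  sfm_fgl : is_fgl (fgl X);
  sfm_hom : forall a, OF a -> is_hom (X := X) (Y := X) (oact X a);
  sfm_act1 : oact X 1 = @fid R (fdim X);
  sfm_actD : forall a b, OF a -> OF b ->
    oact X (a + b) = app2 (fgl X) (oact X a) (oact X b);
  sfm_actM : forall a b, OF a -> OF b ->
    oact X (a * b) = fcomp (oact X a) (oact X b);
  sfm_strict : forall a, OF a -> jac (oact X a) = (Fq_emb W (resF a))%:M;
  sfm_pdiv : isogeny (oact X (unif L))
}.

(* A quasi-isogeny X -> Y is written pi^(-qN) qf with an isogeny qf. *)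
Record qmap (R : fieldType) (n m : nat) := Qmap { qf : fpsmap R n m; qN : nat }.

Definition is_qisog L R (X Y : fmod L R) (r : qmap R (fdim X) (fdim Y)) : Prop :=
  is_hom (X := X) (Y := Y) (qf r) /\ isogeny (qf r).

Definition qeq L R (X Y : fmod L R) (r s : qmap R (fdim X) (fdim Y)) : Prop :=
  fcomp (qf r) (oact X (unif L ^+ qN s)) = fcomp (qf s) (oact X (unif L ^+ qN r)).

(* r o g and g o r *)
Definition qpre R n m l (r : qmap R n m) (g : fpsmap R l n) : qmap R l m :=
  Qmap (fcomp (qf r) g) (qN r).
Definition qpost R n m l (g : fpsmap R m l) (r : qmap R n m) : qmap R n l :=
  Qmap (fcomp g (qf r)) (qN r).

Definition map_fpsmap (R R' : fieldType) (j : R -> R') n m (f : fpsmap R n m) :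
    fpsmap R' n m :=
  fun i e => j (f i e).
Definition map_fmod L (R R' : fieldType) (j : R -> R') (X : fmod L R) :
    fmod L R' :=
  Fmod (map_fpsmap j (fgl X)) (fun a => map_fpsmap j (oact X a)).
Definition map_qmap (R R' : fieldType) (j : R -> R') n m (r : qmap R n m) :
    qmap R' n m :=
  Qmap (map_fpsmap j (qf r)) (qN r).

(** * Relative Dieudonne theory *)

Record is_dmod L R (W : witt L R) (V : vectType (wK W)) (M : V -> Prop)
    (Fr Ve : V -> V) : Prop := IsDmod {
  dm_lattice : is_lattice (wW (w := W)) M;
  dm_F_semilin : forall a v w, Fr (a *: v + w) = frob W a *: Fr v + Fr w;
  dm_V_semilin : forall a v w, Ve (frob W a *: v + w) = a *: Ve v + Ve w;
  dm_FV : forall v, Fr (Ve v) = wpi W *: v;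
  dm_VF : forall v, Ve (Fr v) = wpi W *: v;
  dm_F_stable : forall v, M v -> M (Fr v);
  dm_V_stable : forall v, M v -> M (Ve v);
  dm_V_nilp : exists N, forall v, M v -> exists2 w, M w & iter N Ve v = wpi W *: w
}.

Record is_dmod_hom L R (W : witt L R) (V V' : vectType (wK W))
    (M : V -> Prop) (M' : V' -> Prop) (Fr Ve : V -> V) (Fr' Ve' : V' -> V')
    (f : V -> V') : Prop := IsDmodHom {
  dh_lin : forall a v w, f (a *: v + w) = a *: f v + f w;
  dh_F : forall v, f (Fr v) = Fr' (f v);
  dh_V : forall v, f (Ve v) = Ve' (f v);
  dh_lattice : forall v, M v -> M' (f v)
}.

(* A covariant relative Dieudonne functor over R: an equivalence from strict
   formal O_F-modules to relative Dieudonne modules with topologically nilpotent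
   V, together with its standard compatibilities (Lie X = M/VM, height = rank,
   order of the kernel of an isogeny = q^length of the cokernel).
   [diso X] is the rational Dieudonne module and [dlat X] the lattice in it. *)
Record dieudonne L R (W : witt L R) := Dieudonne {
  diso : fmod L R -> vectType (wK W);
  dlat : forall X, diso X -> Prop;
  dF : forall X, diso X -> diso X;
  dV : forall X, diso X -> diso X;
  dmap : forall X Y : fmod L R, fpsmap R (fdim X) (fdim Y) -> diso X -> diso Y;
  dlie : forall X : fmod L R, diso X -> 'cV[R]_(fdim X);
  d_mod : forall X, is_sfm W X -> is_dmod (@dlat X) (@dF X) (@dV X);
  d_hom : forall X Y f, is_sfm W X -> is_sfm W Y -> is_hom (X := X) (Y := Y) f ->
    is_dmod_hom (@dlat X) (@dlat Y) (@dF X) (@dV X) (@dF Y) (@dV Y)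
      (dmap (X := X) (Y := Y) f);
  d_id : forall X, is_sfm W X ->
    dmap (X := X) (Y := X) (@fid R (fdim X)) =1 id;
  d_comp : forall X Y Z f g, is_sfm W X -> is_sfm W Y -> is_sfm W Z ->
    is_hom (X := X) (Y := Y) f -> is_hom (X := Y) (Y := Z) g ->
    dmap (X := X) (Y := Z) (fcomp g f) =1
      dmap (X := Y) (Y := Z) g \o dmap (X := X) (Y := Y) f;
  d_add : forall X Y f g, is_sfm W X -> is_sfm W Y ->
    is_hom (X := X) (Y := Y) f -> is_hom (X := X) (Y := Y) g ->
    forall v, dmap (X := X) (Y := Y) (app2 (fgl Y) f g) v =
      dmap (X := X) (Y := Y) f v + dmap (X := X) (Y := Y) g v;
  d_act : forall X a, is_sfm W X -> OF a ->
    forall v, dmap (X := X) (Y := X) (oact X a) v = wF W a *: v;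
  d_faithful : forall X Y f g, is_sfm W X -> is_sfm W Y ->
    is_hom (X := X) (Y := Y) f -> is_hom (X := X) (Y := Y) g ->
    dmap (X := X) (Y := Y) f =1 dmap (X := X) (Y := Y) g -> f = g;
  d_full : forall X Y phi, is_sfm W X -> is_sfm W Y ->
    is_dmod_hom (@dlat X) (@dlat Y) (@dF X) (@dV X) (@dF Y) (@dV Y) phi ->
    exists2 f, is_hom (X := X) (Y := Y) f & dmap (X := X) (Y := Y) f =1 phi;
  d_ess_surj : forall (V : vectType (wK W)) M Fr Ve, is_dmod (V := V) M Fr Ve ->
    exists2 X, is_sfm W X & exists phi : diso X -> V,
      [/\ is_dmod_hom (@dlat X) M (@dF X) (@dV X) Fr Ve phi, bijective phi
        & forall v, M (phi v) -> dlat v];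
  d_lie_lin : forall X (a : wK W) (v w : diso X), is_sfm W X ->
    wW a -> dlat v -> dlat w -> dlie (a *: v + w) = wres a *: dlie v + dlie w;
  d_lie_surj : forall X (t : 'cV[R]_(fdim X)), is_sfm W X ->
    exists2 v : diso X, dlat v & dlie v = t;
  d_lie_ker : forall X (v : diso X), is_sfm W X -> dlat v ->
    (dlie v = 0 <-> exists2 w, dlat w & v = dV w);
  d_lie_nat : forall X Y f (v : diso X), is_sfm W X -> is_sfm W Y ->
    is_hom (X := X) (Y := Y) f -> dlat v ->
    dlie (dmap (X := X) (Y := Y) f v) = jac f *m dlie v;
  d_height : forall X c, is_sfm W X ->
    (ker_order (oact X (unif L)) (q L ^ c)%N <-> \dim {:diso X} = c);
  d_isogeny : forall X Y f, is_sfm W X -> is_sfm W Y ->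
    is_hom (X := X) (Y := Y) f ->
    (isogeny f <-> bijective (dmap (X := X) (Y := Y) f));
  d_order : forall X Y f c, is_sfm W X -> is_sfm W Y ->
    is_hom (X := X) (Y := Y) f -> isogeny f ->
    (ker_order f (q L ^ c)%N <->
     colength (wW (w := W))
       (fun v => exists2 u, dlat u & v = dmap (X := X) (Y := Y) f u) (@dlat Y) c)
}.

(* Compatibility of relative Dieudonne modules with extension of the base field:
   D'(X') = D(X) (x) W_{O_F}(R'). *)
Record base_change L R R' (W : witt L R) (W' : witt L R')
    (D : dieudonne W) (D' : dieudonne W') (j : witt_morph W W') := BaseChange {
  bc : forall X, diso D X -> diso D' (map_fmod (mR j) X);
  bc_sfm : forall X, is_sfm W X -> is_sfm W' (map_fmod (mR j) X);
  bc_semilin : forall X a (v w : diso D X), is_sfm W X ->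
    bc (a *: v + w) = mK j a *: bc v + bc w;
  bc_basis : forall X (e : seq (diso D X)), is_sfm W X ->
    basis_of {:diso D X} e ->
    basis_of {:diso D' (map_fmod (mR j) X)} (map (@bc X) e);
  bc_lat : forall X v, is_sfm W X -> (dlat v <->
    span_over (wW (w := W')) (fun w => exists2 u : diso D X, dlat u & w = bc u) v);
  bc_F : forall X (v : diso D X), is_sfm W X -> bc (dF v) = dF (bc v);
  bc_V : forall X (v : diso D X), is_sfm W X -> bc (dV v) = dV (bc v);
  bc_map : forall X Y f (v : diso D X), is_sfm W X -> is_sfm W Y ->
    is_hom (X := X) (Y := Y) f ->
    bc (dmap (X := X) (Y := Y) f v) =
    dmap (X := map_fmod (mR j) X) (Y := map_fmod (mR j) Y) (map_fpsmap (mR j) f) (bc v);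
  bc_lie : forall X (v : diso D X), is_sfm W X -> dlat v ->
    dlie (bc v) = map_mx (mR j) (dlie v)
}.

Definition dq L R (W : witt L R) (D : dieudonne W) (X Y : fmod L R)
    (r : qmap R (fdim X) (fdim Y)) (v : diso D X) : diso D Y :=
  (wpi W)^-1 ^+ qN r *: dmap (X := X) (Y := Y) (qf r) v.

(* Scalar extension of a bilinear form along [bc]. *)
Definition ext_form L R R' (W : witt L R) (W' : witt L R')
    (D : dieudonne W) (D' : dieudonne W') (j : witt_morph W W')
    (b : base_change D D' j) (X : fmod L R) (f : diso D X -> diso D X -> wK W)
    (v w : diso D' (map_fmod (mR j) X)) : wK W' :=
  let e := vbasis {:diso D X} in
  \sum_i \sum_k coord (map_tuple (bc b (X := X)) e) i v
              * coord (map_tuple (bc b (X := X)) e) k w * mK j (f e`_i e`_k).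

(** * Hermitian formal modules *)

(* Data (X, i_X, lambda_X). The dual X^vee is given through relative Dieudonne
   theory, as [hdual] with the perfect pairing [hev] between the Dieudonne modules
   of X and X^vee; [hact x] is relevant for x in O_E only. *)
Record hmod L R (W : witt L R) (D : dieudonne W) := Hmod {
  hX : fmod L R;
  hact : fldE L -> fpsmap R (fdim hX) (fdim hX);
  hdual : fmod L R;
  hev : diso D hX -> diso D hdual -> wK W;
  hlam : fpsmap R (fdim hX) (fdim hdual)
}.

Arguments hact {L R W D} _ _.
Arguments hlam {L R W D} _.
Arguments hev {L R W D h} _ _.

Section HermitianModules.
Variables (L : local_fields) (R : fieldType) (W : witt L R) (D : dieudonne W).
Implicit Type H : hmod D.

Definition hmap H x : diso D (hX H) -> diso D (hX H) :=
  dmap (X := hX H) (Y := hX H) (hact H x).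

Definition hform H (v w : diso D (hX H)) : wK W :=
  hev v (dmap (X := hX H) (Y := hdual H) (hlam H) w).

Arguments hmap H x v : clear implicits.
Arguments hform H v w : clear implicits.

Record is_dual H : Prop := IsDual {
  dual_sfm : is_sfm W (hdual H);
  ev_linl : forall a v v' (w : diso D (hdual H)),
    hev (a *: v + v') w = a * hev v w + hev v' w;
  ev_linr : forall a (v : diso D (hX H)) w w',
    hev v (a *: w + w') = a * hev v w + hev v w';
  ev_F : forall (v : diso D (hX H)) (w : diso D (hdual H)),
    hev (dF v) w = frob W (hev v (dV w));
  ev_perfl : forall w : diso D (hdual H),
    dlat w <-> forall v, dlat v -> wW (hev (h := H) v w);
  ev_perfr : forall v : diso D (hX H),
    dlat v <-> forall w, dlat w -> wW (hev (h := H) v w)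
}.

(* O_E-linear polarizations: antisymmetric isogenies X -> X^vee with
   lambda o i(x) = i(x^* )^vee o lambda. *)
Record is_polarized H : Prop := IsPolarized {
  pol_dual : is_dual H;
  pol_hom : is_hom (X := hX H) (Y := hdual H) (hlam H);
  pol_isog : isogeny (hlam H);
  pol_alt : forall v, hform H v v = 0;
  pol_E : forall x v w, OE x ->
    hform H v (hmap H x w) = hform H (hmap H (conjE L x) v) w
}.

(* [s] is the structure morphism O_E -> R. *)
Record is_hmod (n : nat) (s : fldE L -> R) H : Prop := IsHmod {
  hm_sfm : is_sfm W (hX H);
  hm_height : ker_order (oact (hX H) (unif L)) (q L ^ (2 * n))%N;
  hm_hom : forall x, OE x -> is_hom (X := hX H) (Y := hX H) (hact H x);
  hm_F : forall a : fldF L, OF a -> hact H a%:A = oact (hX H) a;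
  hm_D : forall x y, OE x -> OE y ->
    hact H (x + y) = app2 (fgl (hX H)) (hact H x) (hact H y);
  hm_M : forall x y, OE x -> OE y -> hact H (x * y) = fcomp (hact H x) (hact H y);
  hm_charpol : forall x, OE x ->
    char_poly (jac (hact H x)) =
      ('X - (s x)%:P) * ('X - (s (conjE L x))%:P) ^+ n.-1;
  hm_pol : is_polarized H
}.

(* Isoclinic of slope 1/2. *)
Definition supersingular (X : fmod L R) : Prop :=
  exists2 M : diso D X -> Prop, is_lattice (wW (w := W)) M
    & forall v, scale_set (wpi W) M v <-> exists2 w, M w & v = dV (dV w).

End HermitianModules.

Arguments hform {L R W D} H v w.

(* Framing objects X^[h_i], indexed by i in {1, ..., m}, and the isogenies
   alpha i' i = alpha_{h_i', h_i} : X^[h_i'] -> X^[h_i] for i <= i'. *)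
Definition framing_isogenies L (W0 : witt L (FqE L)) (D0 : dieudonne W0)
    (X : nat -> hmod D0) :=
  forall i' i : nat, fpsmap (FqE L) (fdim (hX (X i'))) (fdim (hX (X i))).

Record is_framing L (W0 : witt L (FqE L)) (D0 : dieudonne W0) (n m : nat)
    (h : nat -> nat) (X : nat -> hmod D0) (alpha : framing_isogenies X) : Prop :=
  IsFraming {
    fr_hmod : forall i, (1 <= i <= m)%N -> is_hmod n (@resE L) (X i);
    fr_supersingular : forall i, (1 <= i <= m)%N -> supersingular D0 (hX (X i));
    fr_kernel : forall i, (1 <= i <= m)%N ->
      ker_order (hlam (X i)) (q L ^ (2 * h i))%N /\
      ker_sub (hlam (X i)) (oact (hX (X i)) (unif L));
    fr_hom : forall i i', (1 <= i <= i')%N -> (i' <= m)%N ->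
      is_hom (X := hX (X i')) (Y := hX (X i)) (alpha i' i);
    fr_isog : forall i i', (1 <= i <= i')%N -> (i' <= m)%N -> isogeny (alpha i' i);
    fr_E : forall i i' x, (1 <= i <= i')%N -> (i' <= m)%N -> OE x ->
      fcomp (alpha i' i) (hact (X i') x) = fcomp (hact (X i) x) (alpha i' i);
    fr_pol : forall i i', (1 <= i <= i')%N -> (i' <= m)%N ->
      forall v w : diso D0 (hX (X i')),
      hform (X i) (dmap (X := hX (X i')) (Y := hX (X i)) (alpha i' i) v)
                  (dmap (X := hX (X i')) (Y := hX (X i)) (alpha i' i) w)
      = hform (X i') v w;
    fr_alpha_kernel : forall i i', (1 <= i <= i')%N -> (i' <= m)%N ->
      ker_order (alpha i' i) (q L ^ (h i' - h i))%N /\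
      ker_sub (alpha i' i) (oact (hX (X i')) (unif L));
    fr_comp : forall i i' i'', (1 <= i <= i')%N -> (i' <= i'' <= m)%N ->
      fcomp (alpha i' i) (alpha i'' i') = alpha i'' i;
    fr_id : forall i, (1 <= i <= m)%N -> alpha i i = @fid _ (fdim (hX (X i)))
  }.

(** * Hermitian isocrystals and vertex lattices *)

Record isocrystal L R (W : witt L R) := Isocrystal {
  nV : vectType (wK W);
  nF : nV -> nV;
  nVer : nV -> nV;
  nE : fldE L -> nV -> nV;
  nform : nV -> nV -> wK W
}.

Section HermitianSpace.
(* [phi] and [del] are the images of phi_0 and delta in F_R. *)
Variables (L : local_fields) (R : fieldType) (W : witt L R) (N : isocrystal W).
Variables (phi : fldE L -> wK W) (del : wK W).

Definition N0 (v : nV N) : Prop := forall x, OE x -> nE x v = phi x *: v.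
Definition N1 (v : nV N) : Prop :=
  forall x, OE x -> nE x v = phi (conjE L x) *: v.

Definition Vinv (v : nV N) : nV N := (wpi W)^-1 *: nF v.
Definition tau (v : nV N) : nV N := wpi W *: Vinv (Vinv v).
Definition Cset (v : nV N) : Prop := N0 v /\ tau v = v.

Definition herm (v w : nV N) : wK W := del * nform v (nF w).

(* dual in N_0, resp. in C *)
Definition dualN (A : nV N -> Prop) (v : nV N) : Prop :=
  N0 v /\ forall w, A w -> wW (herm v w).
Definition dualC (A : nV N -> Prop) (v : nV N) : Prop :=
  Cset v /\ forall w, A w -> wW (herm v w).

Variables (W0 : witt L (FqE L)) (j : witt_morph W0 W).

Definition O0 (a : wK W) : Prop := exists2 a0 : wK W0, wW a0 & a = mK j a0.

(* W_{O_F}(F_{q^2})-lattices in the n-dimensional F_{F_{q^2}}-space C *)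
Definition C_lattice (n : nat) (A : nV N -> Prop) : Prop :=
  exists e : 'I_n -> nV N,
    [/\ forall i, Cset (e i),
        forall v, Cset v ->
          exists! a : 'rV[wK W0]_n, v = \sum_i mK j (a 0 i) *: e i
      & forall v, A v <->
          exists2 a : 'I_n -> wK W0, (forall i, wW (a i))
            & v = \sum_i mK j (a i) *: e i].

(* Lambda in L_i, and t(Lambda) >= x *)
Definition vertex_lattice (n i : nat) (A : nV N -> Prop) : Prop :=
  [/\ C_lattice n A, incl (scale_set (wpi W ^+ i.+1) (dualC A)) A
    & incl A (scale_set (wpi W ^+ i) (dualC A))].

Definition type_ge (i : nat) (A : nV N -> Prop) (x : nat) : Prop :=
  exists2 t, colength O0 (scale_set (wpi W ^+ i.+1) (dualC A)) A t & (x <= t)%N.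

(* [La0 i] and [La1 j] stand for Lambda_0^i and Lambda_1^j. *)
Record BT_index (n m : nat) (h : nat -> nat) (I : {set 'I_m.+1})
    (La0 La1 : nat -> nV N -> Prop) : Prop := BTindex {
  bt_nonempty : I != set0;
  bt_first : h 1%N = 0%N -> ord0 \notin I;
  bt_last : h m = n -> ord_max \notin I;
  bt_La0 : forall i : 'I_m.+1, i \in I -> (0 < i)%N ->
    vertex_lattice n 0 (La0 i) /\ type_ge 0 (La0 i) (h i + 1);
  bt_La1 : forall i : 'I_m.+1, i \in I -> (i < m)%N ->
    vertex_lattice n 1 (La1 i) /\ type_ge 1 (La1 i) (n - h i.+1 + 1);
  bt_chain : forall i : 'I_m.+1, i \in I -> (0 < i < m)%N ->
    incl (La0 i) (scale_set (wpi W) (dualC (La1 i)));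
  bt_next : forall i i' : 'I_m.+1, i \in I -> i' \in I -> (i < i')%N ->
    (forall l : 'I_m.+1, l \in I -> ~~ (i < l < i')%N) ->
    incl (scale_set (wpi W) (dualC (La1 i))) (La0 i')
}.

(* pi Lambda^vee (+) V(Lambda^vee) and Lambda (+) V^-1(Lambda), over W_{O_F}(R) *)
Definition lat_minus (A : nV N -> Prop) (v : nV N) : Prop :=
  exists a b, [/\ span_over (wW (w := W)) (dualC A) a,
                  span_over (wW (w := W)) (dualC A) b
                & v = wpi W *: a + nVer b].
Definition lat_plus (A : nV N -> Prop) (v : nV N) : Prop :=
  exists a b, [/\ span_over (wW (w := W)) A a,
                  span_over (wW (w := W)) A (nVer b) & v = a + b].

End HermitianSpace.

(** * Points of the moduli space and of the closed subschemes *)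

Section Moduli.
Variables (L : local_fields) (W0 : witt L (FqE L)) (kappa k : fieldType)
  (Wkappa : witt L kappa) (Wk : witt L k)
  (j1 : witt_morph W0 Wkappa) (j2 : witt_morph Wkappa Wk)
  (D0 : dieudonne W0) (Dkappa : dieudonne Wkappa) (Dk : dieudonne Wk)
  (b1 : base_change D0 Dkappa j1) (b2 : base_change Dkappa Dk j2).
Variables (n m : nat) (X : nat -> hmod D0) (alpha : framing_isogenies X).
Variables (phi0 : {rmorphism fldE L -> wK W0}) (delta : wK W0).
Arguments alpha : clear implicits.

(* base changes from F_{q^2} to kappa and to k *)
Definition Xkappa (i : nat) : fmod L kappa := map_fmod (mR j1) (hX (X i)).
Definition Xk (i : nat) : fmod L k := map_fmod (mR j2) (Xkappa i).
Definition alpha_kappa i' i : fpsmap kappa (fdim (Xkappa i')) (fdim (Xkappa i)) :=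
  map_fpsmap (mR j1) (alpha i' i).
Arguments alpha_kappa : clear implicits.
Definition alpha_k i' i : fpsmap k (fdim (Xk i')) (fdim (Xk i)) :=
  map_fpsmap (mR j2) (alpha_kappa i' i).
Arguments alpha_k : clear implicits.
Definition act_kappa i x : fpsmap kappa (fdim (Xkappa i)) (fdim (Xkappa i)) :=
  map_fpsmap (mR j1) (hact (X i) x).
Arguments act_kappa : clear implicits.
Definition act_k i x : fpsmap k (fdim (Xk i)) (fdim (Xk i)) :=
  map_fpsmap (mR j2) (act_kappa i x).
Arguments act_k : clear implicits.
Definition form_kappa i : diso Dkappa (Xkappa i) -> diso Dkappa (Xkappa i) ->
    wK Wkappa := ext_form b1 (hform (X i)).
Arguments form_kappa : clear implicits.
Definition form_k i : diso Dk (Xk i) -> diso Dk (Xk i) -> wK Wk :=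
  ext_form b2 (form_kappa i).
Arguments form_k : clear implicits.

Definition sk (x : fldE L) : k := mR j2 (mR j1 (resE x)).
Definition phi_kappa x : wK Wkappa := mK j1 (phi0 x).
Definition phi_k x : wK Wk := mK j2 (phi_kappa x).
Definition delta_kappa : wK Wkappa := mK j1 delta.
Definition delta_k : wK Wk := mK j2 delta_kappa.

(* [Xkappa 1] is the base change of X^[h_1], so that its rational Dieudonne module
   is N (x) F_kappa; likewise for k. *)
Definition Nkappa : isocrystal Wkappa :=
  Isocrystal (@dF _ _ _ Dkappa (Xkappa 1)) (@dV _ _ _ Dkappa (Xkappa 1))
    (fun x => dmap (X := Xkappa 1) (Y := Xkappa 1) (act_kappa 1 x))
    (form_kappa 1).
Definition Nk : isocrystal Wk :=
  Isocrystal (@dF _ _ _ Dk (Xk 1)) (@dV _ _ _ Dk (Xk 1))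
    (fun x => dmap (X := Xk 1) (Y := Xk 1) (act_k 1 x)) (form_k 1).

(* N^h(k): families (X^[i], i, lambda, rho) for 1 <= i <= m; the values at other
   indices are irrelevant. Since pi = 0 in k, the quasi-isogenies are defined on
   X^[i] itself. *)
Record point := Point {
  pX : nat -> hmod Dk;
  prho : forall i, qmap k (fdim (hX (pX i))) (fdim (Xk i))
}.

Record is_point (x : point) : Prop := IsPoint {
  pt_hmod : forall i, (1 <= i <= m)%N -> is_hmod n sk (pX x i);
  pt_qisog : forall i, (1 <= i <= m)%N ->
    is_qisog (X := hX (pX x i)) (Y := Xk i) (prho x i);
  pt_height0 : forall i, (1 <= i <= m)%N ->
    ker_order (qf (prho x i)) (q L ^ (2 * n * qN (prho x i)))%N;
  pt_E : forall i y, (1 <= i <= m)%N -> OE y ->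
    fcomp (qf (prho x i)) (hact (pX x i) y) = fcomp (act_k i y) (qf (prho x i));
  pt_pol : forall i, (1 <= i <= m)%N -> exists u : fldF L,
    [/\ OF u, OF u^-1, u != 0
      & forall v w : diso Dk (hX (pX x i)),
          form_k i (dq (X := hX (pX x i)) (Y := Xk i) (prho x i) v)
                   (dq (X := hX (pX x i)) (Y := Xk i) (prho x i) w)
          = wF Wk u * hform (pX x i) v w];
  pt_lift : forall i, (1 <= i < m)%N ->
    exists g : fpsmap k (fdim (hX (pX x i.+1))) (fdim (hX (pX x i))),
      [/\ is_hom (X := hX (pX x i.+1)) (Y := hX (pX x i)) g, isogeny g
        & qeq (X := hX (pX x i.+1)) (Y := Xk i)
            (qpre (prho x i) g) (qpost (alpha_k i.+1 i) (prho x i.+1))]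
}.

(* The lattices M_i, A_i, B_i in N_k attached to a point; (M_i)_0 and (M_i)_1 are
   the intersections of M_i with N_{k,0} and N_{k,1}. *)
Definition Mlat (x : point) i (v : nV Nk) : Prop :=
  exists2 u : diso Dk (hX (pX x i)), dlat u
    & v = dmap (X := Xk i) (Y := Xk 1) (alpha_k i 1)
            (dq (X := hX (pX x i)) (Y := Xk i) (prho x i) u).
Definition Alat (x : point) i (v : nV Nk) : Prop :=
  N0 (N := Nk) phi_k v /\ Mlat x i v.
Definition Blat (x : point) i (v : nV Nk) : Prop :=
  N0 (N := Nk) phi_k v /\
  forall w, N1 (N := Nk) phi_k w -> Mlat x i w -> wW (nform (i := Nk) v w).

Definition dualk (A : nV Nk -> Prop) : nV Nk -> Prop :=
  dualN (N := Nk) phi_k delta_k A.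
Definition dualkappa (A : nV Nkappa -> Prop) : nV Nkappa -> Prop :=
  dualC (N := Nkappa) phi_kappa delta_kappa A.

(* Lambda_k for a lattice Lambda in C *)
Definition lat_k (A : nV Nkappa -> Prop) : nV Nk -> Prop :=
  span_over (V := nV Nk) (wW (w := Wk))
    (fun v => exists2 u, A u & v = bc b2 (X := Xkappa 1) u).

(* (Y, rho) is the strict formal O_F-module over kappa with quasi-isogeny
   rho : Y -> X^[h_i] whose Dieudonne module is alpha_{h_i,h_1}^{-1}(T). *)
Record lattice_module i (T : nV Nkappa -> Prop) (Y : fmod L kappa)
    (rho : qmap kappa (fdim Y) (fdim (Xkappa i))) : Prop := LatticeModule {
  lm_sfm : is_sfm Wkappa Y;
  lm_qisog : is_qisog (X := Y) (Y := Xkappa i) rho;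
  lm_lattice : forall v : diso Dkappa (Xkappa i),
    (exists2 u : diso Dkappa Y, dlat u & v = dq (X := Y) (Y := Xkappa i) rho u)
    <-> T (dmap (X := Xkappa i) (Y := Xkappa 1) (alpha_kappa i 1) v)
}.

Variables (I : {set 'I_m.+1}) (La0 La1 : nat -> nV Nkappa -> Prop).

(* X_{Lambda_0^{i-}} and X_{Lambda_1^{j+}} with their quasi-isogenies *)
Record lattice_modules := LatticeModules {
  Xm : nat -> fmod L kappa;
  rhom : forall i, qmap kappa (fdim (Xm i)) (fdim (Xkappa i));
  Xp : nat -> fmod L kappa;
  rhop : forall j, qmap kappa (fdim (Xp j)) (fdim (Xkappa j.+1));
  Xm_lattice : forall i : 'I_m.+1, i \in I -> (0 < i)%N ->
    lattice_module (lat_minus (N := Nkappa) phi_kappa delta_kappa (La0 i)) (rhom i);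
  Xp_lattice : forall j : 'I_m.+1, j \in I -> (j < m)%N ->
    lattice_module (lat_plus (N := Nkappa) (La1 j)) (rhop j)
}.

(* k-points of the closed subscheme N^h_{I, Lambda}: rho_X^{-1} o rho_- and
   rho_+^{-1} o rho_X are isogenies g, i.e. rho_X o g = rho_- and
   rho_+ o g = rho_X. *)
Definition in_closed_subscheme (Y : lattice_modules) (x : point) : Prop :=
  (forall i : 'I_m.+1, i \in I -> (0 < i)%N ->
     exists g : fpsmap k (fdim (map_fmod (mR j2) (Xm Y i))) (fdim (hX (pX x i))),
       [/\ is_hom (X := map_fmod (mR j2) (Xm Y i)) (Y := hX (pX x i)) g, isogeny g
         & qeq (X := map_fmod (mR j2) (Xm Y i)) (Y := Xk i)
             (qpre (prho x i) g) (map_qmap (mR j2) (rhom Y i))])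
  /\
  (forall j : 'I_m.+1, j \in I -> (j < m)%N ->
     exists g : fpsmap k (fdim (hX (pX x j.+1))) (fdim (map_fmod (mR j2) (Xp Y j))),
       [/\ is_hom (X := hX (pX x j.+1)) (Y := map_fmod (mR j2) (Xp Y j)) g, isogeny g
         & qeq (X := hX (pX x j.+1)) (Y := Xk j.+1)
             (qpre (map_qmap (mR j2) (rhop Y j)) g) (prho x j.+1)]).

End Moduli.

Arguments Nkappa {L W0 kappa Wkappa j1 D0 Dkappa} b1 X.
Arguments Nk {L W0 kappa k Wkappa Wk j1 j2 D0 Dkappa Dk} b1 b2 X.
Arguments Alat {L W0 kappa k Wkappa Wk j1 j2 D0 Dkappa Dk} b1 b2 {X} alpha phi0 x i v.
Arguments Blat {L W0 kappa k Wkappa Wk j1 j2 D0 Dkappa Dk} b1 b2 {X} alpha phi0 x i v.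
Arguments lat_k {L W0 kappa k Wkappa Wk j1 j2 D0 Dkappa Dk b1} b2 {X} A v.

(* Main.v *)
(* In the rational Dieudonne module N = N_0 (+) N_1, the lattice M_i of a point
   splits as A_i (+) (M_i)_1, and V B_i^vee = (M_i)_1 because B_i is the dual of
   (M_i)_1 under the perfect pairing of N_0 with N_1.  By Dieudonne theory the
   isogeny out of X_{Lambda^-} exists iff pi Lambda^vee (+) V Lambda^vee lies in
   M_i.  As V^2 = pi tau^-1 acts as pi on tau-invariants, this reduces to
   V Lambda^vee in (M_i)_1, that is Lambda^vee in B_i^vee, and then B_i lies in
   Lambda by duality.  The isogeny into X_{Lambda^+} exists iff M_{j+1} lies in
   Lambda (+) V^-1 Lambda, which reduces to A_{j+1} in Lambda since
   V (M_{j+1})_1 lies in A_{j+1}.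
   Duality needs a basis of C to be a basis of N_0 over F_k: tau-invariant
   vectors independent over F_{F_{q^2}} stay independent, because the fixed field
   of sigma^2 in F_k is F_{F_{q^2}}. *)

Require Import Defs.
From mathcomp Require Import all_boot all_order all_algebra all_field.
From mathcomp Require Import ring.
From mathcomp.multinomials Require Import mpoly.
From Stdlib Require Import FunctionalExtensionality Classical ClassicalEpsilon.

Set Implicit Arguments.
Unset Strict Implicit.
Unset Printing Implicit Defensive.

Import Order.TTheory GRing.Theory Num.Theory.
Local Open Scope ring_scope.

(** * Composition of formal power series *)

(** Points are given by formal group laws, while the claim concerns lattices. Fullness and
    faithfulness of the Dieudonné functor are available only for homomorphisms of formal modules, so
    composites must first be shown to be homomorphisms. This is why associativity of the
    coefficientwise composition [fcomp] is established before any lattice appears. The vertex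
    lattices are spanned over F_{q^2} inside C, whereas M_i is a W_{O_F}(k)-lattice in N_k.
    Inclusions and integrality are therefore tested on images of vectors defined over the smaller
    field and propagated semilinearly. All integral splittings into N_0 and N_1 rest on one z in O_E
    for which phi_0(z) and phi_0(conj z) differ by a unit. To find it, sigma is identified with
    conjugation through [phi0]: a quadratic extension has only one nontrivial automorphism, and the
    q-power map is nontrivial on F_{q^2}. *)

Section OrderOfVanishing.
Variable R : fieldType.

(** Membership in the N-th power of the ideal generated by the variables. Working modulo these
    ideals replaces power series by polynomials. *)
Definition vanishing n (N : nat) (p : {mpoly R[n]}) :=
  forall a, (mdeg a < N)%N -> p@_a = 0.

Definition eqtrunc n (N : nat) (p r : {mpoly R[n]}) := vanishing N (p - r).

Lemma vanishingD n N (p r : {mpoly R[n]}) :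
  vanishing N p -> vanishing N r -> vanishing N (p + r).
Proof. by move=> hp hr a ha; rewrite mcoeffD hp ?hr ?addr0. Qed.

Lemma vanishing_sum n N (I : Type) (s : seq I) (P : pred I)
    (F : I -> {mpoly R[n]}) :
  (forall i, P i -> vanishing N (F i)) -> vanishing N (\sum_(i <- s | P i) F i).
Proof.
move=> hF; apply: (big_ind (vanishing N)) => //.
  by move=> a _; rewrite mcoeff0.
by move=> p r; apply: vanishingD.
Qed.

Lemma vanishingZ n N c (p : {mpoly R[n]}) : vanishing N p -> vanishing N (c *: p).
Proof. by move=> hp a ha; rewrite mcoeffZ hp ?mulr0. Qed.

Lemma vanishingM n N M (p r : {mpoly R[n]}) :
  vanishing N p -> vanishing M r -> vanishing (N + M) (p * r).
Proof.
move=> hp hr a ha; rewrite mcoeffM big1 // => -[k1 k2] /= /eqP ak.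
have [hk|hk] := ltnP (mdeg k1) N; first by rewrite hp ?mul0r.
rewrite hr ?mulr0 //; have da : mdeg a = (mdeg k1 + mdeg k2)%N by rewrite {1}ak mdegD.
rewrite ltnNge; apply/negP => hk'.
by move: ha; rewrite da ltnNge leq_add.
Qed.

Lemma vanishing0 n (p : {mpoly R[n]}) : vanishing 0 p.
Proof. by []. Qed.

Lemma vanishing_le n N M (p : {mpoly R[n]}) :
  (M <= N)%N -> vanishing N p -> vanishing M p.
Proof. by move=> hMN hp a ha; apply: hp; apply: leq_trans hMN. Qed.

Lemma vanishingX n N k (p : {mpoly R[n]}) :
  vanishing N p -> vanishing (k * N) (p ^+ k).
Proof.
move=> hp; elim: k => [|k IH]; first exact: vanishing0.
by rewrite exprS mulSn; apply: vanishingM.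
Qed.

Lemma vanishing_prod n (I : Type) (s : seq I) (d : I -> nat)
    (F : I -> {mpoly R[n]}) :
  (forall i, vanishing (d i) (F i)) ->
  vanishing (\sum_(i <- s) d i) (\prod_(i <- s) F i).
Proof.
move=> hF; elim: s => [|i s IH]; first by rewrite big_nil; apply: vanishing0.
by rewrite !big_cons; apply: vanishingM.
Qed.

Lemma eqtrunc_refl n N (p : {mpoly R[n]}) : eqtrunc N p p.
Proof. by move=> a _; rewrite subrr mcoeff0. Qed.

Lemma eqtruncP n N (p r : {mpoly R[n]}) :
  eqtrunc N p r <-> forall a, (mdeg a < N)%N -> p@_a = r@_a.
Proof.
split=> h a ha; first by apply/eqP; rewrite -subr_eq0 -mcoeffB h.
by rewrite mcoeffB h ?subrr.
Qed.

Lemma eqtrunc_trans n N (p r s : {mpoly R[n]}) :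
  eqtrunc N p r -> eqtrunc N r s -> eqtrunc N p s.
Proof. by move=> /eqtruncP h /eqtruncP h'; apply/eqtruncP => a ha; rewrite h ?h'. Qed.

Lemma eqtrunc_sym n N (p r : {mpoly R[n]}) : eqtrunc N p r -> eqtrunc N r p.
Proof. by move=> /eqtruncP h; apply/eqtruncP => a ha; rewrite h. Qed.

Lemma eqtruncM n N (p p' r r' : {mpoly R[n]}) :
  eqtrunc N p p' -> eqtrunc N r r' -> eqtrunc N (p * r) (p' * r').
Proof.
move=> hp hr; rewrite /eqtrunc.
have -> : p * r - p' * r' = (p - p') * r + p' * (r - r').
  by rewrite mulrBl mulrBr addrA subrK.
apply: vanishingD; first by rewrite -(addn0 N); apply: vanishingM.
by rewrite -(add0n N); apply: vanishingM.
Qed.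

Lemma eqtruncX n N k (p r : {mpoly R[n]}) :
  eqtrunc N p r -> eqtrunc N (p ^+ k) (r ^+ k).
Proof.
move=> h; elim: k => [|k IH]; first exact: eqtrunc_refl.
by rewrite !exprS; apply: eqtruncM.
Qed.

Lemma eqtrunc_compr n l N (p : {mpoly R[n]}) (s t : n.-tuple {mpoly R[l]}) :
  (forall i, eqtrunc N (tnth s i) (tnth t i)) -> eqtrunc N (p \mPo s) (p \mPo t).
Proof.
move=> h; rewrite !comp_mpolyE /eqtrunc -sumrB; apply: vanishing_sum => a _.
rewrite -scalerBr; apply: vanishingZ.
have : eqtrunc N (\prod_(i < n) tnth s i ^+ a i) (\prod_(i < n) tnth t i ^+ a i).
  apply: (big_ind2 (fun p r => eqtrunc N p r)); first exact: eqtrunc_refl.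
    by move=> *; apply: eqtruncM.
  by move=> i _; apply: eqtruncX.
by [].
Qed.

(** A monomial of degree at least N turns into a product of at least N factors without constant
    term. *)
Lemma vanishing_comp n l N (p : {mpoly R[n]}) (s : n.-tuple {mpoly R[l]}) :
  (forall i, vanishing 1 (tnth s i)) -> vanishing N p -> vanishing N (p \mPo s).
Proof.
move=> hs hp; rewrite comp_mpolyE; apply: vanishing_sum => a _.
have [ha|ha] := ltnP (mdeg a) N.
  by rewrite hp // scale0r => b _; rewrite mcoeff0.
apply: vanishingZ; apply: (vanishing_le ha).
rewrite mdegE; apply: (vanishing_prod (d := fun i => a i)) => i.
by rewrite -[X in vanishing X _]muln1; apply: vanishingX.
Qed.

Lemma eqtrunc_compl n l N (p r : {mpoly R[n]}) (s : n.-tuple {mpoly R[l]}) :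
  (forall i, vanishing 1 (tnth s i)) -> eqtrunc N p r ->
  eqtrunc N (p \mPo s) (r \mPo s).
Proof.
by move=> hs h; rewrite /eqtrunc -comp_mpolyB; apply: vanishing_comp.
Qed.

Lemma comp_mpolyA n l o (p : {mpoly R[n]}) (s : n.-tuple {mpoly R[l]})
    (t : l.-tuple {mpoly R[o]}) :
  (p \mPo s) \mPo t = p \mPo [tuple tnth s i \mPo t | i < n].
Proof.
rewrite (comp_mpolyE p s) (comp_mpolyE p) rmorph_sum /=.
apply: eq_bigr => a _; rewrite comp_mpolyZ rmorph_prod /=; congr (_ *: _).
by apply: eq_bigr => i _; rewrite rmorphXn /= tnth_mktuple.
Qed.

Lemma mcoeff_trunc n N (f : fps R n) a :
  (trunc N f)@_a = if (mdeg a < N)%N then f a else 0.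
Proof.
case: ifP => ha; first exact: mcoeff_mpoly.
rewrite raddf_sum big1 // => -[b hb] _ /=.
rewrite mcoeffZ mcoeffX; case: eqP => [bE|_]; last by rewrite mulr0.
by rewrite -bE hb in ha.
Qed.

Lemma trunc_le n N M (f : fps R n) :
  (N <= M)%N -> eqtrunc N (trunc N f) (trunc M f).
Proof.
by move=> h; apply/eqtruncP => a ha; rewrite !mcoeff_trunc ha (leq_trans ha h).
Qed.

Lemma trunc_vanishing1 n N (f : fps R n) : f 0%MM = 0 -> vanishing 1 (trunc N f).
Proof.
move=> h a; rewrite ltnS leqn0 mdeg_eq0 => /eqP ->.
by rewrite mcoeff_trunc h if_same.
Qed.

Definition tuple_trunc l n N (g : fpsmap R l n) : n.-tuple {mpoly R[l]} :=
  [tuple trunc N (g j) | j < n].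

Lemma tuple_trunc_vanishing1 l n N (g : fpsmap R l n) i :
  no_const g -> vanishing 1 (tnth (tuple_trunc N g) i).
Proof. by move=> h; rewrite tnth_mktuple; apply: trunc_vanishing1. Qed.

(** The truncation order in the definition of [fcomp] depends on the coefficient. Any larger order
    gives the same value, so one polynomial substitution computes all coefficients of degree below N
    at once. *)
Lemma fcompE n m l (f : fpsmap R n m) (g : fpsmap R l n) i N a :
  no_const g -> (mdeg a < N)%N ->
  fcomp f g i a = (trunc N (f i) \mPo tuple_trunc N g)@_a.
Proof.
move=> hg ha; rewrite /fcomp -/(tuple_trunc _ g).
have /eqtruncP : eqtrunc (mdeg a).+1 (trunc (mdeg a).+1 (f i) \mPo tuple_trunc (mdeg a).+1 g)
   (trunc N (f i) \mPo tuple_trunc N g).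
  apply: (@eqtrunc_trans _ _ _ (trunc (mdeg a).+1 (f i) \mPo tuple_trunc N g)).
    by apply: eqtrunc_compr => j; rewrite !tnth_mktuple; apply: trunc_le.
  apply: eqtrunc_compl; last exact: trunc_le.
  by move=> j; apply: tuple_trunc_vanishing1.
by apply.
Qed.

Arguments fcompE [n m l] f [g] i N [a].

Lemma trunc_fcomp n m l (f : fpsmap R n m) (g : fpsmap R l n) i N :
  no_const g ->
  eqtrunc N (trunc N (fcomp f g i)) (trunc N (f i) \mPo tuple_trunc N g).
Proof.
by move=> hg; apply/eqtruncP => a ha; rewrite mcoeff_trunc ha (fcompE _ _ N).
Qed.

Lemma no_const_fcomp n m l (f : fpsmap R n m) (g : fpsmap R l n) :
  no_const f -> no_const g -> no_const (fcomp f g).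
Proof.
move=> hf hg i; rewrite (fcompE _ _ 1%N) ?mdeg0 //.
apply: vanishing_comp (trunc_vanishing1 _ (hf i)) _ _; rewrite ?mdeg0 //.
by move=> j; apply: tuple_trunc_vanishing1.
Qed.

(** Substitution of polynomials is associative, and below degree N both composites agree with it.
    Absence of constant terms makes truncating the inner composite harmless. *)
Lemma fcompA n m l o (f : fpsmap R n m) (g : fpsmap R l n) (h : fpsmap R o l) :
  no_const g -> no_const h -> fcomp (fcomp f g) h = fcomp f (fcomp g h).
Proof.
move=> hg hh; apply: functional_extensionality => i.
apply: functional_extensionality => a; set N := (mdeg a).+1.
have ha : (mdeg a < N)%N by [].
rewrite (fcompE _ _ N) // (fcompE _ _ N) //; last exact: no_const_fcomp.
have h1 := eqtrunc_compl (fun j => @tuple_trunc_vanishing1 _ _ N h j hh)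
  (@trunc_fcomp _ _ _ f g i N hg).
rewrite comp_mpolyA in h1.
apply: (eqtruncP _ _ _).1 ha; apply: (eqtrunc_trans h1); apply: eqtrunc_compr => j.
rewrite !tnth_mktuple; apply: eqtrunc_sym; exact: trunc_fcomp.
Qed.

Lemma fcomp_var n l m (f : fpsmap R n m) (g : fpsmap R l n) i c :
  no_const g -> f i = @var R n c -> fcomp f g i = g c.
Proof.
move=> hg fi; apply: functional_extensionality => a.
(* The order is at least 2 even for a = 0, so that the truncation keeps the variable. *)
rewrite (fcompE _ _ (mdeg a).+2) // fi.
have -> : trunc (mdeg a).+2 (@var R n c) = 'X_c.
  apply/mpolyP => b; rewrite mcoeff_trunc mcoeffX eq_sym /var.
  by have [->|_] := eqVneq b; rewrite ?mdeg1 //= if_same.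
by rewrite comp_mpolyXU -tnth_nth tnth_mktuple mcoeff_trunc leqW.
Qed.

Lemma no_const_var n (c : 'I_n) : @var R n c 0%MM = 0.
Proof. by rewrite /var eq_sym mnm1_eq0. Qed.

(** The substitution hidden in [app2]: by definition [app2 Phi f g] is [fcomp Phi (pairing f g)]. *)
Definition pairing d l (f g : fpsmap R l d) : fpsmap R l (d + d) :=
  fun j => match split j with inl a => f a | inr b => g b end.

Lemma no_const_pairing d l (f g : fpsmap R l d) :
  no_const f -> no_const g -> no_const (pairing f g).
Proof. by move=> hf hg i; rewrite /pairing; case: (split i). Qed.

Lemma fcomp_pairing d l o (f g : fpsmap R l d) (h : fpsmap R o l) :
  fcomp (pairing f g) h = pairing (fcomp f h) (fcomp g h).
Proof.
apply: functional_extensionality => i; apply: functional_extensionality => a.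
by rewrite /fcomp /pairing; case: (split i).
Qed.

Lemma fcomp_xblock d l (f g : fpsmap R l d) :
  no_const f -> no_const g -> fcomp (@xblock R d) (pairing f g) = f.
Proof.
move=> hf hg; apply: functional_extensionality => i.
rewrite (@fcomp_var _ _ _ _ _ _ (lshift d i)) //; last exact: no_const_pairing.
by rewrite /pairing (unsplitK (inl i : 'I_d + 'I_d)%type).
Qed.

Lemma fcomp_yblock d l (f g : fpsmap R l d) :
  no_const f -> no_const g -> fcomp (@yblock R d) (pairing f g) = g.
Proof.
move=> hf hg; apply: functional_extensionality => i.
rewrite (@fcomp_var _ _ _ _ _ _ (rshift d i)) //; last exact: no_const_pairing.
by rewrite /pairing (unsplitK (inr i : 'I_d + 'I_d)%type).
Qed.

(** Makes composites eligible for [d_faithful], and lets a composite be compared with a given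
    quasi-isogeny. *)
Lemma is_hom_fcomp L (X Y Z : fmod L R) (W : witt L R)
    (f : fpsmap R (fdim X) (fdim Y)) (g : fpsmap R (fdim Y) (fdim Z)) :
  is_sfm W X -> is_sfm W Y -> is_sfm W Z ->
  is_hom (X := X) (Y := Y) f -> is_hom (X := Y) (Y := Z) g ->
  is_hom (X := X) (Y := Z) (fcomp g f).
Proof.
move=> hX hY hZ hf hg.
have cf := hom_const hf; have cg := hom_const hg.
have cX := fgl_const (sfm_fgl hX); have cY := fgl_const (sfm_fgl hY).
have cx : no_const (@xblock R (fdim X)) by move=> i; apply: no_const_var.
have cy : no_const (@yblock R (fdim X)) by move=> i; apply: no_const_var.
have cx' : no_const (@xblock R (fdim Y)) by move=> i; apply: no_const_var.
have cy' : no_const (@yblock R (fdim Y)) by move=> i; apply: no_const_var.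
have cfx := no_const_fcomp cf cx; have cfy := no_const_fcomp cf cy.
have cp := no_const_pairing cfx cfy.
split; first exact: no_const_fcomp.
  (* Additivity of f, then of g: g(f(x + y)) = g(f(x) + f(y)) = g(f(x)) + g(f(y)), each sum being
     the one of its formal group. *)
  rewrite fcompA // (hom_add hf) /app2 -[fun j => _]/(pairing _ _) -fcompA //.
  rewrite (hom_add hg) /app2 -[fun j => match split j with _ => _ end]/(pairing _ _).
  rewrite (fcompA _ _ cp); last by apply: no_const_pairing; apply: no_const_fcomp.
  congr (fcomp (fgl Z) _); etransitivity; first exact: fcomp_pairing.
  apply: f_equal2.
    by rewrite (fcompA _ cx' cp) fcomp_xblock // fcompA.
  by rewrite (fcompA _ cy' cp) fcomp_yblock // fcompA.
move=> a ha.
have cX' := hom_const (sfm_hom hX ha); have cY' := hom_const (sfm_hom hY ha).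
rewrite fcompA // (hom_act hf) // -fcompA // (hom_act hg) // fcompA //.
Qed.

End OrderOfVanishing.

(** * Base change of power series and homomorphisms along a field extension *)

Section BaseChangeOfSeries.
Variables (R R' : fieldType) (j : {rmorphism R -> R'}).

Lemma map_trunc n N (f : fps R n) :
  map_mpoly j (trunc N f) = trunc N (fun a => j (f a)).
Proof.
apply/mpolyP => a; rewrite mcoeff_map_mpoly !mcoeff_trunc.
by case: ifP => // _; apply: rmorph0.
Qed.

Lemma map_fcomp n m l (f : fpsmap R n m) (g : fpsmap R l n) :
  map_fpsmap j (fcomp f g) = fcomp (map_fpsmap j f) (map_fpsmap j g).
Proof.
apply: functional_extensionality => i; apply: functional_extensionality => a.
rewrite /map_fpsmap /fcomp -mcoeff_map_mpoly map_mpoly_comp; last exact: fmorph_inj.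
rewrite map_trunc; congr (_ \mPo _)@__; apply: eq_from_tnth => c.
by rewrite tnth_map !tnth_mktuple map_trunc.
Qed.

Lemma map_pairing d l (f g : fpsmap R l d) :
  map_fpsmap j (pairing f g) = pairing (map_fpsmap j f) (map_fpsmap j g).
Proof.
apply: functional_extensionality => i.
by rewrite /map_fpsmap /pairing; case: (split i).
Qed.

Lemma map_var n m (c : 'I_m -> 'I_n) :
  map_fpsmap j (fun i => @var R n (c i)) = fun i => @var R' n (c i).
Proof.
apply: functional_extensionality => i; apply: functional_extensionality => a.
by rewrite /map_fpsmap /var; apply: rmorph_nat.
Qed.

Lemma is_hom_map L (X Y : fmod L R) (f : fpsmap R (fdim X) (fdim Y)) :
  is_hom (X := X) (Y := Y) f ->
  is_hom (X := map_fmod j X) (Y := map_fmod j Y) (map_fpsmap j f).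
Proof.
move=> hf; split=> [i||a ha] /=.
- by rewrite /map_fpsmap (hom_const hf); apply: rmorph0.
- rewrite -map_fcomp (hom_add hf) /app2 -!/(pairing _ _) map_fcomp map_pairing.
  congr (fcomp _ _); apply: f_equal2; rewrite (map_fcomp f); congr (fcomp _ _).
    exact: (@map_var (fdim X + fdim X) (fdim X) (lshift (fdim X))).
  exact: (@map_var (fdim X + fdim X) (fdim X) (@rshift (fdim X) (fdim X))).
- by rewrite -!map_fcomp (hom_act hf).
Qed.

End BaseChangeOfSeries.

(** * Discrete valuation rings *)

Section DiscreteValuationRings.
Variables (K R : fieldType) (O : K -> Prop) (u : K) (res : K -> R).
Hypothesis hO : is_dvr O u res.

Lemma dvr0 : O 0.
Proof. by rewrite -(subrr 1); apply: (dvr_sub hO); apply: dvr_one hO. Qed.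

Lemma dvrN x : O x -> O (- x).
Proof. by move=> hx; rewrite -sub0r; apply: (dvr_sub hO) dvr0 hx. Qed.

Lemma dvrD x y : O x -> O y -> O (x + y).
Proof. by move=> hx hy; rewrite -(opprK y); apply: (dvr_sub hO) => //; apply: dvrN. Qed.

Lemma dvr_sum (I : Type) (s : seq I) (P : pred I) (F : I -> K) :
  (forall i, P i -> O (F i)) -> O (\sum_(i <- s | P i) F i).
Proof. by move=> h; apply: big_ind => //; [apply: dvr0 | apply: dvrD]. Qed.

Lemma dvrX x i : O x -> O (x ^+ i).
Proof.
move=> hx; elim: i => [|i IH]; first exact: dvr_one hO.
by rewrite exprS; apply: (dvr_mul hO).
Qed.

Lemma dvr_unif_neq0 : u != 0.
Proof.
apply/eqP => u0; case: (dvr_unif hO) => hu; apply.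
by rewrite u0 invr0; apply: dvr0.
Qed.

Lemma dvr_unif_exp (z : int) : O (u ^ z) <-> 0 <= z.
Proof.
case: (dvr_unif hO) => hu hu'; case: z => n; split=> //.
  by move=> _; apply: dvrX.
rewrite NegzE => h; case: hu'.
have -> : u^-1 = u ^ (- n.+1%:Z) * u ^+ n.
  by rewrite -[u ^+ n]/(u ^ n%:Z) -expfzDr ?dvr_unif_neq0 // intS opprD addrNK.
by apply: (dvr_mul hO) => //; apply: dvrX.
Qed.

Lemma dvr_unit_exp e (z : int) : O e -> O e^-1 -> e != 0 -> O (e * u ^ z) <-> 0 <= z.
Proof.
move=> he he' e0; rewrite -dvr_unif_exp; split=> h; last exact: (dvr_mul hO).
by rewrite -(mulKf e0 (u ^ z)); apply: (dvr_mul hO).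
Qed.

Lemma dvr_val_neq0 x e (z : int) : x != 0 -> x = e * u ^ z -> e != 0.
Proof. by move=> x0 xE; apply: contraNneq x0 => e0; rewrite xE e0 mul0r. Qed.

Lemma dvr_or_inv x : O x \/ O x^-1.
Proof.
have [->|x0] := eqVneq x 0; first by left; apply: dvr0.
have [z [e [he he' xE]]] := dvr_val hO x0.
have e0 := dvr_val_neq0 x0 xE.
have [hz|hz] := boolP (0 <= z)%R; first by left; rewrite xE; apply/dvr_unit_exp.
right; rewrite xE invfM invr_expz.
apply/dvr_unit_exp; rewrite ?invrK ?invr_eq0 //.
by move: hz; rewrite -ltNge oppr_ge0 => /ltW.
Qed.

Lemma dvr_res0 : res 0 = 0.
Proof.
by rewrite -(subrr 1) (dvr_resB hO) ?subrr //; apply: dvr_one hO.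
Qed.

(** Positive valuation would put x in u O, where the residue vanishes, and negative valuation
    contradicts integrality; only valuation 0 remains. *)
Lemma dvr_inv x : O x -> res x != 0 -> O x^-1.
Proof.
move=> hx rx; have x0 : x != 0 by apply: contraNneq rx => ->; rewrite dvr_res0.
have [z [e [he he' xE]]] := dvr_val hO x0.
have e0 := dvr_val_neq0 x0 xE.
case: z xE => [[|z]|z] xE; first by rewrite xE mulr1.
  case/eqP: rx; apply/(dvr_res_ker hO hx).
  rewrite xE -[u ^ _]/(u ^+ z.+1) exprSr mulrA mulfK ?dvr_unif_neq0 //.
  by apply: (dvr_mul hO) => //; apply: dvrX; case: (dvr_unif hO).
by move: hx; rewrite xE dvr_unit_exp.
Qed.

(** If x is not in O then its inverse is. Dividing the monic equation by x^d then writes x as a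
    polynomial in that inverse with coefficients in O. *)
Lemma dvr_integrally_closed (P : {poly K}) x :
  P \is monic -> (forall i, O P`_i) -> root P x -> O x.
Proof.
move=> mP hP rP; case: (dvr_or_inv x) => // hx.
have [->|x0] := eqVneq x 0; first exact: dvr0.
have [d sP] : exists d, size P = d.+2.
  case sP: (size P) => [|[|d]]; last by exists d.
    by move/monic_neq0: mP; rewrite -size_poly_eq0 sP.
  have lP := monicP mP; rewrite lead_coefE sP in lP.
  have P1 : P = 1 by rewrite (size1_polyC (eq_leq sP)) lP.
  by move: rP; rewrite P1 (negbTE (root1 x)).
have lP : P`_d.+1 = 1 by have := monicP mP; rewrite lead_coefE sP.
move: rP; rewrite /root horner_coef sP big_ord_recr /= lP mul1r addrC addr_eq0 => /eqP rP.
have -> : x = - \sum_(i < d.+1) P`_i * x^-1 ^+ (d - i).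
  apply: (mulIf (expf_neq0 d x0)); rewrite -exprS rP mulNr mulr_suml; congr (- _).
  apply: eq_bigr => i _; rewrite -mulrA; congr (_ * _).
  have hi : (i <= d)%N by rewrite -ltnS.
  have -> : x ^+ d = x ^+ (d - i) * x ^+ i by rewrite -exprD subnK.
  by rewrite mulrA -exprMn mulVf // expr1n mul1r.
by apply/dvrN/dvr_sum => i _; apply: (dvr_mul hO) => //; apply: dvrX.
Qed.

Lemma dvr_separated x : (forall i : nat, O (x / u ^+ i)) -> x = 0.
Proof.
move=> h; apply/eqP; apply/negPn/negP => x0.
have [z [e [he he' xE]]] := dvr_val hO x0.
have e0 := dvr_val_neq0 x0 xE.
(* The exponent |z| + 1 exceeds the valuation z of x. *)
have := h `|z|.+1%N; rewrite xE -mulrA -[u ^+ _]/(u ^ _%:Z) invr_expz -expfzDr ?dvr_unif_neq0 //.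
rewrite dvr_unit_exp // subr_ge0 => hz.
by have := le_trans hz (lez_abs z); rewrite lez_nat ltnn.
Qed.

End DiscreteValuationRings.

(** An integral embedding sends units to units; as it also matches the uniformizers, it preserves
    valuations. *)
Lemma dvr_reflect (K K' R R' : fieldType) (O : K -> Prop) (O' : K' -> Prop) u u'
    (res : K -> R) (res' : K' -> R') (f : {rmorphism K -> K'}) :
  is_dvr O u res -> is_dvr O' u' res' -> f u = u' ->
  (forall x, O x -> O' (f x)) -> forall x, O' (f x) -> O x.
Proof.
move=> hO hO' fu hf x hx.
have [->|x0] := eqVneq x 0; first exact: dvr0 hO.
have [z [e [he he' xE]]] := dvr_val hO x0.
have e0 := dvr_val_neq0 x0 xE.
move: hx; rewrite xE rmorphM fmorphXz /= fu.
rewrite (dvr_unit_exp hO') ?fmorph_eq0 // -?fmorphV; try exact: hf.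
by rewrite (dvr_unit_exp hO).
Qed.

(** * Conjugation, Frobenius and its fixed field *)

(** The polynomial T^2 - b T - a has the two roots x and b - x, and y must be one of them. *)
Lemma other_root (A : comRingType) (a b x y : A) :
  x * x = a + b * x -> y * y = a + b * y -> (y - x) * (y - (b - x)) = 0.
Proof.
move=> hx hy; have -> : (y - x) * (y - (b - x)) = (y * y - b * y) - (x * x - b * x) by ring.
by rewrite hx hy !addrK subrr.
Qed.

(** * Uniqueness of the nontrivial automorphism of a quadratic extension *)

Section QuadraticExtension.
Variables (K : fieldType) (E : fieldExtType K) (c f : E -> E).
Hypotheses (dimE : \dim {:E} = 2%N)
  (cD : {morph c : x y / x + y}) (cM : {morph c : x y / x * y})
  (cK : forall a : K, c a%:A = a%:A) (c_nontriv : exists x, c x != x)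
  (fD : {morph f : x y / x + y}) (fM : {morph f : x y / x * y})
  (fK : forall a : K, f a%:A = a%:A) (f_nontriv : exists x, f x != x).

Lemma quadratic_generator (x y : E) : c x != x -> exists a b : K, y = a%:A + b *: x.
Proof.
move=> cx; have fr : free [:: x; 1].
  rewrite free_cons seq1_free oner_neq0 andbT span_seq1.
  by apply: contra cx => /vlineP[a ->]; rewrite cK.
have /andP[/eqP sp _] : basis_of {:E} [:: x; 1].
  by rewrite basisEfree fr subvf dimE.
have := memvf y; rewrite -sp span_cons span_seq1.
case/memv_addP => _ /vlineP[b ->] [_ /vlineP[a ->] ->].
by exists a, b; rewrite addrC.
Qed.

(** Every nontrivial K-algebra map moves the generator x, hence sends it to the other root b - x of
    its quadratic equation. This determines the map and makes it an involution. *)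
Lemma quadratic_conj_unique : f =1 c /\ forall x, c (c x) = x.
Proof.
have [x cx] := c_nontriv.
have gen y := quadratic_generator y cx.
have ext (g : E -> E) : {morph g : x y / x + y} -> {morph g : x y / x * y} ->
    (forall a : K, g a%:A = a%:A) -> forall (a b : K) y, g (a%:A + b *: y) = a%:A + b *: g y.
  by move=> gD gM gK a b y; rewrite gD gK -[b *: y]mulr_algl gM gK mulr_algl.
have [a [b x2]] := gen (x * x).
have alt (g : E -> E) : {morph g : x y / x + y} -> {morph g : x y / x * y} ->
    (forall a : K, g a%:A = a%:A) -> (exists y, g y != y) -> g x = b%:A - x.
  move=> gD gM gK [y gy].
  have gx : g x != x.
    apply: contra gy => /eqP gx; have [a' [b' ->]] := gen y.
    by rewrite ext // gx.
  have := congr1 g x2; rewrite gM ext // => gx2.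
  have : (g x - x) * (g x - (b%:A - x)) = 0.
    by apply: (@other_root _ a%:A); rewrite mulr_algl.
  move/eqP; rewrite mulf_eq0 subr_eq0 (negbTE gx) /= subr_eq0 => /eqP //.
have cx' := alt c cD cM cK c_nontriv.
have fx' := alt f fD fM fK f_nontriv.
split=> y; have [a' [b' ->]] := gen y; first by rewrite !ext // fx' cx'.
rewrite !ext //; congr (_ + _ *: _); rewrite cx'.
have := ext c cD cM cK b (-1) x; rewrite !scaleN1r => ->.
by rewrite cx' opprB addrC subrK.
Qed.

End QuadraticExtension.

(** The polynomial X^d - X has at most d roots, fewer than F has elements. *)
Lemma finfield_frob_nontrivial (F : finFieldType) (d : nat) :
  (1 < d)%N -> (d < #|F|)%N -> exists x : F, x ^+ d != x.
Proof.
move=> d1 hd; apply: NNPP => h.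
have hx (x : F) : x ^+ d = x by apply/eqP/negPn/negP => h'; apply: h; exists x.
have sz : size ('X^d - 'X : {poly F}) = d.+1.
  by rewrite size_polyDl ?size_polyXn // size_polyN size_polyX ltnS.
have p0 : ('X^d - 'X : {poly F}) != 0 by rewrite -size_poly_eq0 sz.
have := max_poly_roots p0 (rs := enum F).
rewrite enum_uniq sz -cardE ltnS => /(_ _ isT) => H.
have : (#|F| <= d)%N.
  apply: H; apply/allP => x _; rewrite /root !hornerE hx subrr //.
by rewrite leqNgt hd.
Qed.

Section RelativeFrobenius.
Variables (L : local_fields) (W0 : witt L (FqE L))
  (phi0 : {rmorphism fldE L -> wK W0}).
Hypothesis hphi0 : is_phi0 phi0.

Lemma phi0_int x : OE x -> wW (phi0 x).
Proof.
move=> [P [mP hP rP]].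
apply: (dvr_integrally_closed (wW_dvr W0) (P := map_poly (wF W0) P)).
- by rewrite monic_map.
- by move=> i; rewrite coef_map; apply: wF_int.
- have -> : map_poly (wF W0) P = map_poly phi0 (map_poly (in_alg (fldE L)) P).
    by rewrite -map_poly_comp; apply: eq_map_poly => a; rewrite /= (phi0_F hphi0).
  by rewrite fmorph_root.
Qed.

Lemma phi0_OE x : wW (phi0 x) -> OE x.
Proof.
apply: (dvr_reflect (E_unramified L) (wW_dvr W0)); first exact: phi0_F hphi0 _.
exact: phi0_int.
Qed.

Lemma OE_conj (x : fldE L) : OE x -> OE (conjE L x).
Proof.
move=> [P [mP hP rP]]; exists P; split=> //.
have -> : map_poly (in_alg (fldE L)) P =
    map_poly (conjE L) (map_poly (in_alg (fldE L)) P).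
  by rewrite -map_poly_comp; apply: eq_map_poly => a /=; rewrite conjE_F.
by rewrite fmorph_root.
Qed.

Lemma q_gt1 : (1 < q L)%N.
Proof. by rewrite /q; apply: finNzRing_gt1. Qed.

Lemma FqE_frob_nontrivial : exists r : FqE L, r ^+ q L != r.
Proof.
apply: finfield_frob_nontrivial; first exact: q_gt1.
by rewrite FqE_card -/(q L) -{1}(expn1 (q L)) ltn_exp2l // q_gt1.
Qed.

(** Transported to E along [phi0], sigma is an F-algebra map. It is nontrivial because on residues
    it is the q-power map, which moves some element of F_{q^2}; so it is the conjugation. *)
Lemma frob_phi0_conj : frob W0 \o phi0 =1 phi0 \o conjE L /\ forall x, conjE L (conjE L x) = x.
Proof.
have [psi phiK psiK] := phi0_bij hphi0.
pose f x := psi (frob W0 (phi0 x)).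
have inj : injective phi0 by apply: can_inj phiK.
have fE x : phi0 (f x) = frob W0 (phi0 x) by rewrite /f psiK.
have [] := @quadratic_conj_unique _ (fldE L) (conjE L) f (E_quadratic L).
- exact: rmorphD.
- exact: rmorphM.
- exact: conjE_F.
- exact: conjE_nontrivial.
- by move=> x y; apply: inj; rewrite fE !rmorphD /= !fE.
- by move=> x y; apply: inj; rewrite fE !rmorphM /= !fE.
- by move=> a; apply: inj; rewrite fE !(phi0_F hphi0) frob_F.
- have [r hr] := FqE_frob_nontrivial.
  have [y hy yr] := dvr_res_surj (wW_dvr W0) r.
  exists (psi y); apply: contra hr => /eqP /(congr1 phi0); rewrite fE psiK => e.
  by rewrite -yr -(frob_res hy) e.
by move=> h h2; split=> // x /=; rewrite -h fE.
Qed.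

Lemma frob2_W0 (a : wK W0) : frob W0 (frob W0 a) = a.
Proof.
have [psi phiK psiK] := phi0_bij hphi0; have [h h2] := frob_phi0_conj.
rewrite -(psiK a); have /= -> := h (psi a).
by have /= -> := h (conjE L (psi a)); rewrite h2.
Qed.

(** Provides the integral idempotents: dividing by phi_0(z) - phi_0(conj z) later splits lattices
    stable under O_E. The element z lifts a residue r with r^q different from r, so the difference
    has nonzero residue. *)
Lemma exists_conj_unit : exists z : fldE L,
  [/\ OE z, wW (phi0 z - phi0 (conjE L z)), wW (phi0 z - phi0 (conjE L z))^-1
    & phi0 z - phi0 (conjE L z) != 0].
Proof.
have [psi phiK psiK] := phi0_bij hphi0; have [h h2] := frob_phi0_conj.
have [r hr] := FqE_frob_nontrivial.
have [y hy yr] := dvr_res_surj (wW_dvr W0) r.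
have hf := frob_int hy.
have ze : phi0 (psi y) - phi0 (conjE L (psi y)) = y - frob W0 y.
  by have /= <- := h (psi y); rewrite psiK.
have hd : wW (y - frob W0 y) by apply: (dvr_sub (wW_dvr W0)).
have hr' : wres (y - frob W0 y) != 0.
  by rewrite (dvr_resB (wW_dvr W0)) // frob_res // yr subr_eq0 eq_sym.
exists (psi y); rewrite ze; split=> //.
- by apply: phi0_OE; rewrite psiK.
- exact: dvr_inv (wW_dvr W0) _ hd hr'.
- by apply: contraNneq hr' => ->; rewrite (dvr_res0 (wW_dvr W0)).
Qed.

Lemma frob_int_reflect R (W : witt L R) x : wW (frob W x) -> wW x.
Proof.
apply: (dvr_reflect (wW_dvr W) (wW_dvr W)); first exact: frob_F.
exact: frob_int.
Qed.

(** * The fixed field of sigma^2 in F_R *)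

Section FixedField.
Variables (R : fieldType) (W : witt L R) (j : witt_morph W0 W).

(** X^(q^2) - X is the product of the X - t over all t in F_{q^2}, so it has no further roots in
    R. *)
Lemma residue_fixed (r : R) : r ^+ (q L ^ 2) = r -> exists t, r = mR j t.
Proof.
move=> hr; have := finField_genPoly (FqE L).
move/(congr1 (map_poly (mR j))); rewrite rmorphB /= map_polyXn map_polyX rmorph_prod /=.
move/(congr1 (fun p => p.[r])); rewrite FqE_card -/(q L) !hornerE hr subrr.
rewrite horner_prod => /esym/eqP/prodf_eq0[t _].
by rewrite rmorphB /= map_polyX map_polyC !hornerE subr_eq0 => /eqP ->; exists t.
Qed.

Let WW := wW_dvr W.

(** Both e and the image of s are fixed by sigma^2, hence so is the quotient r of their difference
    by pi^i. The residue of r therefore lies in F_{q^2}, and lifting it to W_{O_F}(F_{q^2}) gives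
    the next digit. *)
Lemma approximation_step e (s : wK W0) (i : nat) :
  frob W (frob W e) = e -> wW s -> wW ((e - mK j s) / wpi W ^+ i) ->
  exists s', [/\ wW s', wW ((s' - s) / wpi W0 ^+ i)
    & wW ((e - mK j s') / wpi W ^+ i.+1)].
Proof.
have u0 : wpi W != 0 := dvr_unif_neq0 WW.
have v0 : wpi W0 != 0 := dvr_unif_neq0 (wW_dvr W0).
move=> he hs hi; set r := _ / _ in hi.
have mKpi : mK j (wpi W0) = wpi W by apply: mK_F.
have fpi : frob W (wpi W) = wpi W by apply: frob_F.
have hr : frob W (frob W r) = r.
  rewrite /r !fmorph_div !rmorphXn /= !fpi !rmorphB /= he.
  by rewrite -!mK_frob frob2_W0.
have : wres r ^+ (q L ^ 2) = wres r.
  by rewrite expnS expn1 exprM -!frob_res ?hr //; apply: frob_int.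
case/residue_fixed => t ht; have [y hy yt] := dvr_res_surj (wW_dvr W0) t.
exists (s + wpi W0 ^+ i * y); split.
- apply: (dvrD (wW_dvr W0)) => //; apply: (dvr_mul (wW_dvr W0)) => //.
  by apply: (dvrX (wW_dvr W0)); case: (dvr_unif (wW_dvr W0)).
- by rewrite addrC addKr mulrC mulKf // expf_neq0.
- have -> : (e - mK j (s + wpi W0 ^+ i * y)) / wpi W ^+ i.+1 = (r - mK j y) / wpi W.
    rewrite exprSr invfM mulrA; congr (_ / _).
    rewrite rmorphD rmorphM rmorphXn /= mKpi opprD addrA mulrBl -/r.
    by rewrite [_ * mK j y]mulrC mulfK // expf_neq0.
  have hd : wW (r - mK j y) by apply: (dvr_sub WW) => //; apply: mK_int.
  apply/(dvr_res_ker WW hd); rewrite (dvr_resB WW) //; last exact: mK_int.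
  by rewrite mK_res // yt ht subrr.
Qed.

Lemma frob2_fixed_int e : wW e -> frob W (frob W e) = e -> exists a, e = mK j a.
Proof.
move=> he hf.
(* The premises are moved under the existential, with default value 0, so that choice yields a total
   successor function. *)
have H i (s : wK W0) : exists s', wW s -> wW ((e - mK j s) / wpi W ^+ i) ->
    [/\ wW s', wW ((s' - s) / wpi W0 ^+ i) & wW ((e - mK j s') / wpi W ^+ i.+1)].
  have [hs|] := classic (wW s); last by exists 0.
  have [hi|] := classic (wW ((e - mK j s) / wpi W ^+ i)); last by exists 0.
  by have [s' hs'] := approximation_step hf hs hi; exists s'.
pose nxt i s := proj1_sig (constructive_indefinite_description _ (H i s)).
have nxtP i s := proj2_sig (constructive_indefinite_description _ (H i s)).
pose s := fix s i := if i is i'.+1 then nxt i' (s i') else 0 : wK W0.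
have hs i : wW (s i) /\ wW ((e - mK j (s i)) / wpi W ^+ i).
  elim: i => [|i [h1 h2]]; last by have [] := nxtP i (s i) h1 h2.
  by rewrite /= rmorph0 subr0 divr1; split=> //; apply: (dvr0 (wW_dvr W0)).
(* Completeness is used downstairs to get the limit l; separatedness upstairs then identifies its
   image with e. *)
have [l hl] : exists l, forall i, wW ((l - s i) / wpi W0 ^+ i).
  apply: (@wW_complete _ _ W0) => i; first by case: (hs i).
  by have [h1 h2] := hs i; have [] := nxtP i (s i) h1 h2.
exists l; apply/eqP; rewrite -subr_eq0; apply/eqP.
apply: (dvr_separated WW) => i.
have -> : (e - mK j l) / wpi W ^+ i =
    (e - mK j (s i)) / wpi W ^+ i - mK j ((l - s i) / wpi W0 ^+ i).
  rewrite fmorph_div rmorphXn rmorphB /= [mK j (wpi _)]mK_F -mulrBl; congr (_ / _).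
  by rewrite opprB addrA subrK.
by apply: (dvr_sub WW); [case: (hs i) | apply: mK_int].
Qed.

Lemma frob2_fixed x : frob W (frob W x) = x -> exists a, x = mK j a.
Proof.
have [->|x0] := eqVneq x 0; first by exists 0; rewrite rmorph0.
have [z [e [he he' xE]]] := dvr_val WW x0.
have u0 : wpi W ^ z != 0 by apply: expfz_neq0; apply: dvr_unif_neq0 WW.
rewrite xE !rmorphM !fmorphXz /= !frob_F => /(mulIf u0) hf.
have [a ->] := frob2_fixed_int he hf.
by exists (a * wpi W0 ^ z); rewrite rmorphM fmorphXz /= [mK j (wpi _)]mK_F.
Qed.

End FixedField.
End RelativeFrobenius.

(** * Lattices and hermitian isocrystals *)

Section Spans.
Variables (K R : fieldType) (V : vectType K) (O : K -> Prop) (u : K) (res : K -> R).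
Hypothesis hO : is_dvr O u res.

Definition indep N (s : 'I_N -> V) :=
  forall a : 'I_N -> K, \sum_i a i *: s i = 0 -> forall i, a i = 0.

Lemma indep_spans N (s : 'I_N -> V) : \dim {:V} = N -> indep s ->
  forall v, exists a : 'I_N -> K, v = \sum_i a i *: s i.
Proof.
move=> dV hs v; pose X := [tuple s i | i < N].
have sX (i : 'I_N) : X`_i = s i by rewrite -tnth_nth tnth_mktuple.
have fX : free X.
  apply/freeP => a ha; apply: hs; rewrite -[RHS]ha.
  by apply: eq_bigr => i _; rewrite sX.
have bX : basis_of {:V} X by rewrite basisEfree fX subvf dV size_tuple /=.
exists (fun i => coord X i v); rewrite {1}(coord_basis bX (memvf v)).
by apply: eq_bigr => i _; rewrite sX.
Qed.

Lemma span_over_ind (S M : V -> Prop) :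
  M 0 -> (forall v w, M v -> M w -> M (v + w)) ->
  (forall a v, O a -> S v -> M (a *: v)) -> incl (span_over O S) M.
Proof.
move=> M0 MD MZ _ [N [a [s [ha hs ->]]]].
by apply: big_ind => // i _; apply: MZ.
Qed.

Lemma mem_span_over (S : V -> Prop) v : S v -> span_over O S v.
Proof.
move=> hv; exists 1%N, (fun=> 1), (fun=> v); split=> //.
  by move=> _; apply: dvr_one hO.
by rewrite big_ord1 scale1r.
Qed.

Lemma span_over0 (S : V -> Prop) : span_over O S 0.
Proof.
by exists 0%N, (fun=> 0), (fun=> 0); split; rewrite ?big_ord0 //; case.
Qed.

Lemma span_overD (S : V -> Prop) v w :
  span_over O S v -> span_over O S w -> span_over O S (v + w).
Proof.
move=> [N [a [s [ha hs ->]]]] [M [b [t [hb ht ->]]]].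
exists (N + M)%N, (fun i => match split i with inl i => a i | inr i => b i end),
  (fun i => match split i with inl i => s i | inr i => t i end); split.
- by move=> i; case: (split i).
- by move=> i; case: (split i).
- rewrite big_split_ord /=; congr (_ + _); apply: eq_bigr => i _.
    by rewrite (unsplitK (inl i : 'I_N + 'I_M)%type).
  by rewrite (unsplitK (inr i : 'I_N + 'I_M)%type).
Qed.

Lemma span_overZ (S : V -> Prop) c v : O c -> span_over O S v -> span_over O S (c *: v).
Proof.
move=> hc [N [a [s [ha hs ->]]]]; exists N, (fun i => c * a i), s; split=> //.
  by move=> i; apply: (dvr_mul hO).
by rewrite scaler_sumr; apply: eq_bigr => i _; rewrite scalerA.
Qed.

Lemma incl_scale (c : K) (A B : V -> Prop) :
  c != 0 -> incl (scale_set c A) (scale_set c B) <-> incl A B.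
Proof.
move=> c0; split=> h v; last by case=> w /h hw ->; exists w.
move=> hv; have [|w hw /(scalerI c0) ->] // := h (c *: v).
by exists v.
Qed.

Variable M : V -> Prop.
Hypothesis hM : is_lattice O M.

Lemma lattice_sub_closed c v w : O c -> M v -> M w -> M (c *: v + w).
Proof.
case: hM => e [be h] hc /h hv /h hw; apply/h => i; rewrite linearP.
exact: (dvrD hO (dvr_mul hO hc (hv i)) (hw i)).
Qed.

Lemma lattice0 : M 0.
Proof. by case: hM => e [_ h]; apply/h => i; rewrite linear0; apply: dvr0 hO. Qed.

Lemma latticeD v w : M v -> M w -> M (v + w).
Proof. by move=> hv hw; rewrite -[v]scale1r; apply: lattice_sub_closed => //; apply: dvr_one hO. Qed.

Lemma latticeZ c v : O c -> M v -> M (c *: v).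
Proof. by move=> hc hv; rewrite -[_ *: _]addr0; apply: lattice_sub_closed => //; apply: lattice0. Qed.

End Spans.

(** The properties of phi_0 that pass to its images in F_kappa and F_k. *)
Record conj_embedding L R (W : witt L R) (phi : fldE L -> wK W) : Prop := ConjEmbedding {
  ce_frob : forall x, frob W (phi x) = phi (conjE L x);
  ce_int : forall x, OE x -> wW (phi x);
  ce_unit : exists z, [/\ OE z, wW (phi z - phi (conjE L z))^-1
    & phi z - phi (conjE L z) != 0];
  ce_conj2 : forall x : fldE L, conjE L (conjE L x) = x
}.

(** Common interface for the isocrystal over F_{q^2}, kappa and k, so that one set of lemmas serves
    all three. *)
Record unitary_isocrystal L R (W : witt L R) (N : isocrystal W) (n : nat) : Prop :=
  UnitaryIsocrystal {
  ui_F : forall a (v w : nV N), nF (a *: v + w) = frob W a *: nF v + nF w;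
  ui_V : forall a (v w : nV N), nVer (frob W a *: v + w) = a *: nVer v + nVer w;
  ui_FV : forall v : nV N, nF (nVer v) = wpi W *: v;
  ui_VF : forall v : nV N, nVer (nF v) = wpi W *: v;
  ui_E : forall x a (v w : nV N), OE x -> nE x (a *: v + w) = a *: nE x v + nE x w;
  ui_EF : forall x (v : nV N), OE x -> nE x (nF v) = nF (nE x v);
  ui_EV : forall x (v : nV N), OE x -> nE x (nVer v) = nVer (nE x v);
  ui_forml : forall a (v v' w : nV N),
    nform (a *: v + v') w = a * nform v w + nform v' w;
  ui_formr : forall a (v w w' : nV N),
    nform v (a *: w + w') = a * nform v w + nform v w';
  ui_alt : forall v : nV N, nform v v = 0;
  ui_formF : forall v w : nV N, nform (nF v) w = frob W (nform v (nVer w));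
  ui_formE : forall x (v w : nV N), OE x -> nform v (nE x w) = nform (nE (conjE L x) v) w;
  ui_nondeg : forall v : nV N, (forall w, nform w v = 0) -> v = 0;
  ui_dim : \dim {:nV N} = (n + n)%N
}.

(** * The alternating pairing and dual families *)

Section UnitaryIsocrystals.
Variables (L : local_fields) (R : fieldType) (W : witt L R) (N : isocrystal W) (n : nat).
Variable phi : fldE L -> wK W.
Hypotheses (hN : unitary_isocrystal N n) (hphi : conj_embedding phi).

Let WW := wW_dvr W.

Lemma wpi_neq0 : wpi W != 0. Proof. exact: dvr_unif_neq0 WW. Qed.
Lemma frob_wpi : frob W (wpi W) = wpi W. Proof. exact: frob_F. Qed.

Lemma nFD (v w : nV N) : nF (v + w) = nF v + nF w.
Proof. by have := ui_F hN 1 v w; rewrite rmorph1 !scale1r. Qed.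
Lemma nF0 : nF (0 : nV N) = 0.
Proof. by apply: (addrI (nF 0)); rewrite -nFD !addr0. Qed.
Lemma nFZ a (v : nV N) : nF (a *: v) = frob W a *: nF v.
Proof. by rewrite -[a *: v]addr0 (ui_F hN) nF0 addr0. Qed.
Lemma nF_sum k (s : 'I_k -> nV N) : nF (\sum_i s i) = \sum_i nF (s i).
Proof. exact: (big_morph _ nFD nF0). Qed.

Lemma nVD (v w : nV N) : nVer (v + w) = nVer v + nVer w.
Proof. by have := ui_V hN 1 v w; rewrite rmorph1 !scale1r. Qed.
Lemma nV0 : nVer (0 : nV N) = 0.
Proof. by apply: (addrI (nVer 0)); rewrite -nVD !addr0. Qed.
Lemma nVZ a (v : nV N) : nVer (frob W a *: v) = a *: nVer v.
Proof. by rewrite -[_ *: v]addr0 (ui_V hN) nV0 addr0. Qed.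
Lemma nF_inj (v w : nV N) : nF v = nF w -> v = w.
Proof.
by move=> h; apply: (scalerI wpi_neq0); rewrite -!(ui_VF hN) h.
Qed.

Lemma form0l (w : nV N) : nform 0 w = 0.
Proof. by have := ui_forml hN 1 0 0 w; rewrite scaler0 addr0 mul1r -{1}[nform 0 w]addr0 => /addrI. Qed.
Lemma form0r (w : nV N) : nform w 0 = 0.
Proof. by have := ui_formr hN 1 w 0 0; rewrite scaler0 addr0 mul1r -{1}[nform w 0]addr0 => /addrI. Qed.
Lemma formDl (v v' w : nV N) : nform (v + v') w = nform v w + nform v' w.
Proof. by rewrite -[v]scale1r (ui_forml hN) mul1r scale1r. Qed.
Lemma formDr (v w w' : nV N) : nform v (w + w') = nform v w + nform v w'.
Proof. by rewrite -[w]scale1r (ui_formr hN) mul1r scale1r. Qed.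
Lemma formZl a (v w : nV N) : nform (a *: v) w = a * nform v w.
Proof. by rewrite -[_ *: v]addr0 (ui_forml hN) form0l addr0. Qed.
Lemma formZr a (v w : nV N) : nform v (a *: w) = a * nform v w.
Proof. by rewrite -[_ *: w]addr0 (ui_formr hN) form0r addr0. Qed.
Lemma form_suml k (s : 'I_k -> nV N) w : nform (\sum_i s i) w = \sum_i nform (s i) w.
Proof. exact: (big_morph (fun v => nform v w) (fun v v' => formDl v v' w) (form0l w)). Qed.
Lemma form_sumr k (s : 'I_k -> nV N) w : nform w (\sum_i s i) = \sum_i nform w (s i).
Proof. exact: (big_morph (fun v => nform w v) (fun v v' => formDr w v v') (form0r w)). Qed.
Lemma form_anti (v w : nV N) : nform v w = - nform w v.
Proof.
apply/eqP; rewrite -addr_eq0; have := ui_alt hN (v + w).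
by rewrite formDl !formDr !(ui_alt hN) add0r addr0 => ->.
Qed.

Lemma form_nF (v w : nV N) : nform v (nF w) = frob W (nform (nVer v) w).
Proof. by rewrite form_anti (ui_formF hN) form_anti rmorphN opprK. Qed.

(** The Gram matrix is invertible, since a row vector in its kernel would give a vector orthogonal
    to everything. The rows of its inverse are the coordinates of the dual family. *)
Lemma dual_family k (s : 'I_k -> nV N) : \dim {:nV N} = k -> indep s ->
  exists g : 'I_k -> nV N, forall i l, nform (g i) (s l) = (i == l)%:R.
Proof.
move=> dV hs; pose G := \matrix_(i < k, l < k) nform (s i) (s l).
have uG : G \in unitmx.
  rewrite -row_free_unit -kermx_eq0; apply/eqP/row_matrixP => r; rewrite row0.
  set u := row r _; have uG0 : u *m G = 0 by rewrite -row_mul mulmx_ker row0.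
  suff v0 : \sum_i u 0 i *: s i = 0.
    by apply/rowP => i; rewrite (hs (fun i => u 0 i) v0) mxE.
  apply: (ui_nondeg hN) => w; have [a ->] := indep_spans dV hs w.
  rewrite form_anti form_sumr big1 ?oppr0 // => l _.
  rewrite formZr form_suml.
  have -> : \sum_i nform (u 0 i *: s i) (s l) = (u *m G) 0 l.
    by rewrite mxE; apply: eq_bigr => i _; rewrite formZl [G _ _]mxE.
  by rewrite uG0 mxE mulr0.
exists (fun i => \sum_l invmx G i l *: s l) => i l.
rewrite form_suml -[RHS](_ : (1%:M : 'M[wK W]_k) i l = _); last by rewrite mxE.
by rewrite -(mulVmx uG) mxE; apply: eq_bigr => c _; rewrite formZl [G _ _]mxE.
Qed.

(** The family dual to a basis of M lies in the dual lattice, and its pairings with y are the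
    coordinates of y. *)
Lemma lattice_bidual (M : nV N -> Prop) (y : nV N) : is_lattice (wW (w := W)) M ->
  (forall v, (forall w, M w -> wW (nform v w)) -> wW (nform v y)) -> M y.
Proof.
move=> [e [be he]] hy.
have ie : indep (fun i : 'I_(\dim {:nV N}) => e`_i).
  by have := be; rewrite basisEfree => /andP[/freeP fe _]; apply: fe.
have [g hg] := dual_family (erefl _) ie.
have gc i v : nform (g i) v = coord e i v.
  rewrite {1}(coord_basis be (memvf v)) form_sumr (bigD1 i) //= formZr hg eqxx mulr1.
  by rewrite big1 ?addr0 // => l li; rewrite formZr hg eq_sym (negbTE li) mulr0.
by apply/he => i; rewrite -gc; apply: hy => w /he hw; rewrite gc.
Qed.

(** * The decomposition of the isocrystal *)

Lemma nE0 x : OE x -> nE x (0 : nV N) = 0.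
Proof.
move=> hx; have := ui_E hN 1 0 0 hx.
by rewrite scaler0 addr0 scale1r -{1}[nE x 0]addr0 => /addrI.
Qed.

Lemma nED x (v w : nV N) : OE x -> nE x (v + w) = nE x v + nE x w.
Proof. by move=> hx; have := ui_E hN 1 v w hx; rewrite !scale1r. Qed.

Lemma N0_comb a (v w : nV N) : N0 phi v -> N0 phi w -> N0 phi (a *: v + w).
Proof.
by move=> hv hw x hx; rewrite (ui_E hN) // hv // hw // scalerDr !scalerA mulrC.
Qed.
Lemma N1_comb a (v w : nV N) : N1 phi v -> N1 phi w -> N1 phi (a *: v + w).
Proof.
by move=> hv hw x hx; rewrite (ui_E hN) // hv // hw // scalerDr !scalerA mulrC.
Qed.
Lemma N0_0 : N0 phi (0 : nV N).
Proof. by move=> x hx; rewrite nE0 // scaler0. Qed.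
Lemma N1_0 : N1 phi (0 : nV N).
Proof. by move=> x hx; rewrite nE0 // scaler0. Qed.
Lemma N0D (v w : nV N) : N0 phi v -> N0 phi w -> N0 phi (v + w).
Proof. by move=> hv hw; rewrite -[v]scale1r; apply: N0_comb. Qed.
Lemma N1D (v w : nV N) : N1 phi v -> N1 phi w -> N1 phi (v + w).
Proof. by move=> hv hw; rewrite -[v]scale1r; apply: N1_comb. Qed.
Lemma N0Z a (v : nV N) : N0 phi v -> N0 phi (a *: v).
Proof. by move=> hv; rewrite -[_ *: _]addr0; apply: N0_comb (N0_0). Qed.
Lemma N1Z a (v : nV N) : N1 phi v -> N1 phi (a *: v).
Proof. by move=> hv; rewrite -[_ *: _]addr0; apply: N1_comb (N1_0). Qed.
Lemma N0B (v w : nV N) : N0 phi v -> N0 phi w -> N0 phi (v - w).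
Proof. by move=> hv hw; apply: N0D => //; rewrite -scaleN1r; apply: N0Z. Qed.
Lemma N1B (v w : nV N) : N1 phi v -> N1 phi w -> N1 phi (v - w).
Proof. by move=> hv hw; apply: N1D => //; rewrite -scaleN1r; apply: N1Z. Qed.
Lemma N0_sum k (a : 'I_k -> wK W) (s : 'I_k -> nV N) :
  (forall i, N0 phi (s i)) -> N0 phi (\sum_i a i *: s i).
Proof. by move=> h; apply: big_ind => [|v w|i _]; [apply: N0_0|apply: N0D|apply: N0Z]. Qed.
Lemma N1_sum k (a : 'I_k -> wK W) (s : 'I_k -> nV N) :
  (forall i, N1 phi (s i)) -> N1 phi (\sum_i a i *: s i).
Proof. by move=> h; apply: big_ind => [|v w|i _]; [apply: N1_0|apply: N1D|apply: N1Z]. Qed.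

(** F and V are semilinear and sigma turns [phi] into its conjugate, so both operators exchange N_0
    and N_1. *)
Lemma N0_nF (v : nV N) : N0 phi v -> N1 phi (nF v).
Proof. by move=> hv x hx; rewrite (ui_EF hN) // hv // nFZ (ce_frob hphi). Qed.
Lemma N1_nF (v : nV N) : N1 phi v -> N0 phi (nF v).
Proof.
by move=> hv x hx; rewrite (ui_EF hN) // hv // nFZ (ce_frob hphi) (ce_conj2 hphi).
Qed.
Lemma N0_nV (v : nV N) : N0 phi v -> N1 phi (nVer v).
Proof.
move=> hv x hx; rewrite (ui_EV hN) // hv //.
by rewrite -{1}(ce_conj2 hphi x) -(ce_frob hphi) nVZ.
Qed.
Lemma N1_nV (v : nV N) : N1 phi v -> N0 phi (nVer v).
Proof.
by move=> hv x hx; rewrite (ui_EV hN) // hv // -(ce_frob hphi) nVZ.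
Qed.

Lemma N0_N1_eq0 (v : nV N) : N0 phi v -> N1 phi v -> v = 0.
Proof.
move=> h0 h1; have [z [hz _ z0]] := ce_unit hphi.
apply: (scalerI z0); rewrite scaler0 scalerBl -h0 // -h1 // subrr //.
Qed.

Lemma N0_N1_uniq (v v' w w' : nV N) : N0 phi v -> N0 phi v' -> N1 phi w -> N1 phi w' ->
  v + w = v' + w' -> v = v' /\ w = w'.
Proof.
move=> hv hv' hw hw' h.
have e : v - v' = w' - w.
  have -> : v = v' + w' - w by rewrite -h addrK.
  by rewrite addrAC [v' + w']addrC addrK.
have z : v - v' = 0 by apply: N0_N1_eq0; [apply: N0B | rewrite e; apply: N1B].
split; first by apply/eqP; rewrite -subr_eq0 z.
by apply/esym/eqP; rewrite -subr_eq0 -e z.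
Qed.

(** The adjoint of z is its conjugate, which acts on N_0 by a different scalar; so N_0 is isotropic,
    and N_1 likewise. *)
Lemma form_N0 (v w : nV N) : N0 phi v -> N0 phi w -> nform v w = 0.
Proof.
move=> hv hw; have [z [hz _ z0]] := ce_unit hphi.
apply: (mulfI z0); rewrite mulr0 mulrBl -formZr -hw // (ui_formE hN) // hv ?formZl ?subrr //.
exact: OE_conj.
Qed.
Lemma form_N1 (v w : nV N) : N1 phi v -> N1 phi w -> nform v w = 0.
Proof.
move=> hv hw; have [z [hz _ z0]] := ce_unit hphi.
apply: (mulfI z0); rewrite mulr0 mulrBl -[phi (conjE L z) * _]formZr -hw //.
rewrite (ui_formE hN) // hv ?(ce_conj2 hphi) ?formZl ?subrr //.
exact: OE_conj.
Qed.

End UnitaryIsocrystals.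

Arguments N0_0 {L R W N n phi}.
Arguments N1_0 {L R W N n phi}.

(** * Bases of tau-invariants *)

Section TauInvariants.
Variables (L : local_fields) (W0 : witt L (FqE L)) (phi0 : {rmorphism fldE L -> wK W0}).
Hypothesis hphi0 : is_phi0 phi0.
Variables (R : fieldType) (W : witt L R) (j : witt_morph W0 W) (N : isocrystal W) (n : nat).
Variables (phi : fldE L -> wK W) (delta : wK W0).
Hypotheses (hN : unitary_isocrystal N n) (hphi : conj_embedding phi).
Hypothesis hdelta : frob W0 delta = - delta.
Hypothesis delta_neq0 : delta != 0.

Local Notation del := (mK j delta).

Lemma tauE (v : nV N) : tau v = (wpi W)^-1 *: nF (nF v).
Proof.
rewrite /tau /Vinv (nFZ hN) !scalerA fmorphV frob_wpi.
by rewrite mulfV ?wpi_neq0 // mul1r.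
Qed.

Lemma tau_comb a (v w : nV N) : tau (a *: v + w) = frob W (frob W a) *: tau v + tau w.
Proof. by rewrite !tauE !(ui_F hN) scalerDr !scalerA mulrC. Qed.

Lemma tau0 : tau (0 : nV N) = 0.
Proof. by rewrite tauE !(nF0 hN) scaler0. Qed.

Lemma tau_sum k (a : 'I_k -> wK W) (s : 'I_k -> nV N) :
  tau (\sum_i a i *: s i) = \sum_i frob W (frob W (a i)) *: tau (s i).
Proof.
elim: k a s => [|k IH] a s; first by rewrite !big_ord0 tau0.
by rewrite !big_ord_recl tau_comb IH.
Qed.

Lemma Cset_nVV (v : nV N) : Cset phi v -> nVer (nVer v) = wpi W *: v.
Proof.
case=> _ tv; have FF : nF (nF v) = wpi W *: v.
  by rewrite -{2}tv tauE scalerA mulfV ?wpi_neq0 // scale1r.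
apply: (nF_inj hN); rewrite (ui_FV hN); apply: (nF_inj hN).
by rewrite !(nFZ hN) (ui_FV hN) !frob_wpi FF.
Qed.

Section Basis.
Variables (e : 'I_n -> nV N).
Hypothesis eC : forall i, Cset phi (e i).
Hypothesis e_gen : forall v : nV N, Cset phi v ->
  exists! a : 'rV[wK W0]_n, v = \sum_i mK j (a 0 i) *: e i.

(* Minimal relation argument: a shortest relation normalized to have a
   coefficient 1 is fixed by tau, so its coefficients lie in [wK W0]. *)
Lemma Cset_basis_indep : indep e.
Proof.
move=> a; have [k] := ubnP #|[pred i | a i != 0]|.
elim: k a => // k IH a hk ha i; apply/eqP/negPn/negP => ai.
pose b l := a l / a i.
have bi : b i = 1 by rewrite /b mulfV.
have hb : \sum_l b l *: e l = 0.
  transitivity ((a i)^-1 *: \sum_l a l *: e l); last by rewrite ha scaler0.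
  by rewrite scaler_sumr; apply: eq_bigr => l _; rewrite scalerA mulrC.
have hc : \sum_l (frob W (frob W (b l)) - b l) *: e l = 0.
  under eq_bigr do rewrite scalerBl.
  rewrite sumrB hb subr0; transitivity (tau (\sum_l b l *: e l)); last by rewrite hb tau0.
  rewrite tau_sum.
  by apply: eq_bigr => l _; case: (eC l) => _ ->.
have fb l : frob W (frob W (b l)) = b l.
  apply/eqP; rewrite -subr_eq0; apply/eqP; apply: (IH _ _ hc).
  rewrite ltnS in hk; apply: leq_trans hk; apply: proper_card; apply/properP; split.
    apply/subsetP => t; rewrite !inE; apply: contra => /eqP at0.
    by rewrite /b at0 mul0r !rmorph0 subrr.
  by exists i; rewrite inE ?ai // bi !rmorph1 subrr eqxx.
have [c hc'] : exists c : 'rV[wK W0]_n, forall l, b l = mK j (c 0 l).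
  have H l := frob2_fixed hphi0 j (fb l).
  exists (\row_l proj1_sig (constructive_indefinite_description _ (H l))) => l.
  by rewrite mxE; case: constructive_indefinite_description.
(* The normalized relation now has coefficients in [wK W0]. Uniqueness of the expansion of 0 kills
   them all, against the coefficient 1 at i. *)
have C0 : Cset phi (0 : nV N) by split; [apply: (N0_0 hN) | apply: tau0].
have [z [_ zu]] := e_gen C0.
have c0 : c = 0.
  rewrite -(zu c); last by rewrite -[LHS]hb; apply: eq_bigr => l _; rewrite hc'.
  by apply: zu; rewrite big1 // => l _; rewrite mxE rmorph0 scale0r.
by move/eqP: bi; rewrite hc' c0 mxE rmorph0 eq_sym oner_eq0.
Qed.

(** A basis of the whole isocrystal, adapted to N_0 and N_1, since F carries N_0 into N_1. *)
Definition eFe (i : 'I_(n + n)) : nV N :=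
  match split i with inl i => e i | inr i => nF (e i) end.

Lemma eFe_l i : eFe (lshift n i) = e i.
Proof. by rewrite /eFe (unsplitK (inl i : 'I_n + 'I_n)%type). Qed.
Lemma eFe_r i : eFe (rshift n i) = nF (e i).
Proof. by rewrite /eFe (unsplitK (inr i : 'I_n + 'I_n)%type). Qed.

Lemma eFe_sum (a : 'I_(n + n) -> wK W) : \sum_i a i *: eFe i =
  \sum_i a (lshift n i) *: e i + \sum_i a (rshift n i) *: nF (e i).
Proof.
by rewrite big_split_ord /=; congr (_ + _); apply: eq_bigr => i _; rewrite ?eFe_l ?eFe_r.
Qed.

Lemma e_N0 i : N0 phi (e i). Proof. by case: (eC i). Qed.
Lemma Fe_N1 i : N1 phi (nF (e i)). Proof. exact: (N0_nF hN hphi (@e_N0 i)). Qed.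

Lemma eFe_indep : indep eFe.
Proof.
move=> a; rewrite eFe_sum => ha.
have [h0 h1] : \sum_i a (lshift n i) *: e i = 0 /\ \sum_i a (rshift n i) *: nF (e i) = 0.
  apply: (N0_N1_uniq hN hphi); rewrite ?addr0 //.
  - by apply: (N0_sum hN) => i; apply: e_N0.
  - exact: (N0_0 hN).
  - by apply: (N1_sum hN) => i; apply: Fe_N1.
  - exact: (N1_0 hN).
(* Untwisting the coefficients by the inverse of sigma turns the relation among the F e_i into one
   among the e_i. *)
have [g fg gf] := frob_bij W.
have h1' : \sum_i g (a (rshift n i)) *: e i = 0.
  apply: (nF_inj hN); rewrite (nF0 hN) -[RHS]h1 (nF_sum hN).
  by apply: eq_bigr => i _; rewrite (nFZ hN) gf.
move=> i; rewrite -(splitK i); case: (split i) => l /=.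
  exact: (Cset_basis_indep h0).
by rewrite -(gf (a _)) (Cset_basis_indep h1') rmorph0.
Qed.

Lemma eFe_spans (v : nV N) : exists a b : 'I_n -> wK W,
  v = \sum_i a i *: e i + \sum_i b i *: nF (e i).
Proof.
have [a ->] := indep_spans (ui_dim hN) eFe_indep v.
by exists (fun i => a (lshift n i)), (fun i => a (rshift n i)); rewrite eFe_sum.
Qed.

(** The two factors pi produced by V F = pi cancel the two inverses in tau = pi^-1 F^2, and delta
    changes sign twice. *)
Lemma herm_tau (v w : nV N) : herm del (tau v) (tau w) = frob W (frob W (herm del v w)).
Proof.
have p0 := wpi_neq0 W.
have h : nform (nF (nF v)) (nF (nF (nF w))) = wpi W * (wpi W * frob W (frob W (nform v (nF w)))).
  rewrite (ui_formF hN) (ui_VF hN) (formZr hN) rmorphM frob_wpi.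
  by rewrite (ui_formF hN) (ui_VF hN) (formZr hN) !rmorphM /= !frob_wpi.
rewrite /herm !tauE (nFZ hN) (formZl hN) (formZr hN) h fmorphV frob_wpi !mulKf //.
by rewrite !rmorphM /= -!mK_frob hdelta rmorphN /= hdelta opprK.
Qed.

(** The vectors are those dual to the F e_i in the basis [eFe], divided by delta. Membership in N_0
    and tau-invariance are read off from pairings, by nondegeneracy. *)
Lemma Cset_dual_basis : exists g : 'I_n -> nV N, (forall i, Cset phi (g i)) /\
  forall i l, herm del (g i) (e l) = (i == l)%:R.
Proof.
have [g hg] := dual_family hN (ui_dim hN) eFe_indep.
have d0 : del != 0 by rewrite fmorph_eq0.
pose g' i := del^-1 *: g (rshift n i).
have herm_g i l : herm del (g' i) (e l) = (i == l)%:R.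
  rewrite /herm /g' (formZl hN) mulVKf // -eFe_r hg.
  by rewrite (inj_eq (@rshift_inj _ _)).
have form_g i l : nform (g' i) (e l) = 0.
  by rewrite /g' (formZl hN) -eFe_l hg eq_sym -val_eqE /= ltn_eqF ?mulr0 // ltn_addr.
(* The N_1-component pairs to 0 with N_1 by isotropy, and with N_0 because [g' i] and its
   N_0-component both do; so it vanishes. *)
have g_N0 i : N0 phi (g' i).
  have [a [b gE]] := eFe_spans (g' i).
  have gN0 : N0 phi (\sum_i a i *: e i) by apply: (N0_sum hN) => l; apply: e_N0.
  have gN1 : N1 phi (\sum_i b i *: nF (e i)) by apply: (N1_sum hN) => l; apply: Fe_N1.
  suff g1 : \sum_i b i *: nF (e i) = 0 by rewrite gE g1 addr0.
  apply: (ui_nondeg hN) => w; rewrite (form_anti hN).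
  have [c [d ->]] := eFe_spans w.
  rewrite (formDr hN) [X in _ + X](form_N1 hN hphi gN1) ?addr0; last first.
    by apply: (N1_sum hN) => l; apply: Fe_N1.
  rewrite (form_sumr hN) big1 ?oppr0 // => l _; rewrite (formZr hN).
  have := form_g i l; rewrite gE (formDl hN) (form_N0 hN hphi gN0) ?add0r; last exact: e_N0.
  by move=> ->; rewrite mulr0.
exists g'; split=> // i; split=> //.
apply/eqP; rewrite -subr_eq0; apply/eqP; apply: (ui_nondeg hN) => w.
have tN0 : N0 phi (tau (g' i) - g' i).
  apply: (N0B hN) => //; rewrite tauE; apply: (N0Z hN).
  by apply: (N1_nF hN hphi); apply: (N0_nF hN hphi).
rewrite (form_anti hN); have [c [d ->]] := eFe_spans w.
rewrite (formDr hN) (form_N0 hN hphi tN0) ?add0r; last first.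
  by apply: (N0_sum hN) => l; apply: e_N0.
rewrite (form_sumr hN) big1 ?oppr0 // => l _; rewrite (formZr hN).
(* Since tau fixes e_l, pairing tau(g'_i) with e_l gives sigma^2 of 0 or 1, the same value as for
   g'_i. *)
have h : herm del (tau (g' i) - g' i) (e l) = 0.
  have := herm_tau (g' i) (e l); case: (eC l) => _ ->; rewrite herm_g rmorph_nat rmorph_nat => h.
  rewrite /herm (formDl hN) -scaleN1r [X in _ + X](formZl hN) mulN1r mulrBr.
  by have := herm_g i l; move: h; rewrite /herm => -> ->; rewrite subrr.
by have /eqP := h; rewrite mulf_eq0 (negbTE d0) /= => /eqP ->; rewrite mulr0.
Qed.

End Basis.

End TauInvariants.

(** * The two lattice criteria *)

Record isocrystal_extension L R R' (W : witt L R) (W' : witt L R')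
    (j : witt_morph W W') (N : isocrystal W) (N' : isocrystal W')
    (b : nV N -> nV N') : Prop := IsocrystalExtension {
  ie_semilin : forall a v w, b (a *: v + w) = mK j a *: b v + b w;
  ie_F : forall v, b (nF v) = nF (b v);
  ie_V : forall v, b (nVer v) = nVer (b v);
  ie_E : forall x v, OE x -> b (nE x v) = nE x (b v);
  ie_form : forall v w, nform (b v) (b w) = mK j (nform v w);
  ie_span : forall v', span_over (fun=> True) (fun w => exists u, w = b u) v'
}.

Section ExtendedLattices.
Variables (L : local_fields) (W0 : witt L (FqE L)) (phi0 : {rmorphism fldE L -> wK W0}).
Hypothesis hphi0 : is_phi0 phi0.
Variables (R R' : fieldType) (W : witt L R) (W' : witt L R') (j0 : witt_morph W0 W)
  (j : witt_morph W W') (N : isocrystal W) (N' : isocrystal W') (n : nat).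
Variables (phi : fldE L -> wK W) (delta : wK W0) (b : nV N -> nV N').
Local Notation phi' := (fun x => mK j (phi x)).
Local Notation del := (mK j0 delta).
Local Notation del' := (mK j del).
Hypotheses (hN : unitary_isocrystal N n) (hN' : unitary_isocrystal N' n)
  (hphi : conj_embedding phi) (hphi' : conj_embedding phi')
  (hb : isocrystal_extension j b).
Hypothesis hdelta : [/\ delta != 0, wW delta, wW delta^-1 & frob W0 delta = - delta].
Let WW := wW_dvr W.
Let WW' := wW_dvr W'.

Lemma ext0 : b 0 = 0.
Proof.
have := ie_semilin hb 1 0 0; rewrite scaler0 addr0 rmorph1 scale1r.
by rewrite -{1}[b 0]addr0 => /addrI.
Qed.
Lemma extD v w : b (v + w) = b v + b w.
Proof. by rewrite -[v]scale1r (ie_semilin hb) rmorph1 !scale1r. Qed.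
Lemma extZ a v : b (a *: v) = mK j a *: b v.
Proof. by rewrite -[_ *: v]addr0 (ie_semilin hb) ext0 addr0. Qed.
Lemma ext_sum k (s : 'I_k -> nV N) : b (\sum_i s i) = \sum_i b (s i).
Proof. exact: (big_morph _ extD ext0). Qed.

Lemma ext_N0 v : N0 phi v -> N0 phi' (b v).
Proof. by move=> h x hx; rewrite -(ie_E hb) // h // extZ. Qed.
Lemma ext_N1 v : N1 phi v -> N1 phi' (b v).
Proof. by move=> h x hx; rewrite -(ie_E hb) // h // extZ. Qed.

Lemma ext_herm v w : herm del' (b v) (b w) = mK j (herm del v w).
Proof. by rewrite /herm -(ie_F hb) (ie_form hb) rmorphM. Qed.

Lemma del'_int : wW del'. Proof. by case: hdelta => *; apply: mK_int; apply: mK_int. Qed.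
Lemma del'_inv_int : wW del'^-1.
Proof. by case: hdelta => *; rewrite -!fmorphV; apply: mK_int; apply: mK_int. Qed.
Lemma del'_neq0 : del' != 0. Proof. by case: hdelta => *; rewrite !fmorph_eq0. Qed.
Lemma del'_unit x : wW (del' * x) <-> wW x.
Proof.
split=> h; last by apply: (dvr_mul WW'); [apply: del'_int|].
by rewrite -(mulKf del'_neq0 x); apply: (dvr_mul WW'); [apply: del'_inv_int|].
Qed.

Lemma mK_wpi : mK j (wpi W) = wpi W'. Proof. exact: mK_F. Qed.

Definition extend (A : nV N -> Prop) : nV N' -> Prop :=
  span_over (wW (w := W')) (fun v => exists2 u, A u & v = b u).

Lemma mem_extend (A : nV N -> Prop) u : A u -> extend A (b u).
Proof. by move=> h; apply: (mem_span_over WW'); exists u. Qed.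

(** {v, w} = delta <v, F w> equals -delta sigma(<w, V v>), where delta is a unit and sigma preserves
    and reflects integrality. This translates hermitian duality in N_0 into the pairing of N_0 with
    N_1. *)
Lemma herm_formV (v w : nV N') : wW (herm del' v w) <-> wW (nform w (nVer v)).
Proof.
rewrite /herm del'_unit (form_nF hN') (form_anti hN') rmorphN.
split=> h; first by apply: frob_int_reflect; rewrite -[X in wW X]opprK; apply: (dvrN WW').
by apply: (dvrN WW'); apply: frob_int.
Qed.

Lemma extend_sub_dualN (A : nV N -> Prop) (B : nV N' -> Prop) :
  (forall d, A d -> dualN phi' del' B (b d)) -> incl (extend A) (dualN phi' del' B).
Proof.
move=> hA; apply: span_over_ind => [|v w [hv hv'] [hw hw']|a _ ha [u /hA[h0 h1] ->]].
- split; first exact: (N0_0 hN').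
  by move=> w _; rewrite /herm (form0l hN') mulr0; apply: dvr0 WW'.
- split=> [|u hu]; first exact: (N0D hN').
  by rewrite /herm (formDl hN') mulrDr; apply: (dvrD WW'); [apply: hv'|apply: hw'].
- split=> [|w hw]; first exact: (N0Z hN').
  by rewrite /herm (formZl hN') mulrCA; apply: (dvr_mul WW') => //; apply: h1.
Qed.

Section OneLattice.
Variables (La : nV N -> Prop) (e : 'I_n -> nV N).
Hypothesis eC : forall i, Cset phi (e i).
Hypothesis e_gen : forall v : nV N, Cset phi v ->
  exists! a : 'rV[wK W0]_n, v = \sum_i mK j0 (a 0 i) *: e i.
Hypothesis eLa : forall v, La v <-> exists2 a : 'I_n -> wK W0, (forall i, wW (a i))
  & v = \sum_i mK j0 (a i) *: e i.

Lemma ext_spans (v' : nV N') : exists a c : 'I_n -> wK W',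
  v' = \sum_i a i *: b (e i) + \sum_i c i *: nF (b (e i)).
Proof.
apply: (span_over_ind (M := fun v' => exists a c : 'I_n -> wK W',
  v' = \sum_i a i *: b (e i) + \sum_i c i *: nF (b (e i)))) (ie_span hb v').
- exists (fun=> 0), (fun=> 0); rewrite !big1 ?addr0 // => i _; exact: scale0r.
- move=> _ _ [a [c ->]] [a' [c' ->]].
  exists (fun i => a i + a' i), (fun i => c i + c' i).
  under [X in _ = X + _]eq_bigr do rewrite scalerDl.
  under [X in _ = _ + X]eq_bigr do rewrite scalerDl.
  by rewrite !big_split /= addrACA.
- move=> t _ _ [u ->]; have [a [c ->]] := eFe_spans hphi0 hN hphi eC e_gen u.
  exists (fun i => t * mK j (a i)), (fun i => t * mK j (c i)).
  rewrite extD !ext_sum scalerDr !scaler_sumr; congr (_ + _); apply: eq_bigr => i _.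
    by rewrite extZ scalerA.
  by rewrite extZ (ie_F hb) scalerA.
Qed.

Lemma be_N0 i : N0 phi' (b (e i)). Proof. by apply: ext_N0; case: (eC i). Qed.

Lemma ext_decomposition (v : nV N') : exists v0 v1,
  [/\ N0 phi' v0, N1 phi' v1 & v = v0 + v1].
Proof.
have [a [c ->]] := ext_spans v.
exists (\sum_i a i *: b (e i)), (\sum_i c i *: nF (b (e i))); split=> //.
  by apply: (N0_sum hN') => i; apply: be_N0.
by apply: (N1_sum hN') => i; apply: (N0_nF hN' hphi'); apply: be_N0.
Qed.

Lemma ext_N0_spans (v : nV N') : N0 phi' v ->
  exists a : 'I_n -> wK W', v = \sum_i a i *: b (e i).
Proof.
move=> hv; have [a [c vE]] := ext_spans v; exists a.
have [] := @N0_N1_uniq _ _ _ _ _ _ hN' hphi' v (\sum_i a i *: b (e i)) 0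
  (\sum_i c i *: nF (b (e i))); rewrite ?addr0 //.
- by apply: (N0_sum hN') => i; apply: be_N0.
- exact: (N1_0 hN').
- by apply: (N1_sum hN') => i; apply: (N0_nF hN' hphi'); apply: be_N0.
Qed.

Lemma e_La i : La (e i).
Proof.
apply/eLa; exists (fun l => (i == l)%:R).
  by move=> l; case: eqP => _; [apply: dvr_one (wW_dvr W0)|apply: dvr0 (wW_dvr W0)].
rewrite (bigD1 i) //= eqxx rmorph1 scale1r big1 ?addr0 // => l li.
by rewrite eq_sym (negbTE li) rmorph0 scale0r.
Qed.

(** The hermitian dual basis g_i lies in the dual of [La], and {g_i, v} is sigma of the i-th
    coordinate of v. Hence testing against vectors of C already suffices over W_{O_F}(k). *)
Lemma dual_dual_extend (v : nV N') : N0 phi' v ->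
  (forall d, dualC phi del La d -> wW (herm del' (b d) v)) -> extend La v.
Proof.
move=> hv hd; have [d0 _ _ fd] := hdelta.
have [g [gC ge]] := Cset_dual_basis hphi0 hN hphi fd d0 eC e_gen.
have [a vE] := ext_N0_spans hv.
exists n, a, (fun i => b (e i)); split=> // i; last by exists (e i) => //; apply: e_La.
have hgi : herm del' (b (g i)) v = frob W' (a i).
  rewrite vE /herm (nF_sum hN') (form_sumr hN') (bigD1 i) //= big1 ?addr0 => [|l li].
    rewrite (nFZ hN') (formZr hN') mulrCA -/(herm _ _ _) ext_herm ge eqxx.
    by rewrite rmorph1 mulr1.
  have : herm del' (b (g i)) (b (e l)) = 0.
    by rewrite ext_herm ge eq_sym (negbTE li) rmorph0.
  rewrite /herm => /eqP; rewrite mulf_eq0 (negbTE del'_neq0) => /eqP h.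
  by rewrite (nFZ hN') (formZr hN') h mulr0.
apply: frob_int_reflect; rewrite -hgi; apply: hd; split=> // w /eLa[c hc ->].
rewrite /herm (nF_sum hN) (form_sumr hN) mulr_sumr; apply: (dvr_sum WW) => l _.
rewrite (nFZ hN) (formZr hN) mulrCA -/(herm _ _ _) ge -mK_frob.
apply: (dvr_mul WW); first by apply: mK_int; apply: frob_int.
by case: (i == l); [apply: dvr_one WW | apply: dvr0 WW].
Qed.

(** * Lattices stable under V and O_E *)

Section StableLattice.
Variable M : nV N' -> Prop.
Hypotheses (hM : is_lattice (wW (w := W')) M) (MV : forall v, M v -> M (nVer v))
  (ME : forall x v, OE x -> M v -> M (nE x v)).

(** The predicate P is kept general because the splitting is applied both to M and to its dual
    lattice. *)
Lemma stable_proj0 (P : nV N' -> Prop) (v0 v1 : nV N') :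
  (forall a v w, wW a -> P v -> P w -> P (a *: v + w)) -> P 0 ->
  (forall x v, OE x -> P v -> P (nE x v)) ->
  N0 phi' v0 -> N1 phi' v1 -> P (v0 + v1) -> P v0 /\ P v1.
Proof.
move=> Pcomb P0 PE h0 h1 hv; have [z [hz zi z0]] := ce_unit hphi'.
have Pv0 : P v0.
  (* The operator z - phi(conj z) kills v1 and multiplies v0 by a unit. *)
  have e0 : nE z (v0 + v1) - phi' (conjE L z) *: (v0 + v1) =
      (phi' z - phi' (conjE L z)) *: v0.
    rewrite (nED hN') // h0 // h1 // scalerDr opprD.
    by rewrite addrACA subrr addr0 scalerBl.
  rewrite -(scalerK z0 v0) -e0 -[_ *: _]addr0; apply: (Pcomb) => //.
  rewrite addrC -scaleNr; apply: (Pcomb) => //; last exact: PE.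
  by apply: (dvrN WW'); apply: (ce_int hphi'); apply: OE_conj.
split=> //; have -> : v1 = (-1) *: v0 + (v0 + v1) by rewrite scaleN1r addKr.
by apply: (Pcomb) => //; apply: (dvrN WW'); apply: dvr_one WW'.
Qed.

(** When M is the lattice M_i of a point, [lat0] is A_i and [lat0_dual] is B_i. *)
Definition lat0 (v : nV N') : Prop := N0 phi' v /\ M v.
Definition lat0_dual (v : nV N') : Prop :=
  N0 phi' v /\ forall w, N1 phi' w -> M w -> wW (nform v w).

(** Recovers the N_1-part of M from B. The dual of M is stable under O_E, so the N_0-component of
    each of its vectors lies in B, while the N_1-component pairs to 0 with y. *)
Lemma lat0_dual_dual (y : nV N') : N1 phi' y ->
  (forall v, lat0_dual v -> wW (nform v y)) -> M y.
Proof.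
move=> hy h; apply: (lattice_bidual hN' hM) => v hv.
have [v0 [v1 [h0 h1 vE]]] := ext_decomposition v.
have [P0 _] : (forall w, M w -> wW (nform v0 w)) /\ (forall w, M w -> wW (nform v1 w)).
  apply: (@stable_proj0 (fun v => forall w, M w -> wW (nform v w))) h0 h1 _.
  - move=> a u u' ha hu hu' w hw; rewrite (ui_forml hN').
    by apply: (dvrD WW'); [apply: (dvr_mul WW'); [|apply: hu]|apply: hu'].
  - by move=> w hw; rewrite (form0l hN'); apply: dvr0 WW'.
  - move=> x u hx hu w hw; rewrite -(ce_conj2 hphi x) -(ui_formE hN'); last exact: OE_conj.
    by apply: hu; apply: ME => //; apply: OE_conj.
  - by rewrite -vE.
rewrite vE (formDl hN') (form_N1 hN' hphi' h1 hy) addr0; apply: h; split=> // w _.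
exact: P0.
Qed.

Lemma lat_minus_criterion :
  (forall t, lat_minus phi del La t -> M (b t)) <->
  incl (scale_set (wpi W') (extend (dualC phi del La)))
       (scale_set (wpi W') (dualN phi' del' lat0_dual))
  /\ incl lat0_dual (extend La).
Proof.
rewrite incl_scale ?wpi_neq0 //; split=> [h|[h _]].
  (* Apply the hypothesis to V d, the element of [lat_minus] with zero first summand. *)
  have hd d : dualC phi del La d -> dualN phi' del' lat0_dual (b d).
    move=> hd; have dN0 : N0 phi' (b d) by apply: ext_N0; case: hd => [[]].
    split=> // w hw; apply/herm_formV; case: hw => _; apply.
      exact: (N0_nV hN' hphi').
    rewrite -(ie_V hb); apply: h; exists 0, d; split; last by rewrite scaler0 add0r.
      exact: span_over0.
    exact: (mem_span_over WW).
  (* By [hd], elements of [lat0_dual] pair integrally with the dual of [La], so they lie in its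
     double dual. *)
  split; last by move=> v hv; apply: dual_dual_extend => [|d /hd[_]]; [case: hv|apply].
  exact: extend_sub_dualN.
have hV d : dualC phi del La d -> M (nVer (b d)).
  move=> hd; have [dN0 hd'] := h _ (mem_extend hd).
  apply: lat0_dual_dual; first exact: (N0_nV hN' hphi').
  by move=> v hv; apply/herm_formV; apply: hd'.
have hpi d : dualC phi del La d -> M (wpi W' *: b d).
  move=> hd; have [dC _] := hd.
  by rewrite -mK_wpi -extZ -(Cset_nVV hN dC) !(ie_V hb); apply/MV/hV.
move=> _ [a [c [ha hc ->]]]; rewrite extD extZ mK_wpi (ie_V hb).
apply: (latticeD WW' hM).
  apply: (span_over_ind (M := fun a => M (wpi W' *: b a))) ha.
  - by rewrite ext0 scaler0; apply: lattice0 WW' _ hM.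
  - by move=> v w hv hw; rewrite extD scalerDr; apply: (latticeD WW' hM).
  - move=> t v ht hv; rewrite extZ scalerA mulrC -scalerA.
    by apply: (latticeZ WW' hM); [apply: mK_int|apply: hpi].
apply: (span_over_ind (M := fun a => M (nVer (b a)))) hc.
- by rewrite ext0 (nV0 hN'); apply: lattice0 WW' _ hM.
- by move=> v w hv hw; rewrite extD (nVD hN'); apply: (latticeD WW' hM).
(* V is sigma^-1-linear, so t comes out as its preimage under sigma, which is again integral. *)
- move=> t v ht hv; have [g _ gf] := frob_bij W'.
  rewrite extZ -(gf (mK j t)) (nVZ hN'); apply: (latticeZ WW' hM); last exact: hV.
  by apply: frob_int_reflect; rewrite gf; apply: mK_int.
Qed.

Lemma N1_of_nV (v : nV N) : N0 phi (nVer v) -> N1 phi v.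
Proof.
move=> hv; rewrite -(scalerK (wpi_neq0 W) v) -(ui_FV hN).
by apply: (N1Z hN); apply: (N0_nF hN hphi).
Qed.

Lemma wpiV_nFV (v : nV N') : (wpi W')^-1 *: nF (nVer v) = v.
Proof. by rewrite (ui_FV hN') scalerK ?wpi_neq0. Qed.

Lemma nV_wpiV_nF (v : nV N) : nVer ((wpi W)^-1 *: nF v) = v.
Proof.
by rewrite -(frob_wpi W) -fmorphV (nVZ hN) (ui_VF hN) scalerK ?wpi_neq0.
Qed.

Lemma extend_mono (A B : nV N -> Prop) : incl A B -> incl (extend A) (extend B).
Proof.
move=> hAB _ [k [a [s [ha hs ->]]]]; exists k, a, s; split=> // i.
by have [u hu ->] := hs i; exists u => //; apply: hAB.
Qed.

Lemma lat_plus_criterion :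
  incl M (extend (lat_plus La)) <->
  incl (scale_set (wpi W' ^+ 2) (extend (dualC phi del La)))
       (scale_set (wpi W' ^+ 2) (dualN phi' del' lat0))
  /\ incl lat0 (extend La).
Proof.
rewrite incl_scale ?expf_neq0 ?wpi_neq0 //.
have Vf : nVer (0 : nV N) = 0 := nV0 hN.
have LaN0 v : span_over (wW (w := W)) La v -> N0 phi v.
  apply: span_over_ind => [|u w|a u _ /eLa[c _ ->]]; first exact: (N0_0 hN).
    exact: (N0D hN).
  by apply: (N0Z hN); apply: (N0_sum hN) => i; case: (eC i).
have ext_ext v : span_over (wW (w := W)) La v -> extend La (b v).
  apply: (span_over_ind (M := fun v => extend La (b v))).
  - by rewrite ext0; apply: span_over0.
  - by move=> u w; rewrite extD; apply: span_overD.
  - by move=> a u ha hu; rewrite extZ; apply: (span_overZ WW'); [apply: mK_int|apply: mem_extend].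
split=> [h|[_ h]].
  have h2 : incl lat0 (extend La).
    move=> v [v0 /h hv].
    (* The summand V^-1(Lambda) of [lat_plus] lies in N_1, so it cannot contribute to a vector v of
       N_0. *)
    have [a [a' [ha ha' vE]]] : exists a a', [/\ extend La a, N1 phi' a' & v = a + a'].
      apply: (span_over_ind (M := fun v => exists a a', [/\ extend La a, N1 phi' a' & v = a + a'])) hv.
      - by exists 0, 0; split; rewrite ?addr0 //; [apply: span_over0 | apply: (N1_0 hN')].
      - move=> _ _ [a [a' [ha ha' ->]]] [c [c' [hc hc' ->]]].
        exists (a + c), (a' + c'); rewrite addrACA; split=> //.
          exact: span_overD.
        exact: (N1D hN').
      - move=> t _ ht [_ [a [c [ha hc ->]]] ->].
        exists (t *: b a), (t *: b c); rewrite extD scalerDr; split=> //.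
          by apply: (span_overZ WW') => //; apply: ext_ext.
        apply: (N1Z hN'); apply: ext_N1; apply: N1_of_nV.
        exact: LaN0.
    have aN0 : N0 phi' a.
      apply: (span_over_ind (M := N0 phi')) ha; first exact: (N0_0 hN').
        exact: (N0D hN').
      move=> t _ _ [u hu ->]; apply: (N0Z hN'); apply: ext_N0; apply: LaN0.
      exact: (mem_span_over WW).
    have [] := @N0_N1_uniq _ _ _ _ _ _ hN' hphi' v a 0 a' v0 aN0 (N1_0 hN') ha'.
      by rewrite addr0.
    by move=> ->.
  (* The dual inclusion follows by reversing A in Lambda_k: d pairs integrally with Lambda, hence
     with its scalar extension. *)
  split=> //; apply: extend_sub_dualN => d hd.
  split=> [|w /h2]; first by apply: ext_N0; case: hd => [[]].
  apply: (span_over_ind (M := fun w => wW (herm del' (b d) w))).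
  - by rewrite /herm (nF0 hN') (form0r hN') mulr0; apply: dvr0 WW'.
  - by move=> u w' hu hw'; rewrite /herm (nFD hN') (formDr hN') mulrDr; apply: (dvrD WW').
  - move=> t _ ht [u hu ->]; rewrite /herm (nFZ hN') (formZr hN') mulrCA.
    apply: (dvr_mul WW'); first exact: frob_int.
    by rewrite -/(herm _ _ _) ext_herm; apply: mK_int; case: hd => _; apply.
(* V^-1 is written pi^-1 F. It is sigma-linear, so only generators have to be checked. *)
have hV y : extend La y -> extend (lat_plus La) ((wpi W')^-1 *: nF y).
  apply: (span_over_ind (M := fun y => extend (lat_plus La) ((wpi W')^-1 *: nF y))).
  - by rewrite (nF0 hN') scaler0; apply: span_over0.
  - by move=> u w; rewrite (nFD hN') scalerDr; apply: span_overD.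
  - move=> t _ ht [u hu ->]; rewrite (nFZ hN') scalerA mulrC -scalerA.
    apply: (span_overZ WW'); first exact: frob_int.
    rewrite -(ie_F hb) -mK_wpi -fmorphV -extZ; apply: mem_extend.
    exists 0, ((wpi W)^-1 *: nF u); split; last by rewrite add0r.
      exact: span_over0.
    by rewrite nV_wpiV_nF; apply: (mem_span_over WW).
move=> v Mv; have [v0 [v1 [h0 h1 vE]]] := ext_decomposition v.
have [M0 M1] : M v0 /\ M v1.
  apply: (stable_proj0 _ _ ME h0 h1); last by rewrite -vE.
    by move=> *; apply: (lattice_sub_closed WW' hM).
  exact: (lattice0 WW' hM).
rewrite vE; apply: span_overD.
  apply: (@extend_mono La); last by apply: h.
  move=> u hu; exists u, 0; split; rewrite ?addr0 //; first exact: (mem_span_over WW).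
  by rewrite Vf; apply: span_over0.
(* The N_1-component is V^-1 of V v1, and V v1 lies in [lat0] by stability of M under V. *)
rewrite -(wpiV_nFV v1); apply: hV; apply: h; split; last exact: MV.
exact: (N1_nV hN' hphi').
Qed.

End StableLattice.
End OneLattice.
End ExtendedLattices.

(** * Isocrystals of hermitian formal modules *)

Lemma lattice_no_line (K R : fieldType) (V : vectType K) (O : K -> Prop) (u : K) (res : K -> R)
    (M : V -> Prop) (w : V) :
  is_dvr O u res -> is_lattice O M -> (forall c, M (c *: w)) -> w = 0.
Proof.
move=> hO [e [be he]] hw; rewrite (coord_basis be (memvf w)) big1 // => i _.
have -> : coord e i w = 0; last exact: scale0r.
apply: (dvr_separated hO) => l; have /he/(_ i) := hw (u ^+ l)^-1.
by rewrite linearZ /= mulrC.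
Qed.

Section Semilinear.
Variables (K K' : fieldType) (V : vectType K) (V' : vectType K') (c : K -> K') (g : V -> V').
Hypotheses (gP : forall a v w, g (a *: v + w) = c a *: g v + g w) (c1 : c 1 = 1).

Lemma semilinearD v w : g (v + w) = g v + g w.
Proof. by rewrite -[v]scale1r gP c1 !scale1r. Qed.

Lemma semilinear0 : g 0 = 0.
Proof. by apply: (addrI (g 0)); rewrite -semilinearD !addr0. Qed.

Lemma semilinearZ a v : g (a *: v) = c a *: g v.
Proof. by rewrite -[_ *: v]addr0 gP semilinear0 addr0. Qed.

Lemma semilinear_sum k (s : 'I_k -> V) : g (\sum_i s i) = \sum_i g (s i).
Proof. exact: (big_morph _ semilinearD semilinear0). Qed.

End Semilinear.

Section HmodIsocrystal.
Variables (L : local_fields) (R : fieldType) (W : witt L R) (D : dieudonne W).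
Variables (n : nat) (s : fldE L -> R) (H : hmod D).
Hypothesis hH : is_hmod n s H.

Definition hmod_isocrystal : isocrystal W :=
  Isocrystal (@dF _ _ _ D (hX H)) (@dV _ _ _ D (hX H))
    (fun x => dmap (X := hX H) (Y := hX H) (hact H x)) (hform H).

Lemma hmod_unitary_isocrystal : unitary_isocrystal hmod_isocrystal n.
Proof.
have hD := d_mod D (hm_sfm hH); have [dualH hlamh hlami halt hE] := hm_pol hH.
have sD := dual_sfm dualH.
have actH x (hx : OE x) := d_hom D (hm_sfm hH) (hm_sfm hH) (hm_hom hH hx).
set l := @dmap _ _ _ D (hX H) (hdual H) (hlam H).
have hl := d_hom D (hm_sfm hH) sD hlamh.
split=> /=.
- exact: dm_F_semilin hD.
- exact: dm_V_semilin hD.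
- exact: dm_FV hD.
- exact: dm_VF hD.
- by move=> x a v w hx; apply: (dh_lin (actH x hx)).
- by move=> x v hx; apply: (dh_F (actH x hx)).
- by move=> x v hx; apply: (dh_V (actH x hx)).
- by move=> a v v' w; apply: (ev_linl dualH).
- by move=> a v w w'; rewrite /hform (dh_lin hl) (ev_linr dualH).
- exact: halt.
- by move=> v w; rewrite /hform (ev_F dualH) -(dh_V hl).
- by move=> x v w hx; apply: hE.
(* If v pairs to 0 with everything, perfectness puts the whole line through lambda(v) in the
   Dieudonné lattice of the dual. A lattice contains no line, and lambda is injective on rational
   modules. *)
- move=> v hv; have [g lg _] := (d_isogeny D (hm_sfm hH) sD hlamh).1 hlami.
  have lv0 : l v = 0.
    apply: (lattice_no_line (wW_dvr W) (dm_lattice (d_mod D sD))) => c.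
    apply/(ev_perfl dualH) => w _.
    have := ev_linr dualH c w (l v) 0.
    have := ev_linr dualH (-1) w 0 0.
    rewrite scaleN1r oppr0 addr0 mulN1r addNr => ->.
    rewrite !addr0 => ->; rewrite -[hev w _]/(hform H w v) hv mulr0.
    exact: dvr0 (wW_dvr W).
  have l0 : l 0 = 0.
    exact: (semilinear0 (c := id) (dh_lin hl)).
  by apply: (can_inj lg); rewrite -/l lv0 l0.
- by rewrite addnn -mul2n; apply/(d_height D _ (hm_sfm hH)); apply: (hm_height hH).
Qed.

End HmodIsocrystal.

(** * Scalar extension of isocrystals with pairing *)

Section BaseChangeOfIsocrystals.
Variables (L : local_fields) (R R' : fieldType) (W : witt L R) (W' : witt L R')
  (D : dieudonne W) (D' : dieudonne W') (j : witt_morph W W') (b : base_change D D' j).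
Variables (X : fmod L R) (act : fldE L -> fpsmap R (fdim X) (fdim X))
  (form : diso D X -> diso D X -> wK W) (n : nat).
Hypotheses (hX : is_sfm W X) (hact : forall x, OE x -> is_hom (X := X) (Y := X) (act x)).

Local Notation X' := (map_fmod (mR j) X).

(** The form is a parameter so that base change can be iterated: the form over kappa is already an
    extended one when passing to k. *)
Definition isocrystal_of : isocrystal W :=
  Isocrystal (@dF _ _ _ D X) (@dV _ _ _ D X) (fun x => dmap (X := X) (Y := X) (act x)) form.
Definition base_change_isocrystal : isocrystal W' :=
  Isocrystal (@dF _ _ _ D' X') (@dV _ _ _ D' X')
    (fun x => dmap (X := X') (Y := X') (map_fpsmap (mR j) (act x))) (ext_form b form).

Local Notation N := isocrystal_of.
Local Notation N' := base_change_isocrystal.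
Hypothesis hN : unitary_isocrystal N n.
Local Notation bX := (bc b (X := X)).

Lemma bcD (v w : diso D X) : bX (v + w) = bX v + bX w.
Proof. by rewrite -[v]scale1r (bc_semilin b) // rmorph1 !scale1r. Qed.
Lemma bc0 : bX 0 = 0.
Proof. by apply: (addrI (bX 0)); rewrite -bcD !addr0. Qed.
Lemma bcZ a (v : diso D X) : bX (a *: v) = mK j a *: bX v.
Proof. by rewrite -[_ *: v]addr0 (bc_semilin b) // bc0 addr0. Qed.
Lemma bc_sum k (s : 'I_k -> diso D X) : bX (\sum_i s i) = \sum_i bX (s i).
Proof. exact: (big_morph _ bcD bc0). Qed.

Let e := vbasis {:diso D X}.
Let e' := map_tuple bX e.

Lemma bc_vbasis : basis_of {:diso D' X'} e'.
Proof. by apply: bc_basis => //; apply: vbasisP. Qed.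

Lemma coord_bc i (v : diso D X) : coord e' i (bX v) = mK j (coord e i v).
Proof.
rewrite {1}(coord_basis (vbasisP {:diso D X}) (memvf v)) bc_sum.
under eq_bigr => l _ do rewrite bcZ.
have -> : \sum_l mK j (coord e l v) *: bX e`_l = \sum_l mK j (coord e l v) *: e'`_l.
  by apply: eq_bigr => l _; rewrite /e' (nth_map 0) // size_tuple.
by apply: coord_sum_free; apply: basis_free bc_vbasis.
Qed.

Lemma bc_span (v' : diso D' X') : span_over (fun=> True) (fun w => exists u, w = bX u) v'.
Proof.
exists (\dim {:diso D X}), (fun i => coord e' i v'), (fun i => e'`_i); split=> //.
  by move=> i; exists e`_i; rewrite /e' (nth_map 0) // size_tuple.
exact: coord_basis bc_vbasis (memvf v').
Qed.

Local Notation f' := (ext_form b form).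

Lemma ext_form_linl a (v v' w : diso D' X') : f' (a *: v + v') w = a * f' v w + f' v' w.
Proof.
rewrite /ext_form mulr_sumr -big_split; apply: eq_bigr => i _ /=.
rewrite mulr_sumr -big_split; apply: eq_bigr => l _ /=.
by rewrite linearP /= !mulrDl !mulrA.
Qed.

Lemma ext_form_linr a (v w w' : diso D' X') : f' v (a *: w + w') = a * f' v w + f' v w'.
Proof.
rewrite /ext_form mulr_sumr -big_split; apply: eq_bigr => i _ /=.
rewrite mulr_sumr -big_split; apply: eq_bigr => l _ /=.
by rewrite linearP /= mulrDr !mulrDl !mulrA (mulrC a).
Qed.

Let f_suml k (s : 'I_k -> diso D X) w : form (\sum_i s i) w = \sum_i form (s i) w.
Proof. exact: (form_suml hN). Qed.
Let f_sumr k (s : 'I_k -> diso D X) w : form w (\sum_i s i) = \sum_i form w (s i).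
Proof. exact: (form_sumr hN). Qed.
Let fZl a v w : form (a *: v) w = a * form v w.
Proof. exact: (formZl hN). Qed.
Let fZr a v w : form v (a *: w) = a * form v w.
Proof. exact: (formZr hN). Qed.

Lemma ext_form_bc (v w : diso D X) : f' (bX v) (bX w) = mK j (form v w).
Proof.
rewrite {2}(coord_basis (vbasisP {:diso D X}) (memvf v)).
rewrite {2}(coord_basis (vbasisP {:diso D X}) (memvf w)).
rewrite f_suml rmorph_sum; apply: eq_bigr => i _ /=.
rewrite f_sumr rmorph_sum; apply: eq_bigr => l _ /=.
by rewrite fZl fZr !rmorphM /= !coord_bc mulrA.
Qed.

Let f'0l w : f' 0 w = 0.
Proof. by have := ext_form_linl (-1) 0 0 w; rewrite scaleN1r oppr0 addr0 mulN1r addNr. Qed.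
Let f'0r w : f' w 0 = 0.
Proof. by have := ext_form_linr (-1) w 0 0; rewrite scaleN1r oppr0 addr0 mulN1r addNr. Qed.
Let f'Dl v v' w : f' (v + v') w = f' v w + f' v' w.
Proof. by rewrite -[v]scale1r ext_form_linl mul1r scale1r. Qed.
Let f'Dr w v v' : f' w (v + v') = f' w v + f' w v'.
Proof. by rewrite -[v]scale1r ext_form_linr mul1r scale1r. Qed.
Let f'Zl a v w : f' (a *: v) w = a * f' v w.
Proof. by rewrite -[_ *: v]addr0 ext_form_linl f'0l addr0. Qed.
Let f'Zr a v w : f' v (a *: w) = a * f' v w.
Proof. by rewrite -[_ *: w]addr0 ext_form_linr f'0r addr0. Qed.

(** Reduces statements compatible with sums to multiples of vectors coming from the smaller
    field. *)
Lemma bc_ind (P : diso D' X' -> Prop) : P 0 -> (forall v w, P v -> P w -> P (v + w)) ->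
  (forall a u, P (a *: bX u)) -> forall v, P v.
Proof.
move=> P0 PD PZ v; apply: (span_over_ind P0 PD _ (bc_span v)).
by move=> a _ _ [u ->].
Qed.

Lemma ext_form_anti v w : f' v w + f' w v = 0.
Proof.
elim/bc_ind: v => [|v v' h h'|a v]; first by rewrite f'0l f'0r addr0.
  by rewrite f'Dl f'Dr addrACA h h' addr0.
elim/bc_ind: w => [|w w' h h'|c w]; first by rewrite f'0l f'0r addr0.
  by rewrite f'Dl f'Dr addrACA h h' addr0.
rewrite !f'Zl !f'Zr !ext_form_bc !mulrA (mulrC c a) -mulrDr -rmorphD /=.
by rewrite -[form w v]/(nform (i := N) w v) (form_anti hN) subrr rmorph0 mulr0.
Qed.

Lemma base_change_unitary_isocrystal :
  unitary_isocrystal N' n /\ isocrystal_extension (N := N) (N' := N') j bX.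
Proof.
have hD := d_mod D' (bc_sfm b hX).
have hact' x (hx : OE x) :=
  d_hom D' (bc_sfm b hX) (bc_sfm b hX) (is_hom_map (mR j) (hact hx)).
have F0 := semilinear0 (dm_F_semilin hD) (rmorph1 _).
have FD := semilinearD (dm_F_semilin hD) (rmorph1 _).
have [V0 VD] : dV (0 : diso D' X') = 0 /\ (forall v w : diso D' X', dV (v + w) = dV v + dV w).
  have VD (v w : diso D' X') : dV (v + w) = dV v + dV w.
    by have := dm_V_semilin hD 1 v w; rewrite rmorph1 !scale1r.
  by split=> //; apply: (addrI (dV 0)); rewrite -VD !addr0.
have FZ a v : dF (a *: v : diso D' X') = frob W' a *: dF v.
  by rewrite -[_ *: v]addr0 (dm_F_semilin hD) F0 addr0.
have VZ a v : dV (frob W' a *: v : diso D' X') = a *: dV v.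
  by rewrite -[_ *: v]addr0 (dm_V_semilin hD) V0 addr0.
have [g _ fg] := frob_bij W'.
split; split=> /=.
- exact: dm_F_semilin hD.
- exact: dm_V_semilin hD.
- exact: dm_FV hD.
- exact: dm_VF hD.
- by move=> x a v w hx; apply: (dh_lin (hact' x hx)).
- by move=> x v hx; apply: (dh_F (hact' x hx)).
- by move=> x v hx; apply: (dh_V (hact' x hx)).
- exact: ext_form_linl.
- exact: ext_form_linr.
(* Alternation is not additive in v; the cross terms of a sum cancel by antisymmetry. *)
- elim/bc_ind => [|v w hv hw|a v]; first exact: f'0l.
    by rewrite f'Dl !f'Dr hv hw add0r addr0 ext_form_anti.
  by rewrite f'Zl f'Zr ext_form_bc -[form v v]/(nform (i := N) v v) (ui_alt hN) rmorph0 !mulr0.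
- elim/bc_ind => [w|v v' h h' w|a v].
  + by rewrite F0 !f'0l rmorph0.
  + by rewrite FD !f'Dl h h' rmorphD.
  elim/bc_ind => [|w w' h h'|c w].
  + by rewrite V0 !f'0r rmorph0.
  + by rewrite VD !f'Dr h h' rmorphD.
  (* The coefficient c is written as a value of sigma, since V is sigma^-1-linear. *)
  rewrite -(fg c) VZ FZ !f'Zl !f'Zr !rmorphM /= fg -bc_F // -bc_V // !ext_form_bc -mK_frob.
  by congr (_ * (_ * mK j _)); apply: (ui_formF hN).
- move=> x v w hx; have hcx := OE_conj hx.
  have E0 := semilinear0 (c := id) (dh_lin (hact' x hx)) erefl.
  have ED := semilinearD (c := id) (dh_lin (hact' x hx)) erefl.
  have E0' := semilinear0 (c := id) (dh_lin (hact' _ hcx)) erefl.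
  have ED' := semilinearD (c := id) (dh_lin (hact' _ hcx)) erefl.
  have EZ a v := dh_lin (hact' x hx) a v 0.
  have EZ' a v := dh_lin (hact' _ hcx) a v 0.
  elim/bc_ind: v => [|v v' h h'|a v]; first by rewrite E0' !f'0l.
    by rewrite ED' !f'Dl h h'.
  elim/bc_ind: w => [|w w' h h'|c w]; first by rewrite E0 !f'0r.
    by rewrite ED !f'Dr h h'.
  rewrite -[a *: _]addr0 -[c *: _]addr0 EZ EZ' E0 E0' !addr0 !f'Zl !f'Zr.
  rewrite -!bc_map //; try exact: hact.
  by rewrite !ext_form_bc; congr (_ * (_ * mK j _)); apply: (ui_formE hN).
(* The image of a family dual to the basis downstairs reads off the coordinates of v. *)
- move=> v hv.
  have ie : indep (fun i : 'I_(\dim {:diso D X}) => e`_i).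
    by have := vbasisP {:diso D X}; rewrite basisEfree => /andP[/freeP fe _]; apply: fe.
  have [d hd] := @dual_family _ _ _ N _ hN _ _ (erefl _) ie.
  have fd (i l : 'I_(\dim {:diso D X})) : form (d i) e`_l = (i == l)%:R := hd i l.
  rewrite (coord_basis bc_vbasis (memvf v)) big1 // => i _.
  suff -> : coord e' i v = 0 by rewrite scale0r.
  rewrite -[RHS](hv (bX (d i))) {2}(coord_basis bc_vbasis (memvf v)).
  have f'_sum k (t : 'I_k -> diso D' X') w : f' w (\sum_l t l) = \sum_l f' w (t l).
    exact: (big_morph _ (f'Dr w) (f'0r w)).
  have e'E (l : 'I_(\dim {:diso D X})) : e'`_l = bX e`_l.
    by rewrite /e' (nth_map 0) // size_tuple.
  rewrite f'_sum (bigD1 i) //= f'Zr e'E ext_form_bc fd eqxx rmorph1 mulr1.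
  rewrite big1 ?addr0 // => l li.
  by rewrite f'Zr e'E ext_form_bc fd eq_sym (negbTE li) rmorph0 mulr0.
- exact: (etrans (vector.size_basis bc_vbasis) (ui_dim hN)).
- by move=> a v w; apply: bc_semilin.
- by move=> v; apply: bc_F.
- by move=> v; apply: bc_V.
- by move=> x v hx; apply: bc_map => //; apply: hact.
- exact: ext_form_bc.
- exact: bc_span.
Qed.

End BaseChangeOfIsocrystals.

(** * Quasi-isogenies and Dieudonne lattices *)

Section LinearBijections.
Variables (K : fieldType) (V V' : vectType K) (O : K -> Prop) (psi : V -> V').
Hypothesis psi_lin : forall a v w, psi (a *: v + w) = a *: psi v + psi w.

Let psi0 : psi 0 = 0 := semilinear0 (c := id) psi_lin erefl.
Let psiZ a v : psi (a *: v) = a *: psi v := semilinearZ (c := id) psi_lin erefl a v.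
Let psi_sum k (s : 'I_k -> V) : psi (\sum_i s i) = \sum_i psi (s i) :=
  semilinear_sum (c := id) psi_lin erefl s.

Lemma map_tuple_nth n (e : n.-tuple V) (i : 'I_n) : (map_tuple psi e)`_i = psi e`_i.
Proof. by rewrite (nth_map 0) // size_tuple. Qed.

Lemma basis_image n (e : n.-tuple V) : bijective psi ->
  basis_of {:V} e -> basis_of {:V'} (map_tuple psi e).
Proof.
move=> [g gK Kg] be; rewrite /basis_of; apply/andP; split.
  rewrite eqEsubv subvf /=; apply/subvP => v _.
  rewrite -(Kg v) (coord_basis be (memvf (g v))) psi_sum.
  apply: memv_suml => i _; rewrite psiZ -map_tuple_nth; apply: memvZ.
  by apply: memv_span; apply: mem_nth; rewrite size_tuple.
apply/freeP => k hk.
have /freeP fe : free e by apply: basis_free be.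
apply: fe; apply: (can_inj gK); rewrite psi0 psi_sum -[RHS]hk.
by apply: eq_bigr => i _; rewrite psiZ map_tuple_nth.
Qed.

Lemma coord_image n (e : n.-tuple V) i v :
  basis_of {:V} e -> basis_of {:V'} (map_tuple psi e) ->
  coord (map_tuple psi e) i (psi v) = coord e i v.
Proof.
move=> be be'; rewrite {1}(coord_basis be (memvf v)) psi_sum.
under eq_bigr do rewrite psiZ -map_tuple_nth.
by apply: coord_sum_free; apply: basis_free be'.
Qed.

Lemma bijective_of_basis n (e : n.-tuple V) :
  basis_of {:V} e -> basis_of {:V'} (map_tuple psi e) -> bijective psi.
Proof.
move=> be be'; exists (fun w => \sum_i coord (map_tuple psi e) i w *: e`_i).
  by move=> v; rewrite {2}(coord_basis be (memvf v)); under eq_bigr do rewrite coord_image //.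
move=> w; rewrite psi_sum [RHS](coord_basis be' (memvf w)).
by apply: eq_bigr => i _; rewrite psiZ map_tuple_nth.
Qed.

(** [is_lattice] prescribes the dimension as the length of the tuple; substituting the equality of
    lengths avoids a cast. *)
Lemma is_lattice_of_basis n (e : n.-tuple V') (M : V' -> Prop) : basis_of {:V'} e ->
  (forall v, M v <-> forall i, O (coord e i v)) -> is_lattice O M.
Proof.
move=> be hM; have E := vector.size_basis be; subst n.
by exists e.
Qed.

Lemma is_lattice_image (M : V -> Prop) : bijective psi -> is_lattice O M ->
  is_lattice O (fun v => exists2 u, M u & v = psi u).
Proof.
move=> bij [e [be he]]; have be' := basis_image bij be.
apply: (is_lattice_of_basis be') => v; split=> [[u /he hu ->] i|hv].
  by rewrite coord_image.
case: bij => g gK Kg; exists (g v); rewrite ?Kg //; apply/he => i.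
by rewrite -(coord_image _ _ be be') Kg.
Qed.

End LinearBijections.

Section QuasiIsogenies.
Variables (L : local_fields) (R : fieldType) (W : witt L R) (D : dieudonne W).
Local Notation dm X Y f := (@dmap _ _ _ D X Y f).
Local Notation dQ X Y r := (@dq _ _ _ D X Y r).
Local Notation hom X Y f := (is_hom (X := X) (Y := Y) f).

Lemma OF_unifX N : OF (unif L ^+ N).
Proof. by apply: (dvrX (F_dvr L)); case: (dvr_unif (F_dvr L)). Qed.

Section TwoModules.
Variables (X Y : fmod L R).
Hypotheses (hX : is_sfm W X) (hY : is_sfm W Y).

Lemma dmap_linear f a v w : hom X Y f ->
  dm X Y f (a *: v + w) = a *: dm X Y f v + dm X Y f w.
Proof. by move=> hf; apply: (dh_lin (d_hom D hX hY hf)). Qed.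

Lemma dmapZ f a v : hom X Y f -> dm X Y f (a *: v) = a *: dm X Y f v.
Proof.
by move=> hf; apply: (semilinearZ (c := id)) => // *; apply: dmap_linear.
Qed.

Variable r : qmap R (fdim X) (fdim Y).

Lemma dq_linear a v w : hom X Y (qf r) -> dQ X Y r (a *: v + w) = a *: dQ X Y r v + dQ X Y r w.
Proof.
by move=> hf; rewrite /dq dmap_linear // scalerDr !scalerA mulrC.
Qed.

Let frob_wpiVX N : frob W ((wpi W)^-1 ^+ N) = (wpi W)^-1 ^+ N.
Proof. by rewrite rmorphXn fmorphV /= frob_wpi. Qed.

Lemma dq_F v : hom X Y (qf r) -> dQ X Y r (dF v) = dF (dQ X Y r v).
Proof.
move=> hf; rewrite /dq (dh_F (d_hom D hX hY hf)).
rewrite (semilinearZ (c := frob W) (dm_F_semilin (d_mod D hY)) (rmorph1 _)).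
by rewrite frob_wpiVX.
Qed.

Lemma dq_V v : hom X Y (qf r) -> dQ X Y r (dV v) = dV (dQ X Y r v).
Proof.
move=> hf; rewrite /dq (dh_V (d_hom D hX hY hf)).
have VD (u w : diso D Y) : dV (u + w) = dV u + dV w.
  by have := dm_V_semilin (d_mod D hY) 1 u w; rewrite rmorph1 !scale1r.
have V0 : dV (0 : diso D Y) = 0 by apply: (addrI (dV 0)); rewrite -VD !addr0.
set c := _ ^+ _; have := dm_V_semilin (d_mod D hY) c (dm X Y (qf r) v) 0.
by rewrite frob_wpiVX !addr0 V0 addr0 => ->.
Qed.

Lemma dmap_bij f : hom X Y f -> isogeny f -> bijective (dm X Y f).
Proof. by move=> hf; apply: (d_isogeny D hX hY hf).1. Qed.

Lemma dq_bij : is_qisog (X := X) (Y := Y) r -> bijective (dQ X Y r).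
Proof.
case=> hf /(dmap_bij hf)[g gK Kg].
have c0 : (wpi W)^-1 ^+ qN r != 0 by rewrite expf_neq0 // invr_eq0 wpi_neq0.
exists (fun w => g (((wpi W)^-1 ^+ qN r)^-1 *: w)) => v; rewrite /dq.
  by rewrite scalerK.
by rewrite Kg scalerKV.
Qed.

Variable s : qmap R (fdim X) (fdim Y).

(** [qeq] clears the denominators pi^N. On rational Dieudonné modules pi is invertible, and
    faithfulness brings equality of the maps back to power series. *)
Lemma qeqP : hom X Y (qf r) -> hom X Y (qf s) ->
  qeq (X := X) (Y := Y) r s <-> forall v, dQ X Y r v = dQ X Y s v.
Proof.
move=> hr hs; rewrite /qeq.
have hX' N := sfm_hom hX (OF_unifX N).
have E t N v : hom X Y t ->
    dm X Y (fcomp t (oact X (unif L ^+ N))) v = wpi W ^+ N *: dm X Y t v.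
  move=> ht; rewrite (d_comp hX hX hY (hX' N) ht) /= (d_act hX (OF_unifX N)).
  by rewrite dmapZ // rmorphXn.
have p0 := wpi_neq0 W.
have E2 v : wpi W ^+ (qN r + qN s) *: dQ X Y r v = wpi W ^+ qN s *: dm X Y (qf r) v.
  by rewrite /dq scalerA exprD mulrAC -exprMn mulfV // expr1n mul1r.
have E3 v : wpi W ^+ (qN r + qN s) *: dQ X Y s v = wpi W ^+ qN r *: dm X Y (qf s) v.
  by rewrite /dq scalerA exprD -mulrA -exprMn mulfV // expr1n mulr1.
have pN0 : wpi W ^+ (qN r + qN s) != 0 by rewrite expf_neq0.
split=> [h v|h].
  by apply: (scalerI pN0); rewrite E2 E3 -(E _ _ _ hr) -(E _ _ _ hs) h.
apply: (@d_faithful _ _ _ D _ _ _ _ hX hY); try exact: (is_hom_fcomp hX hX hY).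
by move=> v; rewrite (E _ _ _ hr) (E _ _ _ hs) -E2 -E3 h.
Qed.

End TwoModules.

(* [s^-1 o r] is an isogeny iff it maps one Dieudonne lattice into the other. *)
Lemma exists_isogeny_iff (X Y Z : fmod L R) (r : qmap R (fdim X) (fdim Z))
    (s : qmap R (fdim Y) (fdim Z)) :
  is_sfm W X -> is_sfm W Y -> is_sfm W Z ->
  is_qisog (X := X) (Y := Z) r -> is_qisog (X := Y) (Y := Z) s ->
  (exists g : fpsmap R (fdim X) (fdim Y), [/\ hom X Y g, isogeny g
     & qeq (X := X) (Y := Z) (qpre s g) r]) <->
  (forall u : diso D X, dlat u -> exists2 w : diso D Y, dlat w & dQ X Z r u = dQ Y Z s w).
Proof.
move=> hX hY hZ hr hs.
have dq_pre g : hom X Y g -> forall v, dQ X Z (qpre s g) v = dQ Y Z s (dm X Y g v).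
  by move=> hg v; rewrite /dq /= (d_comp hX hY hZ hg (proj1 hs)).
split=> [[g [hg ig hq]] u hu|h].
  exists (dm X Y g u); first exact: (dh_lattice (d_hom D hX hY hg)).
  have hf := is_hom_fcomp hX hY hZ hg (proj1 hs).
  by rewrite -(dq_pre _ hg) ((qeqP (r := qpre s g) hX hZ hf (proj1 hr)).1 hq).
have [hr1 hr2] := hr; have [hs1 hs2] := hs.
have [ri rK Kr] := dq_bij hX hZ hr; have [si sK Ks] := dq_bij hY hZ hs.
(* The candidate s^-1 o r exists on rational modules; its compatibilities are checked after applying
   the injective map of s, and fullness lifts it. *)
pose phi u := si (dQ X Z r u).
have phiE u : dQ Y Z s (phi u) = dQ X Z r u by rewrite /phi Ks.
have inj := can_inj sK.
have hphi : is_dmod_hom (@dlat _ _ _ D X) (@dlat _ _ _ D Y) (@dF _ _ _ D X) (@dV _ _ _ D X)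
    (@dF _ _ _ D Y) (@dV _ _ _ D Y) phi.
  split.
  - by move=> a v w; apply: inj; rewrite phiE !dq_linear // !phiE.
  - by move=> v; apply: inj; rewrite phiE !dq_F // phiE.
  - by move=> v; apply: inj; rewrite phiE !dq_V // phiE.
  - by move=> v /h[w hw e]; have -> : phi v = w by apply: inj; rewrite phiE.
have [g hg gE] := d_full hX hY hphi.
exists g; split; first exact: hg.
  apply/(d_isogeny D hX hY hg); exists (fun w => ri (dQ Y Z s w)) => v.
    by rewrite gE phiE rK.
  by rewrite gE; apply: inj; rewrite phiE Kr.
have hf := is_hom_fcomp hX hY hZ hg hs1.
apply: (qeqP (r := qpre s g) hX hZ hf hr1).2 => v.
by rewrite (dq_pre _ hg) gE phiE.
Qed.

End QuasiIsogenies.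

Section BaseChangeOfQuasiIsogenies.
Variables (L : local_fields) (R R' : fieldType) (W : witt L R) (W' : witt L R')
  (D : dieudonne W) (D' : dieudonne W') (j : witt_morph W W') (b : base_change D D' j).
Variables (X Y : fmod L R).
Hypotheses (hX : is_sfm W X) (hY : is_sfm W Y).
Local Notation X' := (map_fmod (mR j) X).
Local Notation Y' := (map_fmod (mR j) Y).

(** Finiteness of the kernel is not followed through the power series. It is replaced by bijectivity
    on rational Dieudonné modules, which is visible on base-changed bases. *)
Lemma isogeny_map (f : fpsmap R (fdim X) (fdim Y)) :
  is_hom (X := X) (Y := Y) f -> isogeny f -> isogeny (map_fpsmap (mR j) f).
Proof.
move=> hf if_; have hf' := is_hom_map (mR j) hf.
apply/(d_isogeny D' (bc_sfm b hX) (bc_sfm b hY) hf').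
have lin a v w := dmap_linear (D := D) hX hY a v w hf.
have lin' a v w := dmap_linear (D := D') (bc_sfm b hX) (bc_sfm b hY) a v w hf'.
have be := bc_vbasis b hX.
have bf := basis_image lin (dmap_bij D hX hY hf if_) (vbasisP {:diso D X}).
have bf' := bc_basis b hY bf.
apply: (bijective_of_basis lin' be).
congr (basis_of _ _): bf'; rewrite /= -!map_comp; apply: eq_map => v /=.
exact: bc_map.
Qed.

Lemma is_qisog_map (r : qmap R (fdim X) (fdim Y)) :
  is_qisog (X := X) (Y := Y) r ->
  is_qisog (X := X') (Y := Y') (map_qmap (mR j) r).
Proof.
by case=> h1 h2; split; [apply: is_hom_map | apply: isogeny_map].
Qed.

Lemma dq_map (r : qmap R (fdim X) (fdim Y)) (u : diso D X) :
  is_hom (X := X) (Y := Y) (qf r) ->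
  dq (X := X') (Y := Y') (map_qmap (mR j) r) (bc b u) = bc b (dq (X := X) (Y := Y) r u).
Proof.
move=> hr; rewrite /dq bcZ // rmorphXn fmorphV [mK j (wpi W)]mK_F.
by rewrite bc_map.
Qed.

End BaseChangeOfQuasiIsogenies.

(** * Points of the moduli space *)

Lemma phi0_embedding L (W0 : witt L (FqE L)) (phi0 : {rmorphism fldE L -> wK W0}) :
  is_phi0 phi0 -> conj_embedding phi0.
Proof.
move=> h; have [hf h2] := frob_phi0_conj h; have [z [hz _ zi z0]] := exists_conj_unit h.
by split=> //; [exact: phi0_int | exists z].
Qed.

Lemma conj_embedding_mK L R R' (W : witt L R) (W' : witt L R') (j : witt_morph W W')
    (phi : fldE L -> wK W) :
  conj_embedding phi -> conj_embedding (fun x => mK j (phi x)).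
Proof.
case=> hf hi [z [hz zi z0]] h2; split=> //.
- by move=> x; rewrite -mK_frob hf.
- by move=> x hx; apply: mK_int; apply: hi.
- exists z; rewrite -rmorphB -fmorphV fmorph_eq0; split=> //; exact: mK_int.
Qed.

Section Points.
Variables (L : local_fields) (W0 : witt L (FqE L)) (kappa k : fieldType)
  (Wkappa : witt L kappa) (Wk : witt L k)
  (j1 : witt_morph W0 Wkappa) (j2 : witt_morph Wkappa Wk)
  (D0 : dieudonne W0) (Dkappa : dieudonne Wkappa) (Dk : dieudonne Wk)
  (b1 : base_change D0 Dkappa j1) (b2 : base_change Dkappa Dk j2).
Variables (n m : nat) (h : nat -> nat) (X : nat -> hmod D0) (alpha : framing_isogenies X).
Hypothesis hX : is_framing n m h alpha.

Lemma Xkappa_sfm i : (1 <= i <= m)%N -> is_sfm Wkappa (Xkappa j1 X i).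
Proof. by move=> hi; apply: (bc_sfm b1); apply: (hm_sfm (fr_hmod hX hi)). Qed.

Lemma Xk_sfm i : (1 <= i <= m)%N -> is_sfm Wk (Xk j1 j2 X i).
Proof. by move=> hi; apply: (bc_sfm b2); apply: Xkappa_sfm. Qed.

Lemma act_kappa_hom i y : (1 <= i <= m)%N -> OE y ->
  is_hom (X := Xkappa j1 X i) (Y := Xkappa j1 X i) (act_kappa (j1 := j1) (X := X) (i := i) y).
Proof. by move=> hi hy; apply: is_hom_map; apply: (hm_hom (fr_hmod hX hi)). Qed.

Lemma act_k_hom i y : (1 <= i <= m)%N -> OE y ->
  is_hom (X := Xk j1 j2 X i) (Y := Xk j1 j2 X i) (act_k (j1 := j1) (j2 := j2) (X := X) (i := i) y).
Proof. by move=> hi hy; apply: is_hom_map; apply: act_kappa_hom. Qed.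

Hypothesis m_gt0 : (0 < m)%N.
Let m1 : (1 <= 1 <= m)%N. Proof. by rewrite leqnn. Qed.

Lemma Nkappa_unitary : unitary_isocrystal (Nkappa b1 X) n.
Proof.
have h1 := fr_hmod hX m1.
by have [] := base_change_unitary_isocrystal b1 (hm_sfm h1) (hm_hom h1)
  (hmod_unitary_isocrystal h1).
Qed.

Lemma Nk_unitary : unitary_isocrystal (Nk b1 b2 X) n /\
  isocrystal_extension (N := Nkappa b1 X) (N' := Nk b1 b2 X) j2 (bc b2 (X := Xkappa j1 X 1)).
Proof.
exact: (base_change_unitary_isocrystal b2 (Xkappa_sfm m1)
  (fun y hy => act_kappa_hom m1 hy) Nkappa_unitary).
Qed.

Section Frames.
Variable i : nat.
Hypothesis hi : (1 <= i <= m)%N.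
Local Notation al_kappa := (@alpha_kappa _ _ _ _ j1 _ X alpha i 1).
Local Notation al_k := (@alpha_k _ _ _ _ _ _ j1 j2 _ X alpha i 1).

Lemma alpha_index : (1 <= 1 <= i)%N /\ (i <= m)%N.
Proof. by case/andP: hi => h1 h2; rewrite leqnn h1 h2. Qed.

Lemma alpha_kappa_hom : is_hom (X := Xkappa j1 X i) (Y := Xkappa j1 X 1) al_kappa.
Proof. by case: alpha_index => h1 h2; apply: is_hom_map; apply: (fr_hom hX). Qed.

Lemma alpha_k_hom : is_hom (X := Xk j1 j2 X i) (Y := Xk j1 j2 X 1) al_k.
Proof. by apply: is_hom_map; apply: alpha_kappa_hom. Qed.

Lemma alpha_kappa_isogeny : isogeny al_kappa.
Proof.
have [h1 h2] := alpha_index.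
by apply: (isogeny_map b1 (hm_sfm (fr_hmod hX hi)) (hm_sfm (fr_hmod hX m1)));
  [apply: (fr_hom hX) | apply: (fr_isog hX)].
Qed.

Lemma alpha_k_isogeny : isogeny al_k.
Proof.
by apply: (isogeny_map b2 (Xkappa_sfm hi) (Xkappa_sfm m1));
  [apply: alpha_kappa_hom | apply: alpha_kappa_isogeny].
Qed.

Lemma alpha_k_act y : OE y ->
  fcomp al_k (act_k (j1 := j1) (j2 := j2) (X := X) (i := i) y) =
  fcomp (act_k (j1 := j1) (j2 := j2) (X := X) (i := 1) y) al_k.
Proof.
move=> hy; have [h1 h2] := alpha_index.
have E d1 d2 d3 (f : fpsmap (FqE L) d2 d3) (g : fpsmap (FqE L) d1 d2) :
    map_fpsmap (mR j2) (map_fpsmap (mR j1) (fcomp f g)) =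
    fcomp (map_fpsmap (mR j2) (map_fpsmap (mR j1) f)) (map_fpsmap (mR j2) (map_fpsmap (mR j1) g)).
  by rewrite !map_fcomp.
by apply: (etrans (esym (E _ _ _ _ _))); rewrite (fr_E hX) // E.
Qed.

(* The image in N_k of the Dieudonne module of a quasi-isogeny [r : Z -> Xk i]. *)
Definition to_Nk (Z : fmod L k) (r : qmap k (fdim Z) (fdim (Xk j1 j2 X i)))
    (u : diso Dk Z) : diso Dk (Xk j1 j2 X 1) :=
  dmap (X := Xk j1 j2 X i) (Y := Xk j1 j2 X 1) al_k (dq (X := Z) (Y := Xk j1 j2 X i) r u).

Lemma to_Nk_linear Z r a (v w : diso Dk Z) : is_sfm Wk Z ->
  is_hom (X := Z) (Y := Xk j1 j2 X i) (qf r) ->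
  to_Nk r (a *: v + w) = a *: to_Nk r v + to_Nk r w.
Proof.
move=> hZ hr; rewrite /to_Nk (dq_linear hZ (Xk_sfm hi)) //.
by rewrite (dmap_linear (Xk_sfm hi) (Xk_sfm m1)) //; apply: alpha_k_hom.
Qed.

Lemma alpha_k_bij : bijective (dmap (d := Dk) (X := Xk j1 j2 X i) (Y := Xk j1 j2 X 1) al_k).
Proof.
exact: (dmap_bij Dk (Xk_sfm hi) (Xk_sfm m1) alpha_k_hom alpha_k_isogeny).
Qed.

Lemma to_Nk_bij Z r : is_sfm Wk Z -> is_qisog (X := Z) (Y := Xk j1 j2 X i) r ->
  bijective (@to_Nk Z r).
Proof. by move=> hZ hr; apply: bij_comp alpha_k_bij (dq_bij Dk hZ (Xk_sfm hi) hr). Qed.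

Lemma to_Nk_V Z r (v : diso Dk Z) : is_sfm Wk Z ->
  is_hom (X := Z) (Y := Xk j1 j2 X i) (qf r) -> to_Nk r (dV v) = dV (to_Nk r v).
Proof.
move=> hZ hr; rewrite /to_Nk (dq_V hZ (Xk_sfm hi)) //.
exact: (dh_V (d_hom Dk (Xk_sfm hi) (Xk_sfm m1) alpha_k_hom)).
Qed.

(* [extend T] is the image in N_k of the Dieudonne module of X_T over k. *)
Lemma to_Nk_lattice_module (T : nV (Nkappa b1 X) -> Prop) (Y : fmod L kappa)
    (rho : qmap kappa (fdim Y) (fdim (Xkappa j1 X i))) (v : nV (Nk b1 b2 X)) :
  lattice_module (b1 := b1) alpha T rho ->
  extend (N := Nkappa b1 X) (N' := Nk b1 b2 X) (bc b2 (X := Xkappa j1 X 1)) T v <->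
  exists2 u, dlat u & v = to_Nk (Z := map_fmod (mR j2) Y) (map_qmap (mR j2) rho) u.
Proof.
case=> hY hrho hT; have hY' := bc_sfm b2 hY.
have hrho' := is_qisog_map b2 hY (Xkappa_sfm hi) hrho.
have lin a u w := @to_Nk_linear (map_fmod (mR j2) Y) (map_qmap (mR j2) rho) a u w hY' (proj1 hrho').
have bcE (u : diso Dkappa Y) :
    to_Nk (Z := map_fmod (mR j2) Y) (map_qmap (mR j2) rho) (bc b2 u) =
    bc b2 (dmap (X := Xkappa j1 X i) (Y := Xkappa j1 X 1) al_kappa
             (dq (X := Y) (Y := Xkappa j1 X i) rho u)).
  rewrite /to_Nk (dq_map b2 hY (Xkappa_sfm hi)); last by case: hrho.
  by rewrite (bc_map b2 _ (Xkappa_sfm hi) (Xkappa_sfm m1)) //; apply: alpha_kappa_hom.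
split.
  apply: (span_over_ind (M := fun v => exists2 u, dlat u & v = _)).
  - exists 0; first by apply/(bc_lat b2 _ hY); apply: span_over0.
    by rewrite (semilinear0 (c := id) lin).
  - move=> _ _ [u hu ->] [u' hu' ->]; exists (u + u').
      by apply: (latticeD (wW_dvr Wk) (dm_lattice (d_mod Dk hY'))).
    by rewrite (semilinearD (c := id) lin).
  (* The lattice of Y is described only through alpha, so t is first pulled back along this
     bijection. *)
  - move=> a _ ha [t ht ->].
    have [g _ Kg] := dmap_bij Dkappa (Xkappa_sfm hi) (Xkappa_sfm m1) alpha_kappa_hom
      alpha_kappa_isogeny.
    have := (hT (g t)).2; rewrite Kg => /(_ ht)[u hu gt].
    exists (a *: bc b2 u); last first.
      by rewrite (semilinearZ (c := id) lin) // bcE -gt Kg.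
    apply/(bc_lat b2 _ hY); exists 1%N, (fun=> a), (fun=> bc b2 u); split=> //.
      by exists u.
    by rewrite big_ord1.
case=> u /(bc_lat b2 _ hY)[N [a [s [ha hs ->]]]] ->.
exists N, a, (fun l => to_Nk (Z := map_fmod (mR j2) Y) (map_qmap (mR j2) rho) (s l)).
split=> // [l|].
  have [u' hu' ->] := hs l; rewrite bcE; eexists; last reflexivity.
  by apply/hT; exists u'.
rewrite (semilinear_sum (c := id) lin) //; apply: eq_bigr => l _.
exact: (semilinearZ (c := id) lin).
Qed.

End Frames.

Variable x : point j1 j2 Dk X.
Hypothesis hx : is_point b1 b2 n m alpha x.

Section OneIndex.
Variable i : nat.
Hypothesis hi : (1 <= i <= m)%N.
Local Notation M := (Mlat (b1 := b1) (b2 := b2) alpha x i).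

Lemma pX_sfm : is_sfm Wk (Defs.hX (pX x i)).
Proof. exact: hm_sfm (pt_hmod hx hi). Qed.

Let hom_rho : is_hom (X := Defs.hX (pX x i)) (Y := Xk j1 j2 X i) (qf (prho x i)).
Proof. by case: (pt_qisog hx hi). Qed.

Lemma Mlat_lattice : is_lattice (V := nV (Nk b1 b2 X)) (wW (w := Wk)) M.
Proof.
apply: (@is_lattice_image _ _ _ _ (to_Nk (prho x i))).
- by move=> a v w; apply: to_Nk_linear => //; apply: pX_sfm.
- by apply: to_Nk_bij => //; [apply: pX_sfm | apply: (pt_qisog hx)].
- exact: dm_lattice (d_mod Dk pX_sfm).
Qed.

Lemma Mlat_V v : M v -> M (nVer (i := Nk b1 b2 X) v).
Proof.
case=> u hu ->; exists (dV u); first exact: (dm_V_stable (d_mod Dk pX_sfm)).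
by apply/esym; apply: to_Nk_V => //; apply: pX_sfm.
Qed.

Lemma Mlat_E y v : OE y -> M v -> M (nE (i := Nk b1 b2 X) y v).
Proof.
move=> hy [u hu ->]; have hP := pX_sfm; have hact := hm_hom (pt_hmod hx hi) hy.
exists (dmap (X := Defs.hX (pX x i)) (Y := Defs.hX (pX x i)) (Defs.hact (pX x i) y) u).
  exact: (dh_lattice (d_hom Dk hP hP hact)).
have hs := Xk_sfm hi; have hs1 := Xk_sfm m1.
(* O_E acts on N_k through X^[1]; the action is moved across alpha by [alpha_k_act] and across rho
   by [pt_E]. *)
have /= e1 v := d_comp (d := Dk) hs hs hs1 (act_k_hom hi hy) (alpha_k_hom hi) v.
have /= e2 v := d_comp (d := Dk) hs hs1 hs1 (alpha_k_hom hi) (act_k_hom m1 hy) v.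
have /= e3 v := d_comp (d := Dk) hP hP hs hact hom_rho v.
have /= e4 v := d_comp (d := Dk) hP hs hs hom_rho (act_k_hom hi hy) v.
rewrite /nE /= -e2 -(alpha_k_act hi hy) e1; congr (dmap _ _).
rewrite /dq (dmapZ hs hs); last exact: act_k_hom.
by rewrite -e4 -(pt_E hx hi hy) e3.
Qed.

(** The inclusion is tested on T over kappa only: M is a W_{O_F}(k)-module, so it contains the image
    of T as soon as it contains the scalar extension, and conversely. *)
Lemma minus_isogeny_iff (T : nV (Nkappa b1 X) -> Prop) (Y : fmod L kappa)
    (rho : qmap kappa (fdim Y) (fdim (Xkappa j1 X i))) :
  lattice_module (b1 := b1) alpha T rho ->
  (exists g : fpsmap k (fdim (map_fmod (mR j2) Y)) (fdim (Defs.hX (pX x i))),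
     [/\ is_hom (X := map_fmod (mR j2) Y) (Y := Defs.hX (pX x i)) g, isogeny g
       & qeq (X := map_fmod (mR j2) Y) (Y := Xk j1 j2 X i)
           (qpre (prho x i) g) (map_qmap (mR j2) rho)])
  <-> (forall t, T t -> M (bc b2 (X := Xkappa j1 X 1) t)).
Proof.
move=> hT; have [hY hrho _] := hT.
have hrho' := is_qisog_map b2 hY (Xkappa_sfm hi) hrho.
apply: iff_trans (exists_isogeny_iff Dk (bc_sfm b2 hY) pX_sfm (Xk_sfm hi) hrho' (pt_qisog hx hi)) _.
split=> [h' t ht|h' u hu].
  have [u hu ->] := (to_Nk_lattice_module hi _ hT).1 (mem_extend (N' := Nk b1 b2 X) _ ht).
  by have [w hw e] := h' u hu; exists w; rewrite // /to_Nk e.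
have : extend (N := Nkappa b1 X) (N' := Nk b1 b2 X) (bc b2 (X := Xkappa j1 X 1)) T
    (to_Nk (Z := map_fmod (mR j2) Y) (map_qmap (mR j2) rho) u).
  by apply/(to_Nk_lattice_module hi _ hT); exists u.
have ML := Mlat_lattice.
have : incl (extend (N := Nkappa b1 X) (N' := Nk b1 b2 X) (bc b2 (X := Xkappa j1 X 1)) T) M.
  apply: span_over_ind.
  - exact: (lattice0 (wW_dvr Wk) ML).
  - by move=> v w; apply: (latticeD (wW_dvr Wk) ML).
  - by move=> a _ ha [t /h' ht ->]; apply: (latticeZ (wW_dvr Wk) ML).
(* The isogeny criterion lives in the module of X^[i] and the inclusion in that of X^[1];
   injectivity of alpha passes between them. *)
move=> H /H[w hw e]; exists w => //.
by apply: (bij_inj (alpha_k_bij hi)).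
Qed.

Lemma plus_isogeny_iff (T : nV (Nkappa b1 X) -> Prop) (Y : fmod L kappa)
    (rho : qmap kappa (fdim Y) (fdim (Xkappa j1 X i))) :
  lattice_module (b1 := b1) alpha T rho ->
  (exists g : fpsmap k (fdim (Defs.hX (pX x i))) (fdim (map_fmod (mR j2) Y)),
     [/\ is_hom (X := Defs.hX (pX x i)) (Y := map_fmod (mR j2) Y) g, isogeny g
       & qeq (X := Defs.hX (pX x i)) (Y := Xk j1 j2 X i)
           (qpre (map_qmap (mR j2) rho) g) (prho x i)])
  <-> incl M (extend (N := Nkappa b1 X) (N' := Nk b1 b2 X) (bc b2 (X := Xkappa j1 X 1)) T).
Proof.
move=> hT; have [hY hrho _] := hT.
have hrho' := is_qisog_map b2 hY (Xkappa_sfm hi) hrho.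
apply: iff_trans (exists_isogeny_iff Dk pX_sfm (bc_sfm b2 hY) (Xk_sfm hi) (pt_qisog hx hi) hrho') _.
split=> [h' _ [u hu ->]|h' u hu].
  have [w hw e] := h' u hu.
  by apply/(to_Nk_lattice_module hi _ hT); exists w; rewrite // /to_Nk e.
have Mu : M (to_Nk (prho x i) u) by exists u.
have [w hw e] := (to_Nk_lattice_module hi _ hT).1 (h' _ Mu); exists w => //.
by apply: (bij_inj (alpha_k_bij hi)).
Qed.

End OneIndex.
End Points.

Theorem proposition3p4
  (L : local_fields)
  (W0 : witt L (FqE L)) (phi0 : {rmorphism fldE L -> wK W0})
  (hphi0 : is_phi0 phi0)
  (kappa k : fieldType) (Wkappa : witt L kappa) (Wk : witt L k)
  (hkappa : is_alg_closure (Fq_emb Wkappa)) (hk : alg_closed k)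
  (j1 : witt_morph W0 Wkappa) (j2 : witt_morph Wkappa Wk)
  (D0 : dieudonne W0) (Dkappa : dieudonne Wkappa) (Dk : dieudonne Wk)
  (b1 : base_change D0 Dkappa j1) (b2 : base_change Dkappa Dk j2)
  (delta : wK W0)
  (hdelta : [/\ delta != 0, wW delta, wW delta^-1 & frob W0 delta = - delta])
  (n m : nat) (hn : (0 < n)%N) (hm : (0 < m)%N)
  (h : nat -> nat)
  (hlt : forall i, (1 <= i < m)%N -> (h i < h i.+1)%N)
  (hle : forall i, (1 <= i <= m)%N -> (h i <= n)%N)
  (hpar : forall i i', (1 <= i <= m)%N -> (1 <= i' <= m)%N ->
     odd (h i) = odd (h i'))
  (X : nat -> hmod D0) (alpha : framing_isogenies X)
  (hX : is_framing n m h alpha)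
  (I : {set 'I_m.+1})
  (La0 La1 : nat -> nV (Nkappa b1 X) -> Prop)
  (hI : BT_index (phi_kappa j1 phi0) (delta_kappa j1 delta) j1 n h I La0 La1)
  (Y : lattice_modules alpha phi0 delta I La0 La1)
  (x : point j1 j2 Dk X) (hx : is_point b1 b2 n m alpha x) :
  in_closed_subscheme Y x
  <->
  (forall i : 'I_m.+1, i \in I -> (0 < i)%N ->
     incl (scale_set (wpi Wk) (lat_k b2 (dualkappa phi0 delta (La0 i))))
          (scale_set (wpi Wk) (dualk phi0 delta (Blat b1 b2 alpha phi0 x i)))
     /\ incl (Blat b1 b2 alpha phi0 x i) (lat_k b2 (La0 i)))
  /\
  (forall j : 'I_m.+1, j \in I -> (j < m)%N ->
     incl (scale_set (wpi Wk ^+ 2) (lat_k b2 (dualkappa phi0 delta (La1 j))))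
          (scale_set (wpi Wk ^+ 2) (dualk phi0 delta (Alat b1 b2 alpha phi0 x j.+1)))
     /\ incl (Alat b1 b2 alpha phi0 x j.+1) (lat_k b2 (La1 j))).
Proof.
have e0 := phi0_embedding hphi0.
have e1 := conj_embedding_mK j1 e0; have e2 := conj_embedding_mK j2 e1.
have uN := Nkappa_unitary b1 hX hm.
have [uN' ext] := Nk_unitary b1 b2 hX hm.
have im (i : 'I_m.+1) : (0 < i)%N -> (1 <= i <= m)%N.
  by move=> ->; rewrite -ltnS ltn_ord.
have minusP (i : 'I_m.+1) : i \in I -> (0 < i)%N ->
    (exists g : fpsmap k (fdim (map_fmod (mR j2) (Xm Y i))) (fdim (Defs.hX (pX x i))),
     [/\ is_hom (X := map_fmod (mR j2) (Xm Y i)) (Y := Defs.hX (pX x i)) g, isogeny g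
       & qeq (X := map_fmod (mR j2) (Xm Y i)) (Y := Xk j1 j2 X i)
           (qpre (prho x i) g) (map_qmap (mR j2) (rhom Y i))]) <->
    incl (scale_set (wpi Wk) (lat_k b2 (dualkappa phi0 delta (La0 i))))
         (scale_set (wpi Wk) (dualk phi0 delta (Blat b1 b2 alpha phi0 x i)))
     /\ incl (Blat b1 b2 alpha phi0 x i) (lat_k b2 (La0 i)).
  (* The basis of C that spans Lambda_0^i over W_{O_F}(F_{q^2}) is the input for the duality
     argument. *)
  move=> iI i0; have [[[e [eC eg eL]] _ _] _] := bt_La0 hI iI i0.
  apply: iff_trans (minus_isogeny_iff hX hm hx (im i i0) (Xm_lattice Y iI i0)) _.
  apply: (lat_minus_criterion hphi0 uN uN' e1 e2 ext hdelta eC eg eL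
    (Mlat_lattice hX hm hx (im i i0))).
    by move=> v; apply: (Mlat_V hX hm hx (im i i0)).
  by move=> y v; apply: (Mlat_E hX hm hx (im i i0)).
have plusP (j : 'I_m.+1) : j \in I -> (j < m)%N ->
    (exists g : fpsmap k (fdim (Defs.hX (pX x j.+1))) (fdim (map_fmod (mR j2) (Xp Y j))),
     [/\ is_hom (X := Defs.hX (pX x j.+1)) (Y := map_fmod (mR j2) (Xp Y j)) g, isogeny g
       & qeq (X := Defs.hX (pX x j.+1)) (Y := Xk j1 j2 X j.+1)
           (qpre (map_qmap (mR j2) (rhop Y j)) g) (prho x j.+1)]) <->
    incl (scale_set (wpi Wk ^+ 2) (lat_k b2 (dualkappa phi0 delta (La1 j))))
         (scale_set (wpi Wk ^+ 2) (dualk phi0 delta (Alat b1 b2 alpha phi0 x j.+1)))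
     /\ incl (Alat b1 b2 alpha phi0 x j.+1) (lat_k b2 (La1 j)).
  move=> jI jm; have [[[e [eC eg eL]] _ _] _] := bt_La1 hI jI jm.
  have hj : (1 <= j.+1 <= m)%N by [].
  apply: iff_trans (plus_isogeny_iff hX hm hx hj (Xp_lattice Y jI jm)) _.
  apply: (lat_plus_criterion hphi0 delta uN uN' e1 e2 ext eC eg eL
    (Mlat_lattice hX hm hx hj)).
    by move=> v; apply: (Mlat_V hX hm hx hj).
  by move=> y v; apply: (Mlat_E hX hm hx hj).
by split=> -[h0 h1]; split=> i hi hi'; try (by apply/minusP => //; apply: h0);
  apply/plusP => //; apply: h1.
Qed.
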